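(* Let $n\ge 1$ and $s\in\{1,\dots,1+n\}$, and let $M_{\mathrm{red}}$ be the associated reduced (pseudo-)Kähler manifold. Then the formula $$f\star_{\mathrm{red}} g=\sum_{r=0}^\infty \frac{1}{r!}\,\frac{\lambda^r}{(1-\lambda)(1-2\lambda)\cdots(1-(r-1)\lambda)}\,\big\langle (D^{\mathrm{sym}}_{\mathrm{red}})^r f\otimes (D^{\mathrm{sym}}_{\mathrm{red}})^r g\,,\,H_{\mathrm{red}}^r\big\rangle ,\qquad f,g\in C^\infty(M_{\mathrm{red}})$$ (extended $\mathbb C[[\lambda]]$-bilinearly to $C^\infty(M_{\mathrm{red}})[[\lambda]]$) defines a formal star product on $M_{\mathrm{red}}$, where $D^{\mathrm{sym}}_{\mathrm{red}}$ is the symmetrized covariant derivative associated to the Levi-Civita connection of $M_{\mathrm{red}}$ and $H_{\mathrm{red}}$ is the bivector field on $M_{\mathrm{red}}$ given in the context.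
   Context: Setting. Let $\nu_k=+1$ for $0\le k\le s-1$ and $\nu_k=-1$ for $s\le k\le n$. On $\mathbb C^{1+n}$ with standard coordinates $z^0,\dots,z^n$ put $J=\sum_{k=0}^n\nu_k z^k\bar z^k$, $Z=J^{-1}(\{1\})$, and $M_{\mathrm{red}}=Z/U(1)$ ($U(1)$ acting by scalar multiplication). $M_{\mathrm{red}}$ is identified with the open complex submanifold $\{[\rho]\in\mathbb{CP}^n: J(\rho)>0\}$ of $\mathbb{CP}^n$. On the dense open subset $\{\rho^0\ne0\}$ use the complex coordinates $w^k([\rho])=\rho^k/\rho^0$, $k=1,\dots,n$. All functions and tensor fields are complex-valued, $C^\infty(M)$ denotes complex-valued smooth functions, tangent bundles are complexified. Bivector field. $H_{\mathrm{red}}$ is the smooth section of $T^{(0,1)}M_{\mathrm{red}}\otimes T^{(1,0)}M_{\mathrm{red}}$ which at $[\rho]$ (with representative $\rho\in Z$) is the image of $\sum_{k=0}^n\nu_k\frac{\partial}{\partial\bar z^k}\otimes\frac{\partial}{\partial z^k}\big|_\rho$ under the tangent map (applied to both factors) of $\{J>0\}\to M_{\mathrm{red}}$, $\rho\mapsto[\rho]$. In the coordinates $w$, $$H_{\mathrm{red}}=\Big(1+\sum_{k}\nu_k\bar w^kw^k\Big)\Big(\sum_{k,\ell=1}^n\bar w^kw^\ell\frac{\partial}{\partial\bar w^k}\otimes\frac{\partial}{\partial w^\ell}+\sum_{k=1}^n\nu_k\frac{\partial}{\partial\bar w^k}\otimes\frac{\partial}{\partial w^k}\Big).$$ Metric.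 With $\alpha\vee\beta=\frac12(\alpha\otimes\beta+\beta\otimes\alpha)$ for 1-forms, the (not necessarily definite) metric of $M_{\mathrm{red}}$ is the smooth tensor field $g_{\mathrm{red}}$ given in the coordinates $w$ by $$g_{\mathrm{red}}=\frac{\sum_k\nu_k\,d\bar w^k\vee dw^k}{1+\sum_k\nu_k\bar w^kw^k}-\frac{\sum_{k,\ell}\nu_k\nu_\ell\,\bar w^\ell w^k\,d\bar w^k\vee dw^\ell}{(1+\sum_k\nu_k\bar w^kw^k)^2}.$$ Symmetrized covariant derivative. Symmetric covariant tensor fields form an algebra with product $\alpha\vee\beta=\mathrm{Sym}(\alpha\otimes\beta)$, where $\mathrm{Sym}$ is the averaging projection over permutations. For a torsion-free covariant derivative $\nabla$, the symmetrized covariant derivative is, in local coordinates, $D^{\mathrm{sym}}\omega=\sum_i dx^i\vee\nabla_{\partial/\partial x^i}\omega$ (a derivation of degree $1$ with $D^{\mathrm{sym}}f=df$). Pairing. If $H=\sum H^{ab}\partial_a\otimes\partial_b$ in local coordinates and $\alpha,\beta$ are symmetric $r$-fold covariant tensor fields, then $\langle\alpha\otimes\beta,H^r\rangle=\sum H^{a_1b_1}\cdots H^{a_rb_r}\,\alpha_{a_1\dots a_r}\,\beta_{b_1\dots b_r}$. Formal star product. For a Poisson manifold $M$, a formal star product is an associative $\mathbb C[[\lambda]]$-bilinear product $\star$ on $C^\infty(M)[[\lambda]]$ with the constant function $1$ as unit, of the form $f\star g=\sum_{r\ge0}\lambda^rC_r(f,g)$ with bidifferential operators $C_r$, $C_0(f,g)=fg$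 and $C_1(f,g)-C_1(g,f)=\mathrm i\{f,g\}$. Here the Poisson bracket on $M_{\mathrm{red}}$ is $\{f,g\}_{\mathrm{red}}=\frac1{\mathrm i}\big(\langle df\otimes dg,H_{\mathrm{red}}\rangle-\langle dg\otimes df,H_{\mathrm{red}}\rangle\big)$. *)

(* Defs.v *)
From HB Require Import structures.
From mathcomp Require Import all_boot all_order all_algebra.
From mathcomp Require Import all_fingroup generic_quotient complex ring.
From mathcomp Require Import all_classical all_reals all_analysis.

Set Implicit Arguments.
Unset Strict Implicit.
Unset Printing Implicit Defensive.

Import Order.TTheory GRing.Theory Num.Theory numFieldNormedType.Exports.
Local Open Scope quotient_scope.
Local Open Scope classical_set_scope.
Local Open Scope ring_scope.

(* R[i] packed as a numClosedFieldType, so that its norm topology and the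
   product topology on row vectors are found by unification. *)
Definition Cplx (R : realType) : numClosedFieldType := R[i].

Section Calculus.
Variables (R : realType) (m : nat).
Local Notation C := (Cplx R).
Implicit Types (F : 'rV[C]_m -> C) (U : set 'rV[C]_m) (w v : 'rV[C]_m).

Definition line w v (t : R) : 'rV[C]_m := w + (real_complex R t : C) *: v.

Definition dirD v F w : C :=
  Complex (derive1 (fun t : R => complex.Re (F (line w v t))) 0)
          (derive1 (fun t : R => complex.Im (F (line w v t))) 0).

(* The coordinate directions of the real vector space underlying C^m:
   inl k is d/dx^k and inr k is d/dy^k, where z^k = x^k + i y^k. *)
Definition rdir (a : 'I_m + 'I_m) : 'rV[C]_m :=
  match a with inl k => delta_mx 0 k | inr k => 'i *: delta_mx 0 k end.

Definition smooth_on U F : Prop :=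
  forall (s : seq ('I_m + 'I_m)) w, U w ->
    let G := foldr (fun a => dirD (rdir a)) F s in
    {for w, continuous G} /\
    forall a, derivable (fun t : R => complex.Re (G (line w (rdir a) t))) 0 1 /\
              derivable (fun t : R => complex.Im (G (line w (rdir a) t))) 0 1.

(* Indices of the complexified coordinate frame: inl k stands for z^k and
   inr k for its conjugate, so that [pd] is the Wirtinger derivative. *)
Definition idx : finType := ('I_m + 'I_m)%type.

Definition pd (a : idx) F w : C :=
  match a with
  | inl k => 2^-1 * (dirD (rdir (inl k)) F w - 'i * dirD (rdir (inr k)) F w)
  | inr k => 2^-1 * (dirD (rdir (inl k)) F w + 'i * dirD (rdir (inr k)) F w)
  end.

End Calculus.

Section Tensors.
Variables (R : realType) (n : nat).
Local Notation C := (Cplx R).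
Local Notation idx := (idx n).

(* Components, with respect to the complexified coordinate frame, of a
   covariant r-tensor field on a coordinate domain of C^n. *)
Definition tensor (r : nat) := 'rV[C]_n -> {ffun 'I_r -> idx} -> C.

Definition tens p q (al : tensor p) (be : tensor q) : tensor (p + q) :=
  fun w I => al w [ffun i => I (lshift q i)] * be w [ffun i => I (rshift p i)].

Definition Sym r (om : tensor r) : tensor r :=
  fun w I => (r`!%:R)^-1 * \sum_(sg : 'S_r) om w [ffun i => I (sg i)].

Definition vee p q (al : tensor p) (be : tensor q) : tensor (p + q) :=
  Sym (tens al be).

Definition dcoord (a : idx) : tensor 1 := fun _ I => (I ord0 == a)%:R.

Definition scal (f : 'rV[C]_n -> C) : tensor 0 := fun w _ => f w.

(* [Gam w c a b] is the coefficient of d_c in the covariant derivative of the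
   frame field d_b along d_a. *)
Definition christoffel := 'rV[C]_n -> idx -> idx -> idx -> C.

Definition nabla (Gam : christoffel) (a : idx) r (om : tensor r) : tensor r :=
  fun w I => pd a (fun w' => om w' I) w -
    \sum_(i < r) \sum_(c : idx)
      Gam w c a (I i) * om w [ffun l => if l == i then c else I l].

Definition Dsym (Gam : christoffel) r (om : tensor r) : tensor r.+1 :=
  fun w I => \sum_(a : idx) vee (dcoord a) (nabla Gam a om) w I.

Fixpoint Dsym_iter (Gam : christoffel) r (f : 'rV[C]_n -> C) : tensor r :=
  match r with
  | 0%N => scal f
  | r'.+1 => Dsym Gam (@Dsym_iter Gam r' f)
  end.

Definition diff0 (f : 'rV[C]_n -> C) : tensor 1 := fun w I => pd (I ord0) f w.

Definition bivector := 'rV[C]_n -> idx -> idx -> C.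

Definition pairing r (al be : tensor r) (H : bivector) (w : 'rV[C]_n) : C :=
  \sum_(A : {ffun 'I_r -> idx}) \sum_(B : {ffun 'I_r -> idx})
    (\prod_(i < r) H w (A i) (B i)) * al w A * be w B.

Definition torsion_free (U : set 'rV[C]_n) (Gam : christoffel) : Prop :=
  forall w, U w -> forall a b c, Gam w c a b = Gam w c b a.

Definition metric_compatible (U : set 'rV[C]_n) (g : tensor 2)
    (Gam : christoffel) : Prop :=
  forall w, U w -> forall a I, nabla Gam a g w I = 0.

End Tensors.

Section ReducedManifold.
Variables (R : realType) (n s : nat).
Local Notation C := (Cplx R).
Local Notation idx := (idx n).
Implicit Types (z : 'rV[C]_n.+1) (w : 'rV[C]_n) (j : 'I_n.+1).

Definition nu (k : 'I_n.+1) : C := if (k < s)%N then 1 else -1.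

Definition Jfun z : C := \sum_k nu k * (z 0 k * (z 0 k)^*).

Definition Zlevel := {z : 'rV[C]_n.+1 | Jfun z == 1}.

Definition U1_rel : rel Zlevel := fun x y =>
  `[< exists u : C, `|u| = 1 /\ val y = u *: val x >].

Lemma U1_rel_equiv : equiv_class_of U1_rel.
Proof.
split=> [x|x y|y x z].
- by apply/asboolP; exists 1; rewrite normr1 scale1r.
- apply: asbool_equiv_eq; split=> -[u [u1 e]]; exists u^-1;
    (have u0 : u != 0 by rewrite -normr_eq0 u1 oner_eq0);
    by rewrite normfV u1 invr1 e scalerA mulVf // scale1r.
- move=> /asboolP[u [u1 e]] /asboolP[v [v1 e']]; apply/asboolP.
  by exists (v * u); rewrite normrM u1 v1 mulr1 e' e scalerA.
Qed.

Canonical U1_equiv := EquivRelPack U1_rel_equiv.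

Definition Mred := {eq_quot U1_equiv}.

(* The projection [z |-> [z]] of {J > 0} onto Z / U(1); None when J z <= 0. *)
Definition projM z : option Mred :=
  omap (fun x : Zlevel => \pi_Mred x) (insub ((sqrtC (Jfun z))^-1 *: z)).

(* The chart of CP^n on {z^j != 0}; j = 0 is the chart w^k = z^k / z^0, where
   [lift j] skips the index j. *)
Definition hcoord j z : 'rV[C]_n := \row_k (z 0 (lift j k) / z 0 j).

Definition chart_dom j (p : Mred) : bool := val (repr p) 0 j != 0.
Definition chart j (p : Mred) : 'rV[C]_n := hcoord j (val (repr p)).

(* The section of [hcoord j] with j-th coordinate 1. *)
Definition sec j w : 'rV[C]_n.+1 :=
  \row_i (if unlift j i is Some k then w 0 k else 1).

Definition chart_img j : set 'rV[C]_n := [set w | 0 < Jfun (sec j w)].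

(* Coordinate expression of a function on Mred, extended by 0 outside of the
   open set [chart_img j]. *)
Definition loc j (f : Mred -> C) w : C := oapp f 0 (projM (sec j w)).

Definition smoothM (f : Mred -> C) : Prop :=
  forall j, smooth_on (chart_img j) (loc j f).

(* Function on Mred determined by coordinate expressions in the charts; the
   chart used at a point is immaterial when [chart_independent] holds. *)
Definition glue (u : 'I_n.+1 -> 'rV[C]_n -> C) (p : Mred) : C :=
  let j := odflt ord0 [pick j | chart_dom j p] in u j (chart j p).

Definition chart_independent (u : 'I_n.+1 -> 'rV[C]_n -> C) : Prop :=
  forall p j k, chart_dom j p -> chart_dom k p ->
    u j (chart j p) = u k (chart k p).

Definition cxcoord j (a : idx) z : C :=
  match a with
  | inl k => hcoord j z 0 k
  | inr k => (hcoord j z 0 k)^*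
  end.

Definition repZ j w : 'rV[C]_n.+1 := (sqrtC (Jfun (sec j w)))^-1 *: sec j w.

(* The component along d_a (x) d_b of a pushforward is obtained by letting the
   two factors act on the coordinate functions number a and b. *)
Definition Hred j : bivector R n := fun w a b =>
  \sum_(k < n.+1) nu k * pd (inr k) (cxcoord j a) (repZ j w)
                       * pd (inl k) (cxcoord j b) (repZ j w).

(* [Jfun (sec j w)] is nu_j + sum_k nu_k |w^k|^2. Chart 0 is the defining
   expression; the one in chart j only differs by nu_j, and both are the
   expressions of a single tensor field by [gred_transition]. *)
Definition gred j : tensor R n 2 := fun w I =>
  (\sum_(k < n) nu (lift j k) *
      @vee R n 1 1 (@dcoord R n (inr k)) (@dcoord R n (inl k)) w I)
    / Jfun (sec j w)
  - (\sum_(k < n) \sum_(l < n)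
      nu (lift j k) * nu (lift j l) * ((w 0 l)^* * w 0 k) *
      @vee R n 1 1 (@dcoord R n (inr k)) (@dcoord R n (inl l)) w I)
    / Jfun (sec j w) ^+ 2.

(* The connection is given by its Christoffel symbols in each chart. *)
Definition levi_civita (g : 'I_n.+1 -> tensor R n 2)
    (Gam : 'I_n.+1 -> christoffel R n) : Prop :=
  forall j, torsion_free (chart_img j) (Gam j) /\
            metric_compatible (chart_img j) (g j) (Gam j).

Definition Dpairing (Gam : 'I_n.+1 -> christoffel R n) (r : nat)
    (f g : Mred -> C) : 'I_n.+1 -> 'rV[C]_n -> C := fun j =>
  pairing (@Dsym_iter R n (Gam j) r (loc j f))
          (@Dsym_iter R n (Gam j) r (loc j g))
          (Hred j).

Definition poisson_red (f g : Mred -> C) : Mred -> C :=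
  glue (fun j w =>
    'i^-1 * (pairing (diff0 (loc j f)) (diff0 (loc j g)) (Hred j) w -
             pairing (diff0 (loc j g)) (diff0 (loc j f)) (Hred j) w)).

End ReducedManifold.

Section FormalSeries.
Variables (R : realType).
Local Notation C := (Cplx R).

(* A formal power series is the sequence of its coefficients. *)
Definition fps (A : Type) := nat -> A.

Definition fps_one : fps C := fun m => (m == 0%N)%:R.
Definition fps_lam (r : nat) : fps C := fun m => (m == r)%:R.
Definition fps_mul (a b : fps C) : fps C :=
  fun m => \sum_(i < m.+1) a i * b (m - i)%N.

(* The inverse of 1 - k lambda, see [fps_geomP]. *)
Definition fps_geom (k : nat) : fps C := fun m => k%:R ^+ m.

Lemma fps_geomP k :
  fps_mul (fun m => fps_one m - k%:R * fps_lam 1 m) (fps_geom k) = fps_one.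
Proof.
apply/funext=> -[|m]; rewrite /fps_mul /fps_one /fps_lam /fps_geom.
  by rewrite big_ord_recl big_ord0 /= mulr0 subr0 addr0 mul1r expr0.
rewrite big_ord_recl big_ord_recl big1 /= => [|i _].
  by rewrite mulr0 subr0 mul1r sub0r mulr1 addr0 /bump /= subn1 exprS mulNr subrr.
by rewrite /bump /= !add1n /= mulr0 subr0 mul0r.
Qed.

Definition coef_red (r : nat) : fps C :=
  fps_mul (fps_lam r) (\big[fps_mul/fps_one]_(1 <= k < r) fps_geom k).

End FormalSeries.

Section StarProducts.
Variables (R : realType) (n s : nat).
Local Notation C := (Cplx R).
Local Notation M := (Mred R n s).
Local Notation fctM := (M -> C).
Implicit Types (f g h : fctM) (F G : fps fctM) (a : fps C).

Definition smooth_fps F : Prop := forall m, smoothM (F m).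

Definition fps_const f : fps fctM := fun m p => if m is 0%N then f p else 0.

Definition fps_addM F G : fps fctM := fun m p => F m p + G m p.
Definition fps_scaleM a F : fps fctM :=
  fun m p => \sum_(i < m.+1) a i * F (m - i)%N p.

(* C[[lambda]]-bilinear extension of a product of functions with values in
   formal series. *)
Definition fps_extend (B : fctM -> fctM -> fps fctM)
    (F G : fps fctM) : fps fctM := fun m p =>
  \sum_(i < m.+1) \sum_(j < m.+1 | (i + j <= m)%N)
    B (F i) (G j) (m - (i + j))%N p.

Definition bidifferential (B : fctM -> fctM -> fctM) : Prop :=
  (forall f g, smoothM f -> smoothM g -> smoothM (B f g)) /\
  forall j : 'I_n.+1, exists (N : nat)
      (c : seq (idx n) -> seq (idx n) -> 'rV[C]_n -> C),
    (forall I K, smooth_on (chart_img s j) (c I K)) /\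
    forall f g, smoothM f -> smoothM g -> forall w, chart_img s j w ->
      loc j (B f g) w =
      \sum_(p < N.+1) \sum_(q < N.+1)
        \sum_(I : p.-tuple (idx n)) \sum_(K : q.-tuple (idx n))
          c I K w * foldr (@pd R n) (loc j f) I w
                  * foldr (@pd R n) (loc j g) K w.

Definition is_poisson_bracket (br : fctM -> fctM -> fctM) : Prop :=
  [/\ (forall f g, smoothM f -> smoothM g -> smoothM (br f g)),
      (forall (c : C) f g h, smoothM f -> smoothM g -> smoothM h ->
         br (fun p => c * f p + g p) h = fun p => c * br f h p + br g h p),
      (forall f g, smoothM f -> smoothM g -> br f g = fun p => - br g f p),
      (forall f g h, smoothM f -> smoothM g -> smoothM h ->
         br f (fun p => g p * h p) = fun p => br f g p * h p + g p * br f h p) &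
      (forall f g h, smoothM f -> smoothM g -> smoothM h ->
         forall p, br f (br g h) p + br g (br h f) p + br h (br f g) p = 0)].

Definition is_formal_star_product (br : fctM -> fctM -> fctM)
    (star : fps fctM -> fps fctM -> fps fctM) : Prop :=
  [/\ is_poisson_bracket br,
      (forall F G K : fps fctM, smooth_fps F -> smooth_fps G -> smooth_fps K ->
         star (star F G) K = star F (star G K)),
      (forall a (F G K : fps fctM), smooth_fps F -> smooth_fps G -> smooth_fps K ->
         star (fps_addM (fps_scaleM a F) G) K =
           fps_addM (fps_scaleM a (star F K)) (star G K) /\
         star K (fps_addM (fps_scaleM a F) G) =
           fps_addM (fps_scaleM a (star K F)) (star K G)),
      (forall F, smooth_fps F ->
         star (fps_const (fun _ => 1)) F = F /\
         star F (fps_const (fun _ => 1)) = F) &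
      exists Cr : nat -> fctM -> fctM -> fctM,
        [/\ (forall r, bidifferential (Cr r)),
            (forall F G, smooth_fps F -> smooth_fps G ->
               star F G = fps_extend (fun f g r => Cr r f g) F G),
            (forall f g, smoothM f -> smoothM g ->
               Cr 0%N f g = fun p => f p * g p) &
            (forall f g, smoothM f -> smoothM g -> forall p,
               Cr 1%N f g p - Cr 1%N g f p = 'i * br f g p)]].

(* The r-th summand of the series only has terms of order >= r in lambda. *)
Definition star_red (Gam : 'I_n.+1 -> christoffel R n) :
    fps fctM -> fps fctM -> fps fctM :=
  fps_extend (fun f g m p =>
    \sum_(r < m.+1) (r`!%:R)^-1 * coef_red R r m * glue (Dpairing Gam r f g) p).

End StarProducts.

(* Checks of the definitions above: the tensor law for [gred] and its expression
   in chart 0, the coordinate expression of [Hred], and the existence of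
   Christoffel symbols satisfying [levi_civita]. *)

Lemma is_derive_quot (R : realType) (a1 a2 l1 l2 b1 b2 m1 m2 : R) :
  b1 ^+ 2 + b2 ^+ 2 != 0 ->
  let n t := (b1 + t * m1) ^+ 2 + (b2 + t * m2) ^+ 2 in
  let p t := (a1 + t * l1) * (b1 + t * m1) + (a2 + t * l2) * (b2 + t * m2) in
  is_derive (0 : R) (1 : R) (fun t => p t / n t)
   (((l1 * b1 + a1 * m1 + l2 * b2 + a2 * m2) * (b1 ^+ 2 + b2 ^+ 2) -
     (a1 * b1 + a2 * b2) * 2 * (b1 * m1 + b2 * m2)) / (b1 ^+ 2 + b2 ^+ 2) ^+ 2).
Proof.
move=> b0 n p.
have dD (f g : R -> R) (df dg : R) : is_derive (0 : R) (1 : R) f df ->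
    is_derive (0 : R) (1 : R) g dg ->
    is_derive (0 : R) (1 : R) (fun t => f t + g t) (df + dg).
  by move=> ? ?; exact: is_deriveD.
have dM (f g : R -> R) (df dg : R) : is_derive (0 : R) (1 : R) f df ->
    is_derive (0 : R) (1 : R) g dg ->
    is_derive (0 : R) (1 : R) (fun t => f t * g t) (f 0 * dg + g 0 * df).
  by move=> ? ?; exact: is_deriveM.
have dl : forall x y : R, is_derive (0 : R) (1 : R) (fun t => x + t * y) y.
  move=> x y.
  apply: (@is_derive_eq _ _ _ _ _ _ _ (0 + (0 * 0 + y * 1))); last by ring.
have n0 : n 0 = b1 ^+ 2 + b2 ^+ 2 by rewrite /n !mul0r !addr0.
have dn := dD _ _ _ _ (dM _ _ _ _ (dl b1 m1) (dl b1 m1)) (dM _ _ _ _ (dl b2 m2) (dl b2 m2)).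
have dp := dD _ _ _ _ (dM _ _ _ _ (dl a1 l1) (dl b1 m1)) (dM _ _ _ _ (dl a2 l2) (dl b2 m2)).
have n0' : n 0 != 0 by rewrite n0.
have dV := @is_deriveV _ n 0 _ 1 n0' dn.
have H := dM _ _ _ _ dp dV.
have E : forall x y : R, x = y -> is_derive (0 : R) (1 : R) (fun t => p t / n t) x -> is_derive (0 : R) (1 : R) (fun t => p t / n t) y by move=> x y ->.
apply: E H.
rewrite n0 !mul0r !addr0 /GRing.scale /=; field.
by rewrite b0.
Qed.

Lemma drv_eq (R : realType) (f : R -> R) (x y : R) : is_derive (0 : R) (1 : R) f x -> x = y ->
  is_derive (0 : R) (1 : R) f y.
Proof. by move=> ? <-. Qed.

Lemma is_derive_quotC (R : realType) (a b al be : Cplx R) (F : R -> Cplx R) :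
  b != 0 ->
  (forall t, F t = (a + (real_complex R t : Cplx R) * al) / (b + (real_complex R t : Cplx R) * be)) ->
  let D := (al * b - a * be) / b ^+ 2 in
  is_derive (0 : R) (1 : R) (fun t => complex.Re (F t)) (complex.Re D) /\
  is_derive (0 : R) (1 : R) (fun t => complex.Im (F t)) (complex.Im D).
Proof.
case: a b al be => [a1 a2] [b1 b2] [l1 l2] [m1 m2] b0 FE D.
have nb : b1 ^+ 2 + b2 ^+ 2 != 0.
  apply: contraNneq b0 => /eqP; rewrite paddr_eq0 ?sqr_ge0// !sqrf_eq0.
  by move=> /andP[/eqP-> /eqP->].
have HF : F = fun t => (Complex (a1 + t * l1) (a2 + t * l2) : R[i]) / (Complex (b1 + t * m1) (b2 + t * m2)).
  apply/funext => t; rewrite FE; congr (_ / _); apply/eqP;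
  rewrite eq_complex /=; apply/andP; split; apply/eqP; ring.
have HD : D = ((Complex (l1 * b1 - l2 * b2 - (a1 * m1 - a2 * m2)) (l1 * b2 + l2 * b1 - (a1 * m2 + a2 * m1)) : R[i]) / (Complex (b1 ^+ 2 - b2 ^+ 2) (2 * b1 * b2)) : R[i]).
  rewrite /D; congr (_ / _); apply/eqP; rewrite ?expr2 eq_complex /=; apply/andP; split; apply/eqP; ring.
have nn : (b1 ^+ 2 - b2 ^+ 2) ^+ 2 + (2 * b1 * b2) ^+ 2 = (b1 ^+ 2 + b2 ^+ 2) ^+ 2 by ring.
rewrite HF HD /= nn; split.
- rewrite [X in is_derive _ _ X _](_ : _ = fun t => ((a1 + t * l1) * (b1 + t * m1) + (a2 + t * l2) * (b2 + t * m2)) / ((b1 + t * m1) ^+ 2 + (b2 + t * m2) ^+ 2)); last by apply/funext => t; ring.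
  apply: (drv_eq (@is_derive_quot R _ _ _ _ _ _ _ _ nb)); field; exact: nb.
- rewrite [X in is_derive _ _ X _](_ : _ = fun t => ((a2 + t * l2) * (b1 + t * m1) + (- a1 + t * - l1) * (b2 + t * m2)) / ((b1 + t * m1) ^+ 2 + (b2 + t * m2) ^+ 2)); last by apply/funext => t; ring.
  apply: (drv_eq (@is_derive_quot R _ _ _ _ _ _ _ _ nb)); field; exact: nb.
Qed.

Section QuotientDerivatives.
Variables (R : realType) (m : nat).
Local Notation C := (Cplx R).

Lemma dirD_quot (v w : 'rV[C]_m) F a b al be : b != 0 ->
  (forall t, F (line w v t) = (a + (real_complex R t : C) * al) / (b + (real_complex R t : C) * be)) ->
  dirD v F w = (al * b - a * be) / b ^+ 2 /\
  dirD v (fun w => (F w)^*) w = ((al * b - a * be) / b ^+ 2)^*.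
Proof.
move=> b0 FE; have [d1 d2] := @is_derive_quotC R a b al be (fun t => F (line w v t)) b0 FE.
rewrite /dirD !derive1E.
have e1 := @derive_val _ _ _ _ _ _ _ d1.
have e2 := @derive_val _ _ _ _ _ _ _ d2.
split; first by rewrite e1 e2; case: (_ / _).
have -> : (fun t : R => complex.Re (F (line w v t))^*) = (fun t => complex.Re (F (line w v t))).
  by apply/funext => t; case: (F _).
have -> : (fun t : R => complex.Im (F (line w v t))^*) = - (fun t => complex.Im (F (line w v t))).
  by apply/funext => t; rewrite /GRing.opp /=; case: (F _).
have -> : 'D_1 (- (fun t => complex.Im (F (line w v t)))) 0 = - complex.Im ((al * b - a * be) / b ^+ 2).
  by rewrite deriveN ?e2 //; exact: ex_derive.
by rewrite e1; case: (_ / _).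
Qed.

Lemma pd_quot (w : 'rV[C]_m) (A B : 'rV[C]_m -> C) (al be : 'I_m -> C) : B w != 0 ->
  (forall k c, A (w + c *: delta_mx 0 k) = A w + c * al k) ->
  (forall k c, B (w + c *: delta_mx 0 k) = B w + c * be k) ->
  let D k := (al k * B w - A w * be k) / B w ^+ 2 in
  let F w := A w / B w in
  forall k,
  [/\ pd (inl k) F w = D k, pd (inr k) F w = 0,
      pd (inl k) (fun w => (F w)^*) w = 0 &
      pd (inr k) (fun w => (F w)^*) w = (D k)^*].
Proof.
move=> B0 HA HB D F k.
have [||e1 e1'] := @dirD_quot (rdir R (inl k)) w F (A w) (B w) (al k) (be k) => //.
  by move=> t; rewrite /F /line /= HA HB.
have [||e2 e2'] := @dirD_quot (rdir R (inr k)) w F (A w) (B w) ('i * al k) ('i * be k) => //.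
  by move=> t; rewrite /F /line /= scalerA HA HB !mulrA.
have ii : ('i : C) * 'i = -1 by rewrite -expr2 sqrCi.
have E : ('i * al k * B w - A w * ('i * be k)) / B w ^+ 2 = 'i * D k.
  by rewrite /D; ring.
have h2 : (2%:R : C) != 0 by rewrite pnatr_eq0.
have Ec : ('i * D k)^* = - ('i * (D k)^*).
  by rewrite rmorphM /= conjCi mulNr.
have hf (x : C) : 2^-1 * (x + x) = x.
  by rewrite -mulr2n -(mulr_natl x) mulKf.
rewrite E -/(D k) in e2; rewrite E Ec in e2'; rewrite -/(D k) in e1 e1'.
rewrite /pd e1 e1' e2 e2'; move: (D k) => d.
rewrite !(mulrN, mulNr) !mulrA ii !mulN1r ?opprK !addrN !mulr0.
by split; rewrite ?hf.
Qed.
End QuotientDerivatives.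

Section Checks.
Variables (R : realType) (n s : nat).
Local Notation C := (Cplx R).
Local Notation idx := (idx n).
Implicit Types (z : 'rV[C]_n.+1) (w : 'rV[C]_n) (j k : 'I_n.+1).
Local Notation nu := (@nu R n s).
Local Notation Jfun := (@Jfun R n s).

Lemma sec_diag j w : sec j w 0 j = 1.
Proof. by rewrite mxE unlift_none. Qed.

Lemma sec_lift j w l : sec j w 0 (lift j l) = w 0 l.
Proof. by rewrite mxE liftK. Qed.

Lemma Jfun_sec j w :
  Jfun (sec j w) = nu j + \sum_(k < n) nu (lift j k) * ((w 0 k)^* * w 0 k).
Proof.
rewrite /Jfun (bigD1_ord j) //= sec_diag rmorph1 !mulr1; congr (_ + _).
by apply: eq_bigr => k _; rewrite sec_lift [w 0 k * _]mulrC.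
Qed.

Lemma nu_sqr k : nu k * nu k = 1.
Proof. by rewrite /nu; case: ifP => _; rewrite ?mulrNN mulr1. Qed.

Lemma nu_conj k : (nu k)^* = nu k.
Proof. by rewrite /nu; case: ifP => _; rewrite ?rmorphN rmorph1. Qed.

Lemma sec_add k w c i l : sec k (w + c *: delta_mx 0 i) 0 l =
  sec k w 0 l + c * (lift k i == l)%:R.
Proof.
case: (unliftP k l) => [m|] ->; last first.
  by rewrite !sec_diag eq_sym -[_ == _]negbK neq_lift mulr0 addr0.
by rewrite !sec_lift !mxE /= (inj_eq lift_inj) eq_sym.
Qed.

(* Jacobian entries of the change of coordinates from chart k to chart j. *)
Definition jac j k w (b a : idx) : C :=
  pd a (fun w' => cxcoord j b (sec k w')) w.

Let D j k w l i : C :=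
  ((lift k i == lift j l)%:R * sec k w 0 j -
   sec k w 0 (lift j l) * (lift k i == j)%:R) / sec k w 0 j ^+ 2.

Lemma jacE j k w : sec k w 0 j != 0 -> forall l i,
  [/\ jac j k w (inl l) (inl i) = D j k w l i,
      jac j k w (inl l) (inr i) = 0,
      jac j k w (inr l) (inl i) = 0 &
      jac j k w (inr l) (inr i) = (D j k w l i)^*].
Proof.
move=> z0 l i.
have := @pd_quot R n w (fun w => sec k w 0 (lift j l)) (fun w => sec k w 0 j)
  (fun i => (lift k i == lift j l)%:R) (fun i => (lift k i == j)%:R) z0
  (fun i c => sec_add k w c i (lift j l)) (fun i c => sec_add k w c i j) i.
have E : (fun w' => cxcoord j (inl l) (sec k w')) =
         (fun w' => sec k w' 0 (lift j l) / sec k w' 0 j).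
  by apply/funext => w'; rewrite /= mxE.
have E' : (fun w' => cxcoord j (inr l) (sec k w')) =
         (fun w' => (sec k w' 0 (lift j l) / sec k w' 0 j)^*).
  by apply/funext => w'; rewrite /= mxE.
by move=> [? ? ? ?]; rewrite /jac E E'; split.
Qed.

(* g = 1/2 (h + h^T) *)
Let h j w (a b : idx) : C :=
  match a, b with
  | inr a, inl b => nu (lift j a) * (a == b)%:R / Jfun (sec j w) -
      nu (lift j a) * nu (lift j b) * ((w 0 b)^* * w 0 a) / Jfun (sec j w) ^+ 2
  | _, _ => 0
  end.

Let I0 : 'I_2 := ord0.
Let I1 : 'I_2 := lift ord0 ord0.

Lemma vee_dcoord (x y : idx) w (I : {ffun 'I_2 -> idx}) :
  @vee R n 1 1 (@dcoord R n x) (@dcoord R n y) w I =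
  2^-1 * ((I I0 == x)%:R * (I I1 == y)%:R + (I I1 == x)%:R * (I I0 == y)%:R).
Proof.
rewrite /vee /Sym /tens /dcoord; congr (_ * _).
rewrite (eq_bigr (fun sg : 'S_2 => (I (sg I0) == x)%:R * (I (sg I1) == y)%:R));
  last first.
  move=> sg _; rewrite !ffunE.
  have -> : lshift 1 (ord0 : 'I_1) = I0 by apply/val_inj.
  by have -> : rshift 1 (ord0 : 'I_1) = I1 by apply/val_inj.
have S2 (sg : 'S_2) : sg = if sg I0 == I0 then 1%g else tperm I0 I1.
  have H i : (i == I0) = ~~ (i == I1).
    by case: i => -[|[|?]] ?.
  case: ifP => e; apply/permP => i; have := perm_inj (s:=sg).
  - move=> inj; rewrite perm1; case: (boolP (i == I0)) => [/eqP->|]; first exact/eqP.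
    rewrite H negbK => /eqP->; apply/eqP; move: (H (sg I1)).
    by rewrite -{1}(eqP e) (inj_eq inj) => /esym/negbFE.
  - move=> inj; case: (boolP (i == I0)) => [/eqP->|].
      by rewrite tpermL; apply/eqP; move: e; rewrite H => /negbFE.
    rewrite H negbK => /eqP->; rewrite tpermR; apply/eqP; rewrite H.
    by move: e; rewrite H => /negbFE/eqP e; rewrite -{2}e (inj_eq inj).
have t0 : (1%g : 'S_2) != tperm I0 I1.
  by apply/eqP => /permP/(_ I0); rewrite perm1 tpermL.
move: S2 t0 (perm1 I0) (perm1 I1) (tpermL I0 I1) (tpermR I0 I1).
move: (tperm I0 I1) (1%g : 'S_2) => t o S2 to o0 o1 t0 t1.
rewrite (bigD1 o) // (bigD1 t) /=; last by rewrite eq_sym to.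
rewrite big1 => [|sg]; first by rewrite addr0 o0 o1 t0 t1.
by rewrite {1 2}(S2 sg); case: ifP; rewrite eqxx ?andbF.
Qed.

Lemma gredE j w I :
  gred s j w I = 2^-1 * (h j w (I I0) (I I1) + h j w (I I1) (I I0)).
Proof.
have H (x y : idx) : 
  (\sum_(k < n) nu (lift j k) * ((x == inr k)%:R * (y == inl k)%:R)) / Jfun (sec j w)
  - (\sum_(k < n) \sum_(l < n) nu (lift j k) * nu (lift j l) * ((w 0 l)^* * w 0 k) *
      ((x == inr k)%:R * (y == inl l)%:R)) / Jfun (sec j w) ^+ 2 = h j w x y.
  case: x => a /=; first by rewrite !big1 ?mul0r ?subrr // => i _; rewrite ?big1 // => *; rewrite !(mul0r, mulr0).
  case: y => b /=; last by rewrite !big1 ?mul0r ?subrr // => i _; rewrite ?big1 // => *; rewrite !(mul0r, mulr0).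
  have eL (x y : 'I_n) : (@inl 'I_n 'I_n x == inl y) = (x == y) by [].
  have eR (x y : 'I_n) : (@inr 'I_n 'I_n x == inr y) = (x == y) by [].
  congr (_ / _ - _ / _).
  - rewrite (bigD1 a) //= big1 ?addr0 => [|i ia].
      by rewrite eR eL eqxx mul1r [b == a]eq_sym.
    by rewrite eR eq_sym (negbTE ia) mul0r mulr0.
  - rewrite (bigD1 a) //= [X in _ + X]big1 ?addr0 => [|i ia]; last first.
      by rewrite big1 // => l _; rewrite eR [a == i]eq_sym (negbTE ia) mul0r mulr0.
    rewrite (bigD1 b) //= big1 ?addr0 => [|i ib]; first by rewrite eR eL !eqxx !mulr1.
    by rewrite eL [b == i]eq_sym (negbTE ib) !mulr0.
rewrite /gred -!H.
under eq_bigr do rewrite vee_dcoord mulrCA mulrDr.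
rewrite -mulr_sumr big_split /=.
under [X in _ - X / _]eq_bigr => k _.
  under eq_bigr do rewrite vee_dcoord mulrCA mulrDr.
  rewrite -mulr_sumr big_split /=; over.
rewrite -mulr_sumr big_split /=.
by ring.
Qed.

Let hh (u v : 'I_n.+1 -> C) : C := \sum_i nu i * ((u i)^* * v i).
Let GG (z u v : 'I_n.+1 -> C) : C := hh u v / hh z z - hh u z * hh z v / hh z z ^+ 2.
Let e_ (k : 'I_n.+1) : 'I_n.+1 -> C := fun i => (k == i)%:R.

Lemma hhDr c u v v' : hh u (fun i => v i + c * v' i) = hh u v + c * hh u v'.
Proof. by rewrite /hh mulr_sumr -big_split; apply: eq_bigr => i _ /=; ring. Qed.
Lemma hhDl c u u' v : hh (fun i => u i + c * u' i) v = hh u v + c^* * hh u' v.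
Proof.
by rewrite /hh mulr_sumr -big_split; apply: eq_bigr => i _ /=; rewrite rmorphD rmorphM /=; ring.
Qed.
Lemma hhZr c u v : hh u (fun i => c * v i) = c * hh u v.
Proof. by rewrite /hh mulr_sumr; apply: eq_bigr => i _ /=; ring. Qed.
Lemma hhZl c u v : hh (fun i => c * u i) v = c^* * hh u v.
Proof. by rewrite /hh mulr_sumr; apply: eq_bigr => i _ /=; rewrite rmorphM /=; ring. Qed.

Lemma hh_el k v : hh (e_ k) v = nu k * v k.
Proof.
rewrite /hh (bigD1 k) //= big1 ?addr0 => [|i ik].
  by rewrite /e_ eqxx rmorph1 mul1r.
by rewrite /e_ eq_sym (negbTE ik) rmorph0 mul0r mulr0.
Qed.
Lemma hh_er k v : hh v (e_ k) = nu k * (v k)^*.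
Proof.
rewrite /hh (bigD1 k) //= big1 ?addr0 => [|i ik].
  by rewrite /e_ eqxx mulr1.
by rewrite /e_ eq_sym (negbTE ik) !mulr0.
Qed.

Lemma hhJ z : hh (z 0) (z 0) = Jfun z.
Proof. by apply: eq_bigr => i _; rewrite [_^* * _]mulrC. Qed.

Lemma h_GG j w a b : h j w (inr a) (inl b) =
  GG (sec j w 0) (e_ (lift j a)) (e_ (lift j b)).
Proof.
rewrite /GG hhJ !hh_el hh_er !sec_lift /= /e_ (inj_eq lift_inj) [b == a]eq_sym.
by ring.
Qed.

Lemma GG_inv (z u v : 'I_n.+1 -> C) (al be B : C) : B != 0 -> hh z z != 0 ->
  GG (fun i => B^-1 * z i) (fun i => B^-1 * (u i + al * z i))
     (fun i => B^-1 * (v i + be * z i)) = GG z u v.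
Proof.
move=> B0 J0; rewrite /GG !(hhZr, hhZl, hhDr, hhDl).
have Bc : B^* != 0 by rewrite conjC_eq0.
rewrite !fmorphV /=; field.
by rewrite J0 B0 Bc.
Qed.

Lemma sum_ffun2 (f : idx -> idx -> C) :
  \sum_(K : {ffun 'I_2 -> idx}) f (K I0) (K I1) = \sum_a \sum_b f a b.
Proof.
rewrite pair_bigA /=.
rewrite (reindex (fun p : idx * idx => [ffun i : 'I_2 => if i == I0 then p.1 else p.2])) /=.
  by apply: eq_bigr => p _; rewrite !ffunE.
exists (fun K : {ffun 'I_2 -> idx} => (K I0, K I1)) => [[x y]|K] _.
  by rewrite !ffunE.
by apply/ffunP => i; rewrite ffunE; case: eqP => [->//|]; case: i => -[|[|//]] p e;
  [case: e; apply/val_inj|congr (K _); apply/val_inj].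
Qed.

Lemma sum_idx (f : idx -> C) : \sum_a f a = \sum_a f (inl a) + \sum_a f (inr a).
Proof. by rewrite big_sumType. Qed.

Lemma h_trans j k w a b : sec k w 0 j != 0 -> chart_img s k w ->
  h k w a b = \sum_a' \sum_b' h j (hcoord j (sec k w)) a' b' *
                (jac j k w a' a * jac j k w b' b).
Proof.
move=> z0 Jw.
have J0 : Jfun (sec k w) != 0 by rewrite gt_eqF.
rewrite sum_idx [X in X + _]big1 ?add0r => [|a' _]; last first.
  by rewrite big1 // => b' _; rewrite /= mul0r.
under eq_bigr => a' _.
  rewrite sum_idx [X in _ + X]big1 ?addr0 => [|b' _]; last by rewrite /= mul0r.
  over.
case: a => a.
  rewrite big1 // => a' _; rewrite big1 // => b' _.
  by have [_ _ -> _] := jacE z0 a' a; rewrite mul0r mulr0.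
case: b => b; last first.
  rewrite big1 // => a' _; rewrite big1 // => b' _.
  by have [_ -> _ _] := jacE z0 b' b; rewrite !mulr0.
under eq_bigr => a' _.
  under eq_bigr => b' _.
    have [_ _ _ ->] := jacE z0 a' a; have [-> _ _ _] := jacE z0 b' b.
    rewrite h_GG /GG !hh_el !hh_er; over.
  over.
set z := sec k w 0; set B := z j.
pose U (c : 'I_n) i : C := B^-1 * (e_ (lift k c) i + (- ((lift k c == j)%:R / B)) * z i).
have UD c l : D j k w l c = U c (lift j l).
  by rewrite /D /U /e_ -/z -/B; field.
have Uj c : U c j = 0.
  by rewrite /U /e_ -/B; field.
set ph := sec j (hcoord j (sec k w)) 0.
have phE : ph = fun i => B^-1 * z i.
  apply/funext => i; rewrite /ph; case: (unliftP j i) => [l|] ->.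
    by rewrite sec_lift mxE mulrC.
  by rewrite sec_diag mulVf.
rewrite h_GG -(@GG_inv z _ _ (- ((lift k a == j)%:R / B)) (- ((lift k b == j)%:R / B)) B) //; last by rewrite hhJ.
rewrite -phE -/(U a) -/(U b).
have hU1 c v : hh (U c) v = \sum_l nu (lift j l) * ((D j k w l c)^* * v (lift j l)).
  rewrite /hh (bigD1_ord j) //= Uj rmorph0 mul0r mulr0 add0r.
  by apply: eq_bigr => l _; rewrite UD.
have hU2 c v : hh v (U c) = \sum_l nu (lift j l) * ((v (lift j l))^* * D j k w l c).
  rewrite /hh (bigD1_ord j) //= Uj !mulr0 add0r.
  by apply: eq_bigr => l _; rewrite UD.
rewrite /GG (hU1 a (U b)) (hU1 a ph) (hU2 b ph).
set J := hh ph ph; set S := \sum_l _ * (_ * D j k w l b).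
transitivity (\sum_l (nu (lift j l) * ((D j k w l a)^* * U b (lift j l)) / J -
   nu (lift j l) * ((D j k w l a)^* * ph (lift j l)) * S / J ^+ 2)).
  by rewrite sumrB; congr (_ - _); rewrite !mulr_suml.
apply: eq_bigr => a' _.
transitivity (\sum_b' (nu (lift j a') * e_ (lift j b') (lift j a') / J *
     ((D j k w a' a)^* * D j k w b' b)) -
   \sum_b' (nu (lift j a') * ph (lift j a') * (nu (lift j b') * (ph (lift j b'))^*)
      / J ^+ 2 * ((D j k w a' a)^* * D j k w b' b))); last first.
  by rewrite -sumrB; apply: eq_bigr => b' _; rewrite -/ph -/J; ring.
congr (_ - _).
  rewrite (bigD1 a') //= big1 ?addr0 => [|b' ba].
    by rewrite /e_ eqxx -UD mulr1 mulrAC mulrA.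
  by rewrite /e_ (inj_eq lift_inj) (negbTE ba) mulr0 !mul0r.
rewrite /S mulr_sumr mulr_suml; apply: eq_bigr => b' _; ring.
Qed.

Lemma gred_transition j k w I : chart_img s k w -> sec k w 0 j != 0 ->
  gred s k w I = \sum_(K : {ffun 'I_2 -> idx})
    gred s j (hcoord j (sec k w)) K * \prod_(i < 2) jac j k w (K i) (I i).
Proof.
move=> Jw z0.
under eq_bigr do rewrite gredE big_ord_recl big_ord1.
rewrite (sum_ffun2 (fun a b => 2^-1 * (h j (hcoord j (sec k w)) a b +
   h j (hcoord j (sec k w)) b a) * (jac j k w a (I I0) * jac j k w b (I I1)))).
rewrite gredE (h_trans _ _ z0 Jw) (h_trans (I I1) _ z0 Jw).
rewrite [X in _ * (_ + X)]exchange_big -big_split mulr_sumr.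
apply: eq_bigr => a _; rewrite -big_split mulr_sumr.
by apply: eq_bigr => b _ /=; ring.
Qed.

Lemma gred_chart0 w I : (0 < s)%N ->
  gred s ord0 w I =
    (\sum_(k < n) nu (lift ord0 k) *
        @vee R n 1 1 (@dcoord R n (inr k)) (@dcoord R n (inl k)) w I)
      / (1 + \sum_(k < n) nu (lift ord0 k) * ((w 0 k)^* * w 0 k))
    - (\sum_(k < n) \sum_(l < n)
        nu (lift ord0 k) * nu (lift ord0 l) * ((w 0 l)^* * w 0 k) *
        @vee R n 1 1 (@dcoord R n (inr k)) (@dcoord R n (inl l)) w I)
      / (1 + \sum_(k < n) nu (lift ord0 k) * ((w 0 k)^* * w 0 k)) ^+ 2.
Proof.
move=> s0; have n0 : nu ord0 = 1 by rewrite /nu s0.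
by rewrite /gred Jfun_sec n0.
Qed.

Lemma pd_hcoord j z (z0 : z 0 j != 0) (a : 'I_n) (i : 'I_n.+1) :
  let d : C := ((i == lift j a)%:R * z 0 j - z 0 (lift j a) * (i == j)%:R)
     / z 0 j ^+ 2 in
  [/\ pd (inl i) (cxcoord j (inl a)) z = d,
      pd (inr i) (cxcoord j (inl a)) z = 0,
      pd (inl i) (cxcoord j (inr a)) z = 0 &
      pd (inr i) (cxcoord j (inr a)) z = d^*].
Proof.
have H i' (k : 'I_n.+1) c : (z + c *: delta_mx 0 k) 0 i' = z 0 i' + c * (k == i')%:R.
  by rewrite !mxE eqxx eq_sym.
have := @pd_quot R n.+1 z (fun z => z 0 (lift j a)) (fun z => z 0 j)
  (fun i => (i == lift j a)%:R) (fun i => (i == j)%:R) z0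
  (fun k c => H (lift j a) k c) (fun k c => H j k c) i.
have E : cxcoord j (inl a) = (fun z => z 0 (lift j a) / z 0 j) :> (_ -> C).
  by apply/funext => w'; rewrite /= mxE.
have E' : cxcoord j (inr a) = (fun z => (z 0 (lift j a) / z 0 j)^*) :> (_ -> C).
  by apply/funext => w'; rewrite /= mxE.
by rewrite E E'.
Qed.

Lemma HredE j w (a b : idx) : chart_img s j w ->
  Hred s j w a b =
    match a, b with
    | inr k, inl l => Jfun (sec j w) *
        (nu j * ((w 0 k)^* * w 0 l) + nu (lift j k) * (k == l)%:R)
    | _, _ => 0
    end.
Proof.
move=> Jw; have J0 : Jfun (sec j w) != 0 by rewrite gt_eqF.
pose q := sqrtC (Jfun (sec j w)).
have q0 : q != 0 by rewrite sqrtC_eq0.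
have qq : q ^+ 2 = Jfun (sec j w) by rewrite sqrtCK.
have qc : q^* = q by apply/CrealP; rewrite ger0_real // sqrtC_ge0 ltW.
have zj : repZ s j w 0 j = q^-1 by rewrite mxE sec_diag mulr1.
have z0 : repZ s j w 0 j != 0 by rewrite zj invr_eq0.
have zl l : repZ s j w 0 (lift j l) = q^-1 * w 0 l by rewrite mxE sec_lift.
rewrite /Hred; case: a => a.
  rewrite big1 // => i _; have [_ -> _ _] := pd_hcoord z0 a i.
  by rewrite mulr0 mul0r.
case: b => b; last first.
  by rewrite big1 // => i _; have [_ _ -> _] := pd_hcoord z0 b i; rewrite mulr0.
have E (c : 'I_n) (i : 'I_n.+1) :
    ((i == lift j c)%:R * repZ s j w 0 j - repZ s j w 0 (lift j c) * (i == j)%:R)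
     / repZ s j w 0 j ^+ 2 = q * ((i == lift j c)%:R - w 0 c * (i == j)%:R).
  by rewrite zj zl; field.
under eq_bigr => i _.
  have [_ _ _ ->] := pd_hcoord z0 a i; have [-> _ _ _] := pd_hcoord z0 b i.
  rewrite !E rmorphM rmorphB rmorphM /= !conjC_nat qc; over.
rewrite (bigD1_ord j) //= eqxx !(negbTE (neq_lift _ _)) -qq.
rewrite (bigD1 a) //= big1 => [|i ia].
  rewrite eqxx [lift j a == j]eq_sym (negbTE (neq_lift _ _)) (inj_eq lift_inj).
  rewrite -[false%:R]/(0 : C) -[true%:R]/(1 : C). ring.
rewrite [lift j i == j]eq_sym (negbTE (neq_lift _ _)) !(inj_eq lift_inj) (negbTE ia).
  rewrite -[false%:R]/(0 : C). ring.
Qed.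

(* Inverse of the component matrix of gred, up to a factor 2. *)
Let hinv j w (a b : 'I_n) : C := Jfun (sec j w) *
  (nu (lift j a) * (a == b)%:R + nu j * (w 0 a * (w 0 b)^*)).
Let hmat j w := \matrix_(a, b) h j w (inr a) (inl b).
Let himat j w := \matrix_(a, b) hinv j w a b.

Lemma hmatV j w : chart_img s j w -> hmat j w *m himat j w = 1%:M.
Proof.
move=> Jw; have J0 : Jfun (sec j w) != 0 by rewrite gt_eqF.
have JE := Jfun_sec j w.
apply/matrixP => a c; rewrite mxE [RHS]mxE.
set J := Jfun _ in J0 JE.
set S := \sum_(k < n) _ in JE.
have hE b : hmat j w a b * himat j w b c =
    (b == a)%:R * (nu (lift j a) * nu (lift j b) * (b == c)%:R
                   + nu (lift j a) * nu j * (w 0 b * (w 0 c)^*))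
    - nu (lift j a) * w 0 a / J * ((b == c)%:R * ((w 0 b)^* * (nu (lift j b) * nu (lift j b))))
    - nu (lift j a) * w 0 a / J * (nu j * (w 0 c)^*) * (nu (lift j b) * ((w 0 b)^* * w 0 b)).
  rewrite !mxE /h /hinv -/J [a == b]eq_sym; field; exact: J0.
rewrite (eq_bigr _ (fun b _ => hE b)).
rewrite 2!sumrB -!mulr_sumr -/S.
rewrite (bigD1 a) //= eqxx big1 => [|b /negbTE->]; last by rewrite mul0r.
rewrite (bigD1 c) //= eqxx big1 => [|b /negbTE->]; last by rewrite mul0r.
have -> : S = J - nu j by rewrite JE addrAC subrr add0r.
have n2 := nu_sqr j; have nc := nu_sqr (lift j c); have na := nu_sqr (lift j a).
rewrite nc na -[true%:R]/(1 : C).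
transitivity ((a == c)%:R + nu (lift j a) * (w 0 a * (w 0 c)^*) / J *
   (nu j * nu j - 1)); last by rewrite n2 subrr mulr0 addr0.
by field.
Qed.

Let gc j (a b : idx) w : C := 2^-1 * (h j w a b + h j w b a).
Let gi j w (a b : idx) : C :=
  match a, b with
  | inl a, inr b => 2 * hinv j w a b
  | inr a, inl b => 2 * hinv j w b a
  | _, _ => 0
  end.

Lemma gc_gi j w d e : chart_img s j w ->
  \sum_c gc j d c w * gi j w c e = (d == e)%:R.
Proof.
move=> Jw; have J0 : Jfun (sec j w) != 0 by rewrite gt_eqF.
have E := hmatV Jw; have E' := mulmx1C E.
have h2 : (2 : C) != 0 by rewrite pnatr_eq0.
rewrite sum_idx; case: d => d; case: e => e; rewrite /gc /=.
- rewrite big1 ?add0r => [|c _]; last by rewrite mulr0.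
  have := congr1 (fun M : 'M[C]_n => M e d) E'; rewrite !mxE -[inl d == inl e]/(d == e) eq_sym => <-.
  by apply: eq_bigr => c _; rewrite !mxE /= add0r; field; exact: J0.
- by rewrite !big1 ?addr0 // => c _; rewrite ?addr0 ?mulr0 ?mul0r.
- by rewrite !big1 ?addr0 // => c _; rewrite ?addr0 ?mulr0 ?mul0r.
- rewrite [X in _ + X]big1 ?addr0 => [|c _]; last by rewrite mulr0.
  have := congr1 (fun M : 'M[C]_n => M d e) E; rewrite !mxE -[inr d == inr e]/(d == e) => <-.
  by apply: eq_bigr => c _; rewrite !mxE /= addr0; field; exact: J0.
Qed.

Lemma levi_civita_exists : exists Gam, levi_civita s (@gred R n s) Gam.
Proof.
pose K j (w : 'rV[C]_n) d a b : C := 2^-1 *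
  (pd a (gc j b d) w + pd b (gc j a d) w - pd d (gc j a b) w).
have gcC i a b : gc i a b = gc i b a.
  by apply/funext => w; rewrite /gc addrC.
exists (fun j w c a b => \sum_d gi j w c d * K j w d a b); move=> j.
split=> w Jw.
  by move=> a b c; apply: eq_bigr => d _; rewrite /K (gcC j a b); ring.
move=> a I.
have gE v (L : {ffun 'I_2 -> idx}) : gred s j v L = gc j (L I0) (L I1) v.
  by rewrite gredE.
rewrite /nabla (_ : (fun w' => _) = gc j (I I0) (I I1)); last first.
  by apply/funext => v; rewrite gE.
have low b d : \sum_c (\sum_e gi j w c e * K j w e a b) * gc j d c w = K j w d a b.
  under eq_bigr do rewrite mulr_suml.
  rewrite exchange_big /= (bigD1 d) //= [X in _ + X]big1 => [|e ed].
    rewrite addr0; transitivity ((d == d)%:R * K j w d a b); last by rewrite eqxx mul1r.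
    by rewrite -(gc_gi d d Jw) mulr_suml; apply: eq_bigr => c _; ring.
  transitivity ((d == e)%:R * K j w e a b).
    by rewrite -(gc_gi d e Jw) mulr_suml; apply: eq_bigr => c _; ring.
  by rewrite eq_sym (negbTE ed) mul0r.
rewrite big_ord_recl big_ord1.
under eq_bigr do rewrite gE !ffunE /= gcC.
under [X in _ - (_ + X)]eq_bigr do rewrite gE !ffunE /=.
rewrite !low /K (gcC j (I I1) (I I0)).
have h2 : (2 : C) != 0 by rewrite pnatr_eq0.
rewrite (gcC j a (I I1)); by field.
Qed.
End Checks.

Arguments gred : clear implicits.
Arguments poisson_red : clear implicits.
Arguments star_red : clear implicits.

(* Main.v *)
Require Import Defs.
From HB Require Import structures.
From mathcomp Require Import all_boot all_order all_algebra.
From mathcomp Require Import all_fingroup generic_quotient complex ring.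
From mathcomp Require Import all_classical all_reals all_analysis.

Set Implicit Arguments.
Unset Strict Implicit.
Unset Printing Implicit Defensive.
Import Order.TTheory GRing.Theory Num.Theory numFieldNormedType.Exports.
Local Open Scope quotient_scope.
Local Open Scope classical_set_scope.
Local Open Scope ring_scope.

(* Functions on M_red are the functions on the cone {J > 0} that are invariant
   under complex scaling. On the cone the pairing of the r-th symmetrized
   derivatives is the contraction M_r(f, g) of the antiholomorphic derivatives
   of f and the holomorphic derivatives of g with r copies of
   P^AB = J nu_A delta_AB - conj(z^A) z^B: in a chart the Christoffel symbols are
   - (u_a delta_cb + u_b delta_ca) with u = d log J, so that the r-th symmetrized
   derivative is the r-th derivative on the cone contracted with the horizontal
   lifts of the frame.

   Let A_m be the associator of order m as a function of its third argument, X the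
   antiholomorphic derivative along z^C and mu = nu_C z^C / J. The coefficients
   c_r(m) of the series satisfy c_r(m) + (r+1) r c_(r+1)(m) = (r+1) c_(r+1)(m+1),
   which is what is needed for
     A_(m+1)(h mu) - mu A_(m+1)(h) = X A_m(h) - A_m(X h).
   By induction on m the associator is therefore linear over the functions mu.
   Its value at a point depends on finitely many holomorphic derivatives of h, and
   modulo functions vanishing to higher order there, h is a sum of terms
   (mu_C - a_C mu_j) k_C whose first factor vanishes at the point; so the
   associator is 0. *)

(** * The contraction algebra and its associator *)

(** The obstacle is that [mu C] has degree 0 in z but degree -1 in the conjugate variables, so
    [h * mu C] no longer is a function on M_red. The associator is therefore studied for third
    arguments that are only annihilated by the holomorphic Euler field, a class stable under
    multiplication by [mu C] and under X, while f and g stay invariant. Curvature enters the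
    commutator of X with M_(r+1) as the r (r + 1) term, and matching it is what fixes the
    coefficients: the recurrence amounts to (1 - r lambda) a_(r+1) = lambda a_r for the series a_r =
    r! c_r. A merely smooth h need not be represented by its Taylor series. Instead, a function
    whose holomorphic jet vanishes to some order at the point is exchanged for one that is flatter
    by one order, by means of an Euler field with coefficients vanishing at the point, until the
    finite order of the associator is exceeded. All this takes place in a commutative ring S with
    commuting derivations and evaluations at points; analysis enters only in showing that the smooth
    functions on the cone form such a ring. *)

Section WickAlgebra.
Variables (S : comPzRingType) (I : finType).
Variables (d db : I -> {additive S -> S}) (z zb nu : I -> S) (Ji : S).
Hypotheses
  (dM : forall A f g, d A (f * g) = d A f * g + f * d A g)
  (dbM : forall A f g, db A (f * g) = db A f * g + f * db A g)
  (dC : forall A B f, d A (d B f) = d B (d A f))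
  (dbC : forall A B f, db A (db B f) = db B (db A f))
  (ddb : forall A B f, d A (db B f) = db B (d A f))
  (dz : forall A B, d A (z B) = (A == B)%:R)
  (dbzb : forall A B, db A (zb B) = (A == B)%:R)
  (dzb : forall A B, d A (zb B) = 0)
  (dbz : forall A B, db A (z B) = 0)
  (dnu : forall A B, d A (nu B) = 0)
  (dbnu : forall A B, db A (nu B) = 0)
  (nu2 : forall A, nu A * nu A = 1).

Let J := \sum_A nu A * (z A * zb A).
Hypothesis JJi : J * Ji = 1.

(* H_red in homogeneous coordinates. *)
Let P A B : S := J * nu A * (A == B)%:R - zb A * z B.
Let E f : S := \sum_A z A * d A f.
Let Eb f : S := \sum_A zb A * db A f.
Let mu C : S := nu C * z C * Ji.

(** The contraction M_r of the overview, one slot peeled off at a time: every factor [P] stands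
    outside the derivatives, so [P] itself is never differentiated here. *)
Fixpoint wick r (f g : S) : S :=
  if r is r'.+1 then \sum_A \sum_B P A B * wick r' (db A f) (d B g) else f * g.

Lemma wick0 f g : wick 0 f g = f * g.
Proof. by []. Qed.
Lemma wickSr r f g :
  wick r.+1 f g = \sum_A \sum_B P A B * wick r (db A f) (d B g).
Proof. by []. Qed.
Local Opaque wick.

Lemma sum_delta (F : I -> S) A : \sum_B (A == B)%:R * F B = F A.
Proof.
rewrite (bigD1 A) //= eqxx mul1r big1 ?addr0 // => B /negbTE; rewrite eq_sym => ->.
by rewrite mul0r.
Qed.

Lemma sum_delta_r (F : I -> S) A : \sum_B F B * (A == B)%:R = F A.
Proof. by rewrite -[RHS](sum_delta F); apply: eq_bigr => B _; rewrite mulrC. Qed.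

Lemma sum_delta_l (F : I -> S) B : \sum_A F A * (A == B)%:R = F B.
Proof.
by rewrite -[RHS](sum_delta F); apply: eq_bigr => A _; rewrite mulrC eq_sym.
Qed.

Lemma leib1 (D : {additive S -> S}) :
  (forall f g, D (f * g) = D f * g + f * D g) -> D 1 = 0.
Proof.
move=> H; have := H 1 1; rewrite !mulr1 mul1r => /eqP.
by rewrite -subr_eq subrr eq_sym => /eqP.
Qed.

Lemma leibn (D : {additive S -> S}) k :
  (forall f g, D (f * g) = D f * g + f * D g) -> D k%:R = 0.
Proof. by move=> H; rewrite raddfMn (leib1 H) mul0rn. Qed.

Lemma dJ A : d A J = nu A * zb A.
Proof.
rewrite raddf_sum -[RHS](sum_delta (fun B => nu B * zb B)) /=.
by apply: eq_bigr => B _; rewrite !dM dnu dz dzb; ring.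
Qed.

Lemma dbJ A : db A J = nu A * z A.
Proof.
rewrite raddf_sum -[RHS](sum_delta (fun B => nu B * z B)) /=.
by apply: eq_bigr => B _; rewrite !dbM dbnu dbz dbzb; ring.
Qed.

Lemma dJi A : d A Ji = - (Ji * Ji * (nu A * zb A)).
Proof.
have /(congr1 (fun x => x * Ji)) : d A (J * Ji) = 0 by rewrite JJi (leib1 (dM A)).
rewrite dM dJ mul0r => /eqP; rewrite mulrDl addr_eq0 => /eqP e.
transitivity (J * Ji * d A Ji); first by rewrite JJi mul1r.
by transitivity (J * d A Ji * Ji); [ring|rewrite -[LHS]opprK -e; ring].
Qed.

(** By [dJ] the second factor is the derivative of J: P annihilates dJ, because its two terms give
    the same contribution J [zb A]. *)
Lemma P_nuzb A : \sum_B P A B * (nu B * zb B) = 0.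
Proof.
rewrite (eq_bigr (fun B => J * nu A * (A == B)%:R * (nu B * zb B) - zb A * (nu B * (z B * zb B)))).
  rewrite sumrB -mulr_sumr -/J.
  under eq_bigr do rewrite -mulrA.
  rewrite -mulr_sumr (sum_delta (fun B => nu B * zb B)).
  transitivity (J * zb A * (nu A * nu A - 1)); first by ring.
  by rewrite nu2 subrr mulr0.
by move=> B _; rewrite /P; ring.
Qed.

Lemma wick_subr r f g h : wick r f (g - h) = wick r f g - wick r f h.
Proof.
elim: r f g h => [|r IH] f g h; rewrite ?wick0 ?wickSr; first by ring.
rewrite -sumrB; apply: eq_bigr => A _; rewrite -sumrB; apply: eq_bigr => B _.
by rewrite raddfB IH; ring.
Qed.

Lemma wick_subl r f g h : wick r (g - h) f = wick r g f - wick r h f.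
Proof.
elim: r f g h => [|r IH] f g h; rewrite ?wick0 ?wickSr; first by ring.
rewrite -sumrB; apply: eq_bigr => A _; rewrite -sumrB; apply: eq_bigr => B _.
by rewrite raddfB IH; ring.
Qed.

Lemma wick0r r f : wick r f 0 = 0.
Proof. by rewrite -{1}(subrr 0) wick_subr subrr. Qed.
Lemma wick0l r f : wick r 0 f = 0.
Proof. by rewrite -{1}(subrr 0) wick_subl subrr. Qed.
Lemma wickDr r f g h : wick r f (g + h) = wick r f g + wick r f h.
Proof. by rewrite -{1}(opprK h) -[- h]sub0r !wick_subr wick0r sub0r opprK. Qed.
Lemma wickDl r f g h : wick r (g + h) f = wick r g f + wick r h f.
Proof. by rewrite -{1}(opprK h) -[- h]sub0r !wick_subl wick0l sub0r opprK. Qed.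

Lemma wickMr r f g k : (forall A, d A k = 0) -> wick r f (k * g) = k * wick r f g.
Proof.
move=> k0; elim: r f g => [|r IH] f g; rewrite ?wick0 ?wickSr; first by ring.
rewrite mulr_sumr; apply: eq_bigr => A _; rewrite mulr_sumr; apply: eq_bigr => B _.
by rewrite dM k0 mul0r add0r IH; ring.
Qed.
Lemma wickMl r f g k : (forall A, db A k = 0) -> wick r (k * f) g = k * wick r f g.
Proof.
move=> k0; elim: r f g => [|r IH] f g; rewrite ?wick0 ?wickSr; first by ring.
rewrite mulr_sumr; apply: eq_bigr => A _; rewrite mulr_sumr; apply: eq_bigr => B _.
by rewrite dbM k0 mul0r add0r IH; ring.
Qed.

(* [J] and [Ji] are not killed by [d] but [P] contracts their differential to 0. *)
Lemma wickJi r f g : wick r f (Ji * g) = Ji * wick r f g.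
Proof.
elim: r f g => [|r IH] f g; first by rewrite !wick0; ring.
rewrite !wickSr mulr_sumr; apply: eq_bigr => A _.
transitivity (\sum_B (Ji * (P A B * wick r (db A f) (d B g)) -
   P A B * (nu B * zb B) * (Ji * Ji * wick r (db A f) g))); last first.
  by rewrite sumrB -mulr_suml P_nuzb mul0r subr0 mulr_sumr.
apply: eq_bigr => B _; rewrite dM wickDr IH dJi.
rewrite (_ : - _ * g = (- (nu B * zb B)) * (Ji * (Ji * g))); last by ring.
rewrite wickMr ?IH; last first.
  by move=> C; rewrite raddfN dM dnu dzb !(mul0r, mulr0, addr0) oppr0.
rewrite ?IH; ring.
Qed.

(** What survives when exactly one contraction hits [mu C]: its derivative is [nu C * Ji] in
    direction C, up to a multiple of dJ that P kills. *)
Let Q C r f g := \sum_A P A C * nu C * Ji * wick r (db A f) g.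

Lemma wick_mu_step C r f g : wick r.+1 f (g * mu C) =
  \sum_A \sum_B P A B * wick r (db A f) (d B g * mu C) + Q C r f g.
Proof.
rewrite /Q wickSr -big_split; apply: eq_bigr => A _ /=.
transitivity (\sum_B (P A B * wick r (db A f) (d B g * mu C) +
  (P A B * (C == B)%:R) * (nu C * Ji * wick r (db A f) g) -
  P A B * (nu B * zb B) * (Ji * wick r (db A f) (g * mu C)))).
  apply: eq_bigr => B _; rewrite dM wickDr.
  have -> : g * d B (mu C) = (nu C * (C == B)%:R) * (Ji * g) +
     (- (nu B * zb B)) * (Ji * (g * mu C)).
    by rewrite {1}/mu !dM dnu dz dJi /mu (eq_sym C); ring.
  have k1 D : d D (nu C * (C == B)%:R) = 0.
    by rewrite dM dnu (leibn _ (dM D)) mul0r mulr0 addr0.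
  have k2 D : d D (- (nu B * zb B)) = 0.
    by rewrite raddfN dM dnu dzb !(mul0r, mulr0, addr0) oppr0.
  by rewrite wickDr (wickMr _ _ _ k1) (wickMr _ _ _ k2) !wickJi; ring.
rewrite sumrB big_split -!mulr_suml P_nuzb mul0r subr0 sum_delta_r /=.
by congr (_ + _); ring.
Qed.

(** Under the contraction J behaves like a constant and [mu C] like a linear function of z: at most
    one of the r + 1 slots can hit it, and the slots are interchangeable. *)
Lemma wick_mu C r f g :
  wick r.+1 f (g * mu C) = mu C * wick r.+1 f g + r.+1%:R * Q C r f g.
Proof.
elim: r f g => [|r IH] f g; rewrite wick_mu_step.
  rewrite mul1r wickSr; congr (_ + _); rewrite [RHS]mulr_sumr; apply: eq_bigr => A _.
  by rewrite mulr_sumr; apply: eq_bigr => B _; rewrite !wick0; ring.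
transitivity (mu C * wick r.+2 f g + r.+1%:R * Q C r.+1 f g + Q C r.+1 f g); last first.
  by rewrite [r.+2%:R]mulrS; ring.
congr (_ + _); rewrite wickSr /Q !mulr_sumr.
rewrite [X in _ + X](_ : _ = \sum_A \sum_B P A B * (r.+1%:R * Q C r (db A f) (d B g))); last first.
  under [RHS]eq_bigr => A _.
    under eq_bigr => B _ do rewrite /Q !mulr_sumr.
    rewrite exchange_big /=; over.
  rewrite exchange_big /=; apply: eq_bigr => D _; rewrite wickSr !mulr_sumr.
  apply: eq_bigr => A _; rewrite !mulr_sumr; apply: eq_bigr => B _.
  by rewrite dbC; ring.
rewrite -big_split; apply: eq_bigr => A _; rewrite mulr_sumr -big_split.
by apply: eq_bigr => B _; rewrite IH /=; ring.
Qed.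

(** Homogeneity is recorded as degree -k with k a natural number: invariant functions have k = 0,
    and each derivative raises k by one. *)
Lemma Eb_db k A f : Eb f = - (k%:R * f) -> Eb (db A f) = - (k.+1%:R * db A f).
Proof.
move/(congr1 (db A)); rewrite raddf_sum raddfN dbM (leibn _ (dbM A)) mul0r add0r => e.
apply/eqP; rewrite mulrS mulrDl mul1r opprD addrC -subr_eq opprK -e; apply/eqP.
rewrite -[X in _ + X](sum_delta (fun B => db B f)) -big_split.
by apply: eq_bigr => B _ /=; rewrite dbM dbzb dbC; ring.
Qed.

Lemma E_d k A f : E f = - (k%:R * f) -> E (d A f) = - (k.+1%:R * d A f).
Proof.
move/(congr1 (d A)); rewrite raddf_sum raddfN dM (leibn _ (dM A)) mul0r add0r => e.
apply/eqP; rewrite mulrS mulrDl mul1r opprD addrC -subr_eq opprK -e; apply/eqP.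
rewrite -[X in _ + X](sum_delta (fun B => d B f)) -big_split.
by apply: eq_bigr => B _ /=; rewrite dM dz dC; ring.
Qed.

(** After r derivatives f has degree -(k + r) in the conjugate variables; Euler's identity is
    applied inside the contraction, whose factors P are not differentiated. *)
Lemma Eb_wick k r f g : Eb f = - (k%:R * f) ->
  \sum_A zb A * wick r (db A f) g = - ((k + r)%:R * wick r f g).
Proof.
elim: r k f g => [|r IH] k f g h.
  rewrite addn0 wick0 mulrA -mulNr -h mulr_suml.
  by apply: eq_bigr => A _; rewrite wick0; ring.
rewrite !wickSr mulr_sumr -sumrN.
under eq_bigr do rewrite wickSr mulr_sumr.
rewrite exchange_big; apply: eq_bigr => A _ /=.
under eq_bigr do rewrite mulr_sumr.
rewrite exchange_big mulr_sumr -sumrN; apply: eq_bigr => B _ /=.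
transitivity (P A B * \sum_C zb C * wick r (db C (db A f)) (d B g)).
  by rewrite mulr_sumr; apply: eq_bigr => C _; rewrite dbC; ring.
by rewrite (IH _ _ _ (Eb_db A h)) addSnnS; ring.
Qed.

Lemma E_wick k r f g : E g = - (k%:R * g) ->
  \sum_A z A * wick r f (d A g) = - ((k + r)%:R * wick r f g).
Proof.
elim: r k f g => [|r IH] k f g h.
  rewrite addn0 wick0 mulrCA -mulrN -h mulr_sumr.
  by apply: eq_bigr => A _; rewrite wick0; ring.
rewrite !wickSr mulr_sumr -sumrN.
under eq_bigr do rewrite wickSr mulr_sumr.
rewrite exchange_big; apply: eq_bigr => A _ /=.
under eq_bigr do rewrite mulr_sumr.
rewrite exchange_big mulr_sumr -sumrN; apply: eq_bigr => B _ /=.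
transitivity (P A B * \sum_C z C * wick r (db A f) (d C (d B g))).
  by rewrite mulr_sumr; apply: eq_bigr => C _; rewrite dC; ring.
by rewrite (IH _ _ _ (E_d B h)) addSnnS; ring.
Qed.

Lemma db_P C A B : db C (P A B) = nu C * z C * nu A * (A == B)%:R - (C == A)%:R * z B.
Proof.
by rewrite raddfB !dbM dbnu dbJ dbzb dbz (leibn _ (dbM C)); ring.
Qed.

(** [P A C * nu C * Ji] equals delta_AC - [mu C * zb A], and Euler's identity evaluates the second
    part. *)
Lemma Q_E C r f g : Eb f = 0 ->
  Q C r f g = wick r (db C f) g + r%:R * (mu C * wick r f g).
Proof.
move=> h.
transitivity (\sum_A (wick r (db A f) g * (A == C)%:R - mu C * (zb A * wick r (db A f) g))).
  apply: eq_bigr => A _; rewrite /P.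
  case: (eqVneq A C) => [->|_] /=; last by rewrite /mu; ring.
  transitivity (((nu C * nu C) * (J * Ji) - zb C * mu C) * wick r (db C f) g);
    first by rewrite /mu; ring.
  by rewrite nu2 JJi; ring.
have h' : Eb f = - (0%:R * f) by rewrite h; ring.
by rewrite sumrB sum_delta_l -mulr_sumr (Eb_wick r g h') add0n; ring.
Qed.

Lemma db_wick_step C r f g :
  db C (wick r.+1 f g) = \sum_A \sum_B P A B * db C (wick r (db A f) (d B g)) +
    \sum_A \sum_B db C (P A B) * wick r (db A f) (d B g).
Proof.
rewrite -big_split raddf_sum; apply: eq_bigr => A _.
rewrite raddf_sum -big_split; apply: eq_bigr => B _ /=.
by rewrite dbM addrC.
Qed.

(** The derivative falls on f, on g or on one of the r + 1 factors P, and the latter contribute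
    equally because iterated derivatives are symmetric. *)
Lemma db_wick C r f g :
  db C (wick r.+1 f g) = wick r.+1 (db C f) g + wick r.+1 f (db C g) +
    r.+1%:R * \sum_A \sum_B db C (P A B) * wick r (db A f) (d B g).
Proof.
elim: r f g => [|r IH] f g; rewrite db_wick_step.
  rewrite mul1r; congr (_ + _); rewrite -big_split; apply: eq_bigr => A _.
  rewrite -big_split; apply: eq_bigr => B _ /=.
  by rewrite !wick0 dbM dbC -ddb; ring.
rewrite [r.+2%:R]mulrS [(1 + _) * _]mulrDl mul1r [X in _ = _ + X]addrC addrA.
congr (_ + _).
rewrite [X in _ = _ + X](_ : _ = \sum_A \sum_B P A B * (r.+1%:R *
   \sum_A' \sum_B' db C (P A' B') * wick r (db A' (db A f)) (d B' (d B g)))).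
  rewrite -!big_split; apply: eq_bigr => A _.
  rewrite -!big_split; apply: eq_bigr => B _ /=.
  by rewrite IH !wickSr dbC -ddb; ring.
rewrite mulr_sumr.
under [LHS]eq_bigr => A' _.
  rewrite mulr_sumr; under eq_bigr => B' _.
    rewrite wickSr !mulr_sumr.
    under eq_bigr => A _ do rewrite !mulr_sumr.
    over.
  rewrite exchange_big /=; over.
rewrite exchange_big /=; apply: eq_bigr => A _.
transitivity (\sum_B \sum_A' \sum_B' r.+1%:R * (db C (P A' B') * (P A B * wick r (db A (db A' f)) (d B (d B' g))))).
  under eq_bigr do rewrite exchange_big /=.
  by rewrite exchange_big.
apply: eq_bigr => B _; rewrite !mulr_sumr; apply: eq_bigr => A' _.
rewrite !mulr_sumr; apply: eq_bigr => B' _.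
by rewrite dbC dC; ring.
Qed.

(* The term [r (r + 1) Q] is the curvature of the reduced manifold. *)
Lemma db_wickQ C r f g : Eb f = 0 -> E g = 0 ->
  db C (wick r.+1 f g) - wick r.+1 f (db C g) =
  Q C r.+1 f g + (r.+1 * r)%:R * Q C r f g.
Proof.
move=> hf hg; rewrite db_wick.
have hf' : Eb f = - (0%:R * f) by rewrite hf; ring.
have hg' : E g = - (0%:R * g) by rewrite hg; ring.
have zbw : \sum_A \sum_B zb A * z B * wick r (db A f) (d B g) = r%:R * (r%:R * wick r f g).
  transitivity (\sum_A zb A * - (r%:R * wick r (db A f) g)).
    apply: eq_bigr => A _; rewrite -[in RHS](add0n r) -(E_wick r (db A f) hg') mulr_sumr.
    by apply: eq_bigr => B _; ring.
  transitivity (- r%:R * \sum_A zb A * wick r (db A f) g).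
    by rewrite mulr_sumr; apply: eq_bigr => A _; ring.
  by rewrite (Eb_wick r g hf') add0n; ring.
(* [db C (P A B)] is [mu C * (P A B + zb A * z B)] minus delta_CA [z B], so besides [wick r.+1 f g]
   only contractions with Euler fields occur. *)
have -> : \sum_A \sum_B db C (P A B) * wick r (db A f) (d B g) =
   mu C * (wick r.+1 f g + r%:R * (r%:R * wick r f g)) + r%:R * wick r (db C f) g.
  rewrite -zbw wickSr -big_split mulr_sumr.
  transitivity (\sum_A \sum_B mu C * (P A B * wick r (db A f) (d B g) + zb A * z B * wick r (db A f) (d B g)) - \sum_A (C == A)%:R * \sum_B z B * wick r (db A f) (d B g)).
    rewrite -sumrB; apply: eq_bigr => A _; rewrite mulr_sumr -sumrB; apply: eq_bigr => B _ /=.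
    rewrite db_P /P /mu; transitivity ((nu C * z C * nu A * (A == B)%:R * (J * Ji) - (C == A)%:R * z B) *
wick r (db A f) (d B g)); first by rewrite JJi mulr1.
    ring.
  rewrite sum_delta (E_wick r (db C f) hg') add0n opprK; congr (_ + _).
  by apply: eq_bigr => A _; rewrite -big_split mulr_sumr.
rewrite !Q_E // natrM; ring.
Qed.

(** Each d_B lowers the degree in z by one and the accompanying P, of degree 1, restores it; hence E
    is a derivation of the product [wick r]. *)
Lemma E_wick0 r f g : E f = 0 -> E g = 0 -> E (wick r f g) = 0.
Proof.
have EM x y : E (x * y) = E x * y + x * E y.
  by rewrite /E mulr_suml mulr_sumr -big_split; apply: eq_bigr => A _; rewrite dM /=; ring.
have ED (s : seq I) F : E (\sum_(A <- s) F A) = \sum_(A <- s) E (F A).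
  rewrite /E exchange_big /=; apply: eq_bigr => A _.
  by rewrite raddf_sum mulr_sumr.
have EP A B : E (P A B) = P A B.
  transitivity (\sum_C (nu C * (z C * zb C) * (nu A * (A == B)%:R) - (zb A * z C) * (C == B)%:R)).
    apply: eq_bigr => C _; rewrite /P raddfB !dM dJ dnu dzb dz (leibn _ (dM C)).
    by ring.
  by rewrite sumrB -mulr_suml -/J sum_delta_l /P; ring.
suff H : E (wick r f g) = wick r (E f) g + wick r f (E g).
  by move=> hf hg; rewrite H hf hg wick0l wick0r addr0.
elim: r f g => [|r IH] f g; first by rewrite !wick0 EM.
rewrite !wickSr ED -big_split; apply: eq_bigr => A _; rewrite ED -big_split.
apply: eq_bigr => B _ /=; rewrite EM EP IH.
have -> : E (db A f) = db A (E f).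
  by rewrite raddf_sum; apply: eq_bigr => C _; rewrite dbM dbz ddb mul0r add0r.
have -> : d B (E g) = E (d B g) + d B g.
  rewrite raddf_sum -[X in _ + X](sum_delta (fun C => d C g)) -big_split.
  by apply: eq_bigr => C _ /=; rewrite dM dz dC; ring.
by rewrite !wickDr; ring.
Qed.

Lemma Eb_wick0 r f g : Eb f = 0 -> Eb g = 0 -> Eb (wick r f g) = 0.
Proof.
have EM x y : Eb (x * y) = Eb x * y + x * Eb y.
  by rewrite /Eb mulr_suml mulr_sumr -big_split; apply: eq_bigr => A _; rewrite dbM /=; ring.
have ED (s : seq I) F : Eb (\sum_(A <- s) F A) = \sum_(A <- s) Eb (F A).
  rewrite /Eb exchange_big /=; apply: eq_bigr => A _.
  by rewrite raddf_sum mulr_sumr.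
have EP A B : Eb (P A B) = P A B.
  transitivity (\sum_C (nu C * (z C * zb C) * (nu A * (A == B)%:R) - (z B * zb C) * (C == A)%:R)).
    by apply: eq_bigr => C _; rewrite db_P; ring.
  by rewrite sumrB -mulr_suml -/J sum_delta_l /P; ring.
suff H : Eb (wick r f g) = wick r (Eb f) g + wick r f (Eb g).
  by move=> hf hg; rewrite H hf hg wick0l wick0r addr0.
elim: r f g => [|r IH] f g; first by rewrite !wick0 EM.
rewrite !wickSr ED -big_split; apply: eq_bigr => A _; rewrite ED -big_split.
apply: eq_bigr => B _ /=; rewrite EM EP IH.
have -> : Eb (d B g) = d B (Eb g).
  by rewrite raddf_sum; apply: eq_bigr => C _; rewrite dM dzb ddb mul0r add0r.
have -> : db A (Eb f) = Eb (db A f) + db A f.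
  rewrite raddf_sum -[X in _ + X](sum_delta (fun C => db C f)) -big_split.
  by apply: eq_bigr => C _ /=; rewrite dbM dbzb dbC; ring.
by rewrite !wickDl; ring.
Qed.

Variables (F : numFieldType) (cst : {rmorphism F -> S}) (c : nat -> nat -> F).
Hypotheses
  (dcst : forall A k, d A (cst k) = 0) (dbcst : forall A k, db A (cst k) = 0)
  (c0 : forall m, c 0 m = (m == 0%N)%:R)
  (c_gt : forall r m, (m < r)%N -> c r m = 0)
  (cS : forall r m, c r m + (r.+1 * r)%:R * c r.+1 m = r.+1%:R * c r.+1 m.+1).

Definition wickS m f g : S := \sum_(r < m.+1) cst (c r m) * wick r f g.

Lemma cstk A k x : d A (cst k * x) = cst k * d A x.
Proof. by rewrite dM dcst mul0r add0r. Qed.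

Lemma wickS_subr m f g h : wickS m f (g - h) = wickS m f g - wickS m f h.
Proof. by rewrite -sumrB; apply: eq_bigr => r _; rewrite wick_subr; ring. Qed.

Lemma wickSDr m f g h : wickS m f (g + h) = wickS m f g + wickS m f h.
Proof. by rewrite -big_split; apply: eq_bigr => r _; rewrite wickDr mulrDr. Qed.
Lemma wickSDl m f g h : wickS m (g + h) f = wickS m g f + wickS m h f.
Proof. by rewrite -big_split; apply: eq_bigr => r _; rewrite wickDl mulrDr. Qed.
Lemma wickS0r m f : wickS m f 0 = 0.
Proof. by rewrite -{1}(subrr 0) wickS_subr subrr. Qed.

Lemma wickSZr m f g k : wickS m f (cst k * g) = cst k * wickS m f g.
Proof.
by rewrite mulr_sumr; apply: eq_bigr => r _; rewrite wickMr => [|A]; rewrite ?dcst //; ring.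
Qed.
Lemma wickSZl m f g k : wickS m (cst k * f) g = cst k * wickS m f g.
Proof.
by rewrite mulr_sumr; apply: eq_bigr => r _; rewrite wickMl => [|A]; rewrite ?dbcst //; ring.
Qed.

Lemma E_cst k f : E (cst k * f) = cst k * E f.
Proof. by rewrite mulr_sumr; apply: eq_bigr => A _; rewrite cstk; ring. Qed.
Lemma E_sum (K : Type) (s : seq K) G : E (\sum_(i <- s) G i) = \sum_(i <- s) E (G i).
Proof.
by rewrite /E exchange_big /=; apply: eq_bigr => A _; rewrite raddf_sum mulr_sumr.
Qed.
Lemma Eb_sum (K : Type) (s : seq K) G : Eb (\sum_(i <- s) G i) = \sum_(i <- s) Eb (G i).
Proof.
by rewrite /Eb exchange_big /=; apply: eq_bigr => A _; rewrite raddf_sum mulr_sumr.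
Qed.

Lemma E_wickS m f g : E f = 0 -> E g = 0 -> E (wickS m f g) = 0.
Proof.
by move=> hf hg; rewrite E_sum big1 // => r _; rewrite E_cst E_wick0 // mulr0.
Qed.
Lemma Eb_wickS m f g : Eb f = 0 -> Eb g = 0 -> Eb (wickS m f g) = 0.
Proof.
move=> hf hg; rewrite Eb_sum big1 // => r _.
transitivity (cst (c r m) * Eb (wick r f g)); last by rewrite Eb_wick0 // mulr0.
by rewrite mulr_sumr; apply: eq_bigr => A _; rewrite dbM dbcst; ring.
Qed.

Lemma wickS_mu0 C f h : wickS 0 f (h * mu C) = mu C * wickS 0 f h.
Proof. by rewrite /wickS !big_ord_recl !big_ord0 !wick0; ring. Qed.

(** By [wick_mu] the left side contains [Q C r f h] with coefficient (r+1) c_(r+1)(m+1); by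
    [db_wickQ] the bracket contains it with coefficient c_r(m) + (r+1) r c_(r+1)(m). The recurrence
    [cS] equates the two. *)
Lemma wickS_mu m C f h : Eb f = 0 -> E h = 0 ->
  wickS m.+1 f (h * mu C) = mu C * wickS m.+1 f h +
    (db C (wickS m f h) - wickS m f (db C h)).
Proof.
move=> hf hh.
transitivity (mu C * wickS m.+1 f h +
   \sum_(r < m.+1) cst (r.+1%:R * c r.+1 m.+1) * Q C r f h).
  rewrite /wickS big_ord_recl [X in mu C * X]big_ord_recl mulrDr -addrA wick0.
  congr (_ + _); first by rewrite wick0; ring.
  rewrite mulr_sumr -big_split; apply: eq_bigr => r _ /=.
  by rewrite /bump /= wick_mu rmorphM rmorph_nat; ring.
congr (_ + _); rewrite raddf_sum -sumrB.
transitivity (\sum_(r < m.+1) (cst (c r m) * Q C r f h + cst ((r.+1 * r)%:R * c r.+1 m) * Q C r f h)).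
  by apply: eq_bigr => r _; rewrite -cS rmorphD mulrDl.
(* The curvature term at the upper end carries c_(m+1)(m), which is 0. *)
rewrite big_split /= [X in _ + X]big_ord_recr /= [c m.+1 m]c_gt // mulr0 rmorph0 mul0r addr0.
rewrite big_ord_recl [RHS]big_ord_recl -addrA; congr (_ + _).
  by rewrite /= dbM dbcst Q_E // !wick0 dbM; ring.
rewrite -big_split; apply: eq_bigr => r _ /=.
rewrite /bump /= add1n dbM dbcst mul0r add0r -mulrBr db_wickQ //.
by rewrite rmorphM rmorph_nat; ring.
Qed.

Section AssociatorJets.
Variables f g : S.
Hypotheses (Ef : E f = 0) (Ebf : Eb f = 0) (Eg : E g = 0) (Ebg : Eb g = 0).

Let assoc m h : S := \sum_(i < m.+1)
  (wickS i f (wickS (m - i) g h) - wickS i (wickS (m - i) f g) h).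

Lemma assoc_mu0 C h : assoc 0 (h * mu C) = mu C * assoc 0 h.
Proof. by rewrite /assoc !big_ord_recl !big_ord0 /wickS !big_ord_recl !big_ord0 !wick0; ring. Qed.

(** Moving [mu C] out of either bracketing costs commutators with [db C] of one order less. When f
    multiplies the product of g and h, the derivative of the inner product occurs with both signs
    and cancels, which leaves the commutator of [db C] with the whole associator. *)
Lemma assoc_mu m C h : E h = 0 ->
  assoc m.+1 (h * mu C) = mu C * assoc m.+1 h + (db C (assoc m h) - assoc m (db C h)).
Proof.
move=> hh.
(* [X 0] is 0 since order 0 is the pointwise product, which commutes with multiplication by
   [mu C]. *)
pose X i u v := if i is i'.+1 then db C (wickS i' u v) - wickS i' u (db C v) else 0.
have SX i u v : Eb u = 0 -> E v = 0 -> wickS i u (v * mu C) = mu C * wickS i u v + X i u v.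
  by move=> hu hv; case: i => [|i] /=; [rewrite wickS_mu0 addr0|rewrite wickS_mu].
have -> : assoc m.+1 (h * mu C) = mu C * assoc m.+1 h + 
    \sum_(i < m.+2) (X i f (wickS (m.+1 - i) g h) + wickS i f (X (m.+1 - i)%N g h)
       - X i (wickS (m.+1 - i) f g) h).
  rewrite mulr_sumr -big_split; apply: eq_bigr => i _ /=.
  rewrite (SX _ g) // wickSDr -(mulrC (wickS _ _ _)) (SX i f) ?E_wickS //.
  by rewrite (SX i (wickS _ _ _)) ?Eb_wickS //; ring.
congr (_ + _); rewrite sumrB big_split /=.
(* The terms containing [X 0] are dropped: i = 0 in the first and third sum, i = m + 1 in the
   second. The others are indexed by the orders up to m. *)
rewrite big_ord_recl [X in _ + X - _]big_ord_recr [X in _ - X]big_ord_recl.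
rewrite /= subnn [X 0%N _ _]/= wickS0r !add0r addr0.
rewrite -big_split -sumrB [in RHS]raddf_sum -sumrB; apply: eq_bigr => i _ /=.
rewrite ?/bump /= ?add1n ?subSS subSn; last by rewrite -ltnS.
by rewrite /= add0n wickS_subr [in RHS]raddfB; ring.
Qed.

Lemma assocB m h k : assoc m (h - k) = assoc m h - assoc m k.
Proof.
by rewrite -sumrB; apply: eq_bigr => i _; rewrite !wickS_subr; ring.
Qed.
Lemma assocZ m k h : assoc m (cst k * h) = cst k * assoc m h.
Proof.
by rewrite mulr_sumr; apply: eq_bigr => i _; rewrite !wickSZr; ring.
Qed.
Lemma assoc0 m : assoc m 0 = 0.
Proof. by rewrite -{1}(subrr 0) assocB subrr. Qed.
Lemma assocD m h k : assoc m (h + k) = assoc m h + assoc m k.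
Proof. by rewrite -{1}(opprK k) -[- k]sub0r !assocB assoc0 sub0r opprK. Qed.
Lemma assoc_sum m (K : Type) (s : seq K) G :
  assoc m (\sum_(i <- s) G i) = \sum_(i <- s) assoc m (G i).
Proof. exact: (big_morph _ (assocD m) (assoc0 m)). Qed.

Lemma wickS1r m u : wickS m u 1 = if m is 0%N then u else 0.
Proof.
rewrite /wickS big_ord_recl big1 => [|i _]; last first.
  rewrite wickSr big1 ?mulr0 // => A _; rewrite big1 // => B _.
  by rewrite (leib1 (dM B)) wick0r mulr0.
by rewrite c0 wick0 addr0 mulr1; case: m => [|m]; rewrite /= ?rmorph1 ?mul1r ?rmorph0 ?mul0r.
Qed.

Lemma wickS1l m u : wickS m 1 u = if m is 0%N then u else 0.
Proof.
rewrite /wickS big_ord_recl big1 => [|i _]; last first.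
  rewrite wickSr big1 ?mulr0 // => A _; rewrite big1 // => B _.
  by rewrite (leib1 (dbM A)) wick0l mulr0.
by rewrite c0 wick0 addr0 mul1r; case: m => [|m]; rewrite /= ?rmorph1 ?mul1r ?rmorph0 ?mul0r.
Qed.

Lemma assoc1 m : assoc m 1 = 0.
Proof.
rewrite /assoc sumrB big_ord_recr big_ord_recl /= subnn subn0 !wickS1r.
rewrite big1 => [|i _]; last first.
  by rewrite wickS1r -(prednK (_ : 0 < m - i)%N) ?subn_gt0 // wickS0r.
rewrite big1 => [|i _]; last by rewrite /bump /= add1n wickS1r.
by rewrite add0r addr0 subrr.
Qed.

Section Jets.
Variable ev : {rmorphism S -> F}.
Hypothesis ev_cst : forall k, ev (cst k) = k.
Variable j : I.
Hypothesis zj : ev (z j) != 0.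

(** Vanishing at the point of all holomorphic derivatives of order below N. Antiholomorphic ones are
    left free because a contraction differentiates its last argument only by [d]. *)
Fixpoint flat N (h : S) : Prop :=
  if N is N'.+1 then ev h = 0 /\ forall A, flat N' (d A h) else True.

Lemma flatW N h : flat N.+1 h -> flat N h.
Proof.
elim: N h => [//|N IH] h [e H]; split=> // A; exact: IH (H A).
Qed.
Lemma flat_le N N' h : (N <= N')%N -> flat N' h -> flat N h.
Proof.
move=> /subnK <-; elim: (N' - N)%N h => [//|k IH] h H; apply: IH; exact: flatW.
Qed.
Lemma flatD N h k : flat N h -> flat N k -> flat N (h + k).
Proof.
elim: N h k => [//|N IH] h k [e H] [e' H']; split=> [|A].
  by rewrite rmorphD /= e e' addr0.
by rewrite raddfD; apply: IH; [exact: H|exact: H'].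
Qed.
Lemma flat0 N : flat N 0.
Proof. by elim: N => [//|N IH]; split=> [|A]; rewrite ?rmorph0 ?raddf0. Qed.
Lemma flat_sum N (K : Type) (s : seq K) G : (forall i, flat N (G i)) -> flat N (\sum_(i <- s) G i).
Proof.
move=> H; elim: s => [|i s IH]; first by rewrite big_nil; exact: flat0.
by rewrite big_cons; apply: flatD.
Qed.
Lemma flatM N h k : flat N h -> flat N (k * h).
Proof.
elim: N h k => [//|N IH] h k H; split=> [|A].
  by case: H => e _; rewrite rmorphM /= e mulr0.
by rewrite dM; apply: flatD; apply: IH; [exact: flatW|exact: H.2].
Qed.
Lemma flatN N h : flat N h -> flat N (- h).
Proof. by move=> H; rewrite -mulN1r; apply: flatM. Qed.
Lemma flatMS N h k : ev k = 0 -> flat N h -> flat N.+1 (k * h).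
Proof.
move=> k0; elim: N h => [|N IH] h H; split=> [|A] //; try by rewrite rmorphM /= k0 mul0r.
by rewrite dM; apply: flatD; [exact: flatM|apply: IH; exact: H.2].
Qed.

Lemma flat_wick N r u h : flat (N + r) h -> flat N (wick r u h).
Proof.
elim: r u h => [|r IH] u h; first by rewrite addn0 wick0; exact: flatM.
rewrite addnS => -[_ H]; rewrite wickSr; apply: flat_sum => A; apply: flat_sum => B.
by apply/flatM/IH; exact: H.
Qed.
Lemma flat_wickS N m u h : flat (N + m) h -> flat N (wickS m u h).
Proof.
move=> H; apply: flat_sum => r; apply/flatM/flat_wick; apply: flat_le H.
by rewrite leq_add2l -ltnS.
Qed.
(** Each of the two nested products takes at most m derivatives of its last argument, hence the
    generous bound 2 m. *)
Lemma flat_assoc m h : flat (m + m).+1 h -> ev (assoc m h) = 0.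
Proof.
move=> H; suff: flat 1 (assoc m h) by case.
apply: flat_sum => i; apply: flatD; last apply: flatN; do ?apply: flat_wickS.
  apply: flat_le H; rewrite -addnA add1n ltnS leq_add ?leq_subr // -ltnS //.
apply: flat_le H; rewrite add1n ltnS (leq_trans _ (leq_addr _ _)) // -ltnS //.
Qed.

Let ka k := cst (ev (z k) / ev (z j)).
(** Unlike z_k minus its value, [v k] both vanishes at the point and is homogeneous of degree 1 in
    z, so that [V] preserves functions of degree 0. *)
Let v k := z k - ka k * z j.
Let V h := \sum_k v k * d k h.

Lemma ev_v k : ev (v k) = 0.
Proof. by rewrite rmorphB rmorphM /= ev_cst divfK ?subrr. Qed.

(* Up to higher order a function which is N-flat is homogeneous of degree N, so
   that Euler's vector field [V] centered at the point multiplies it by N. *)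
Lemma flat_euler N e h : E h = - (e%:R * h) -> flat N h -> flat N.+1 (N%:R * h - V h).
Proof.
elim: N e h => [|N IH] e h hh H.
  split=> // ; rewrite mul0r sub0r raddfN /V raddf_sum big1 ?oppr0 // => k _.
  by rewrite /= rmorphM /= ev_v mul0r.
split=> [|A].
  case: H => e0 _; rewrite rmorphB rmorphM /= e0 mulr0 sub0r /V raddf_sum big1 ?oppr0 // => k _.
  by rewrite /= rmorphM /= ev_v mul0r.
(* The derivative in the direction of the point itself, divided by [ev (z j)]. Homogeneity of h
   expresses it by h and by products of derivatives of h with functions vanishing at the point, so
   it is as flat as h. *)
pose W := \sum_k ka k * d k h.
have dv k : d A (v k) = (A == k)%:R - ka k * (A == j)%:R.
  by rewrite raddfB dM dcst !dz mul0r add0r.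
have -> : d A (N.+1%:R * h - V h) = (N%:R * d A h - V (d A h)) + (A == j)%:R * W.
  rewrite raddfB dM (leibn _ (dM A)) mul0r add0r.
  have -> : d A (V h) = d A h + V (d A h) - (A == j)%:R * W.
    rewrite raddf_sum -[X in X + _ - _](sum_delta (fun k => d k h)) mulr_sumr -big_split -sumrB.
    by apply: eq_bigr => k _ /=; rewrite dM dv dC; ring.
  by rewrite [N.+1%:R]mulrS; ring.
apply: flatD; first by apply: IH (E_d A hh) _; exact: H.2.
apply: flatM.
have -> : W = cst (ev (z j))^-1 * (- (e%:R * h) - \sum_k (z k - cst (ev (z k))) * d k h).
  rewrite -hh -sumrB mulr_sumr; apply: eq_bigr => k _.
  by rewrite /ka rmorphM /=; ring.
apply/flatM/flatD; first exact/flatN/flatM.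
apply/flatN/flat_sum => k; apply: flatMS; first by rewrite rmorphB /= ev_cst subrr.
exact: H.2.
Qed.

(** Linearity over the functions mu makes the associator of [V x] vanish at the point. As (N+1) x -
    V x is flatter than x, the associator of x there is that of a flatter function divided by N + 1;
    repeating this ends with [flat_assoc]. *)
Lemma ev_assoc m h : (forall C h, E h = 0 -> assoc m (h * mu C) = mu C * assoc m h) ->
  E h = 0 -> ev (assoc m h) = 0.
Proof.
move=> Hmu hh.
have EM x y : E (x * y) = E x * y + x * E y.
  by rewrite /E mulr_suml mulr_sumr -big_split; apply: eq_bigr => A _; rewrite dM /=; ring.
have EJd k x : E x = 0 -> E (J * d k x) = 0.
  move=> hx; have hx' : E x = - (0%:R * x) by rewrite hx; ring.
  rewrite EM (E_d k hx') (_ : E J = J); first by ring.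
  by apply: eq_bigr => A _; rewrite dJ; ring.
have EJ x : E x = 0 -> ev (assoc m (V x)) = 0.
  move=> hx; rewrite /V assoc_sum raddf_sum big1 // => k _.
  (* The factor J is moved to the derivative to give [J * d k x] degree 0 in z, as linearity over mu
     demands. *)
  have -> : v k * d k x = (nu k * (J * d k x)) * mu k -
      ka k * ((nu j * (J * d k x)) * mu j).
    transitivity ((nu k * nu k) * (J * Ji) * (z k * d k x) -
                  (nu j * nu j) * (J * Ji) * (ka k * z j * d k x)).
      by rewrite !nu2 JJi /v; ring.
    by rewrite /mu; ring.
  have Enu B y : E y = 0 -> E (nu B * y) = 0.
    move=> hy; rewrite EM hy mulr0 addr0 /E big1 ?mul0r // => A _.
    by rewrite dnu mulr0.
  have Anu B y : assoc m (nu B * y) = nu B * assoc m y.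
    rewrite mulr_sumr; apply: eq_bigr => i _.
    have nuS i' u y' : wickS i' u (nu B * y') = nu B * wickS i' u y'.
      by rewrite mulr_sumr; apply: eq_bigr => r _; rewrite wickMr //; ring.
    by rewrite !nuS; ring.
  rewrite assocB assocZ !Hmu ?Anu; try by apply/Enu/EJd.
  have -> : mu k * (nu k * assoc m (J * d k x)) - ka k * (mu j * (nu j * assoc m (J * d k x))) =
      v k * (Ji * assoc m (J * d k x)).
    transitivity ((nu k * nu k) * z k * (Ji * assoc m (J * d k x)) -
                  (nu j * nu j) * ka k * z j * (Ji * assoc m (J * d k x))).
      by rewrite /mu; ring.
    by rewrite !nu2 /v; ring.
  by rewrite /= rmorphM /= ev_v mul0r.
have Hn N x : E x = 0 -> flat N.+1 x -> ev (assoc m x) = 0.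
  have [k le_k] := ubnP ((m + m).+1 - N)%N; elim: k N x le_k => [//|k IH] N x le_k hx fx.
  have [le_N|lt_N] := leqP (m + m).+1 N.
    by apply: flat_assoc; apply: flat_le fx; exact: leqW.
  have hx' : E x = - (0%:R * x) by rewrite hx; ring.
  have fV := flat_euler hx' fx.
  have EV : E (N.+1%:R * x - V x) = 0.
    have EB y y' : E (y - y') = E y - E y'.
      by rewrite /E -sumrB; apply: eq_bigr => A _; rewrite raddfB; ring.
    rewrite EB EM hx mulr0 addr0 {1}/E big1 => [|A _]; last by rewrite (leibn _ (dM A)) mulr0.
    rewrite mul0r sub0r E_sum big1 ?oppr0 // => A _.
    have -> : v A * d A x = J * d A x * (z A * Ji - ka A * z j * Ji).
      by transitivity (v A * d A x * (J * Ji)); [rewrite JJi mulr1|rewrite /v; ring].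
    rewrite EM EJd // mul0r add0r.
    have Ezi B : E (z B * Ji) = 0.
      rewrite EM (_ : E (z B) = z B); last first.
        by rewrite -[RHS](sum_delta_l z); apply: eq_bigr => D _; rewrite dz.
      rewrite (_ : E Ji = - (J * Ji * Ji)); first by rewrite JJi; ring.
      rewrite mulr_suml mulr_suml -sumrN; apply: eq_bigr => D _; rewrite dJi; ring.
    by rewrite EB Ezi -[ka A * _ * _]mulrA /ka E_cst Ezi mulr0 subrr mulr0.
  have := IH _ _ _ EV fV.
  have /[swap] /[apply] : ((m + m).+1 - N.+1 < k)%N.
    by rewrite subnS -ltnS prednK ?subn_gt0.
  rewrite assocB rmorphB /= EJ // subr0.
  rewrite -(rmorph_nat cst) assocZ rmorphM /= ev_cst => /eqP.
  by rewrite mulf_eq0 pnatr_eq0 /= => /eqP.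
(* Subtracting the value at the point makes h flat of order 1, and by [assoc1] constants do not
   contribute. *)
have ex : E (h - cst (ev h) * 1) = 0.
  have EB y y' : E (y - y') = E y - E y'.
    by rewrite /E -sumrB; apply: eq_bigr => A _; rewrite raddfB; ring.
  rewrite EB hh E_cst /E big1 ?mulr0 ?subrr // => A _.
  by rewrite (leib1 (dM A)) mulr0.
have := Hn 0%N _ ex; rewrite assocB assocZ assoc1 mulr0 subr0; apply.
by split=> //; rewrite rmorphB rmorphM rmorph1 /= ev_cst mulr1 subrr.
Qed.
End Jets.

Variables (pt : Type) (ev : pt -> {rmorphism S -> F}).
Hypotheses (ev_cst : forall p k, ev p (cst k) = k)
  (ev_z : forall p, exists j, ev p (z j) != 0)
  (ev_inj : forall x, (forall p, ev p x = 0) -> x = 0).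

Lemma assoc_eq0 m h : E h = 0 -> assoc m h = 0.
Proof.
elim: m h => [|m IH] h hh; apply: ev_inj => p; have [j zj] := ev_z p.
  by apply: (ev_assoc (ev_cst p) zj) => // C x hx; exact: assoc_mu0.
apply: (ev_assoc (ev_cst p) zj) => // C x hx; rewrite assoc_mu // !IH ?raddf0 ?subr0 ?addr0 //.
(* The induction hypothesis is also applied to [db C x], which must again have degree 0 in z. *)
have -> : E (db C x) = db C (E x).
  by rewrite /E raddf_sum; apply: eq_bigr => A _; rewrite dbM dbz ddb mul0r add0r.
by rewrite hx raddf0.
Qed.
End AssociatorJets.
End WickAlgebra.

(** * Derivatives of complex-valued functions of a real variable *)

Section ComplexDerivative.
Variable R : realType.
Local Notation C := (Cplx R).
Implicit Types (phi psi : R -> C) (l k : C).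

(** Real and imaginary parts are differentiated separately, as in [dirD]; carrying the value makes
    existence and computation a single fact. *)
Definition derC (phi : R -> C) (x : R) (l : C) : Prop :=
  is_derive x (1 : R) (fun t => complex.Re (phi t)) (complex.Re l) /\
  is_derive x (1 : R) (fun t => complex.Im (phi t)) (complex.Im l).

Lemma complexReD (a b : C) : complex.Re (a + b) = complex.Re a + complex.Re b.
Proof. by case: a; case: b. Qed.
Lemma complexImD (a b : C) : complex.Im (a + b) = complex.Im a + complex.Im b.
Proof. by case: a; case: b. Qed.
Lemma complexReM (a b : C) :
  complex.Re (a * b) = complex.Re a * complex.Re b - complex.Im a * complex.Im b.
Proof. by case: a; case: b. Qed.
Lemma complexImM (a b : C) :
  complex.Im (a * b) = complex.Re a * complex.Im b + complex.Im a * complex.Re b.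
Proof. by case: a => a1 a2; case: b. Qed.
Lemma complexReN (a : C) : complex.Re (- a) = - complex.Re a.
Proof. by case: a. Qed.
Lemma complexImN (a : C) : complex.Im (- a) = - complex.Im a.
Proof. by case: a. Qed.
Lemma Re_conj (a : C) : complex.Re a^* = complex.Re a.
Proof. by case: a. Qed.
Lemma Im_conj (a : C) : complex.Im a^* = - complex.Im a.
Proof. by case: a. Qed.
Lemma ReIm_eq (a b : C) : complex.Re a = complex.Re b -> complex.Im a = complex.Im b -> a = b.
Proof. by case: a; case: b => ? ? ? ? /= -> ->. Qed.

Lemma derC_unique phi x l k : derC phi x l -> derC phi x k -> l = k.
Proof.
move=> [a b] [a' b']; apply: ReIm_eq.
  by rewrite -(@derive_val _ _ _ _ _ _ _ a) (@derive_val _ _ _ _ _ _ _ a').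
by rewrite -(@derive_val _ _ _ _ _ _ _ b) (@derive_val _ _ _ _ _ _ _ b').
Qed.

Lemma derC_eq phi x l k : derC phi x l -> l = k -> derC phi x k.
Proof. by move=> ? <-. Qed.

Lemma derC_cst l x : derC (fun=> l) x 0.
Proof. by split; exact: is_derive_cst. Qed.

Lemma derCD phi psi x l k : derC phi x l -> derC psi x k -> derC (fun t => phi t + psi t) x (l + k).
Proof.
move=> [a b] [a' b']; split.
  by rewrite complexReD (_ : (fun t => _) = (fun t => complex.Re (phi t)) + (fun t => complex.Re (psi t)));
    [exact: is_deriveD|apply/funext => t; exact: complexReD].
by rewrite complexImD (_ : (fun t => _) = (fun t => complex.Im (phi t)) + (fun t => complex.Im (psi t)));
  [exact: is_deriveD|apply/funext => t; exact: complexImD].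
Qed.

Lemma is_deriveM_eta (x : R) (f g : R -> R) (df dg : R) : is_derive x (1 : R) f df ->
  is_derive x (1 : R) g dg ->
  is_derive x (1 : R) (fun t => f t * g t) (f x * dg + g x * df).
Proof. by move=> ? ?; exact: is_deriveM. Qed.
Lemma is_deriveD_eta (x : R) (f g : R -> R) (df dg : R) : is_derive x (1 : R) f df ->
  is_derive x (1 : R) g dg -> is_derive x (1 : R) (fun t => f t + g t) (df + dg).
Proof. by move=> ? ?; exact: is_deriveD. Qed.
Lemma is_deriveB_eta (x : R) (f g : R -> R) (df dg : R) : is_derive x (1 : R) f df ->
  is_derive x (1 : R) g dg -> is_derive x (1 : R) (fun t => f t - g t) (df - dg).
Proof. by move=> ? ?; exact: is_deriveB. Qed.
Lemma is_deriveN_eta (x : R) (f : R -> R) (df : R) : is_derive x (1 : R) f df ->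
  is_derive x (1 : R) (fun t => - f t) (- df).
Proof. by move=> ?; exact: is_deriveN. Qed.

Lemma is_derive_eq1 (x : R) (f : R -> R) (a b : R) : is_derive x (1 : R) f a -> a = b ->
  is_derive x (1 : R) f b.
Proof. by move=> ? <-. Qed.

Lemma derCM phi psi x l k : derC phi x l -> derC psi x k ->
  derC (fun t => phi t * psi t) x (l * psi x + phi x * k).
Proof.
move=> [a b] [a' b']; split.
  rewrite (_ : (fun t => _) = (fun t => complex.Re (phi t) * complex.Re (psi t)
     - complex.Im (phi t) * complex.Im (psi t))); last first.
    by apply/funext => t; exact: complexReM.
  apply: is_derive_eq1 (is_deriveB_eta (is_deriveM_eta a a') (is_deriveM_eta b b')) _.
  by rewrite complexReD !complexReM; ring.
rewrite (_ : (fun t => _) = (fun t => complex.Re (phi t) * complex.Im (psi t)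
   + complex.Im (phi t) * complex.Re (psi t))); last first.
  by apply/funext => t; exact: complexImM.
apply: is_derive_eq1 (is_deriveD_eta (is_deriveM_eta a b') (is_deriveM_eta b a')) _.
by rewrite complexImD !complexImM; ring.
Qed.

Lemma derC_conj phi x l : derC phi x l -> derC (fun t => (phi t)^*) x l^*.
Proof.
move=> [a b]; split.
  by rewrite Re_conj (_ : (fun t => _) = fun t => complex.Re (phi t)) //; apply/funext => t; rewrite Re_conj.
rewrite Im_conj (_ : (fun t => _) = (fun t => - complex.Im (phi t))); first exact: is_deriveN_eta.
by apply/funext => t; rewrite Im_conj.
Qed.

Lemma derCV phi x l : phi x != 0 -> derC phi x l ->
  derC (fun t => (phi t)^-1) x (- l / phi x ^+ 2).
Proof.
move=> p0 [a b].
have n0 : complex.Re (phi x) * complex.Re (phi x) + complex.Im (phi x) * complex.Im (phi x) != 0.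
  apply: contraNneq p0 => /eqP; rewrite paddr_eq0 ?sqr_ge0 -?expr2 // !sqrf_eq0.
  by case: (phi x) => u v /= /andP[/eqP-> /eqP->].
have iV (f : R -> R) v : f x != 0 -> is_derive x (1 : R) f v ->
    is_derive x (1 : R) (fun t => (f t)^-1) (- (f x) ^- 2 * v).
  by move=> f0 H; exact: is_deriveV.
have dn := iV _ _ n0 (is_deriveD_eta (is_deriveM_eta a a) (is_deriveM_eta b b)).
(* Expanding by the conjugate leaves a real denominator, so the rules for real functions apply to
   both parts. *)
have E : - l / phi x ^+ 2 = - l * (phi x)^* ^+ 2 * (phi x * (phi x)^*) ^- 2.
  have c0 : (phi x)^* != 0 by rewrite conjC_eq0.
  by field; rewrite ?p0 ?c0.
have Er : phi x * (phi x)^* = real_complex R (complex.Re (phi x) * complex.Re (phi x) + complex.Im (phi x) * complex.Im (phi x)).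
  by apply: ReIm_eq; rewrite ?complexReM ?complexImM ?Re_conj ?Im_conj /=; ring.
have Ei (y : R) : (real_complex R y : C) ^- 2 = real_complex R (y ^- 2).
  by rewrite -exprVn -[y ^- 2]exprVn rmorphXn /= [in RHS]fmorphV.
rewrite E Er Ei; split.
  rewrite (_ : (fun t => _) = (fun t => complex.Re (phi t) * (complex.Re (phi t) * complex.Re (phi t) + complex.Im (phi t) * complex.Im (phi t))^-1)); last first.
    by apply/funext => t; case: (phi t) => u v /=; rewrite !expr2.
  apply: is_derive_eq1 (is_deriveM_eta a dn) _.
  rewrite /= complexReM /= complexReM complexReN complexImN expr2 complexReM complexImM !Re_conj !Im_conj.
  by field; exact: n0.
rewrite (_ : (fun t => _) = (fun t => - (complex.Im (phi t) * (complex.Re (phi t) * complex.Re (phi t) + complex.Im (phi t) * complex.Im (phi t))^-1))); last first.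
  by apply/funext => t; case: (phi t) => u v /=; rewrite !expr2 ?mulNr.
apply: is_derive_eq1 (is_deriveN_eta (is_deriveM_eta b dn)) _.
rewrite /= complexImM /= complexImM complexReM complexReN complexImN expr2 complexReM complexImM !Re_conj !Im_conj.
by field; exact: n0.
Qed.

Lemma derC_near phi psi x l : (\forall t \near x, phi t = psi t) -> derC phi x l -> derC psi x l.
Proof.
move=> e [a b]; split.
  by apply: near_eq_is_derive a; near=> t; congr complex.Re; near: t.
by apply: near_eq_is_derive b; near=> t; congr complex.Im; near: t.
Unshelve. all: by end_near. Qed.

Lemma is_derive_translate (f : R -> R) (x y v : R) :
  is_derive x (1 : R) (fun t => f (t + y)) v <-> is_derive (x + y) (1 : R) f v.
Proof.
have E : (fun h : R => h^-1 *: (((fun t => f (t + y)) \o shift x) (h *: 1) - f (x + y))) =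
         (fun h : R => h^-1 *: ((f \o shift (x + y)) (h *: 1) - f (x + y))).
  by apply/funext => h /=; rewrite addrA.
have Ed : derivable (fun t => f (t + y)) x 1 = derivable f (x + y) 1 by rewrite /derivable E.
have Ev : 'D_1 (fun t => f (t + y)) x = 'D_1 f (x + y) by rewrite /derive E.
split=> -[u e].
  by apply: DeriveDef; [rewrite -Ed; exact: u|rewrite -Ev; exact: e].
by apply: DeriveDef; [rewrite Ed; exact: u|rewrite Ev; exact: e].
Qed.
End ComplexDerivative.

(** * Smooth functions and their closure properties *)

Section SmoothCalculus.
Variables (R : realType) (m : nat).
Local Notation C := (Cplx R).
Implicit Types (F G : 'rV[C]_m -> C) (U : set 'rV[C]_m) (w v : 'rV[C]_m) (a : 'I_m + 'I_m).

Lemma line0 w v : line w v 0 = w.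
Proof. by rewrite /line rmorph0 scale0r addr0. Qed.
Lemma lineD w v (t u : R) : line w v (t + u) = line (line w v t) v u.
Proof. by rewrite /line rmorphD scalerDl addrA. Qed.

Definition hasD v F w l := derC (fun t => F (line w v t)) 0 l.

Lemma hasD_dirD v F w l : hasD v F w l -> dirD v F w = l.
Proof.
move=> [a b]; rewrite /dirD !derive1E.
rewrite (@derive_val _ _ _ _ _ _ _ a) (@derive_val _ _ _ _ _ _ _ b).
by case: l {a b}.
Qed.

Lemma derivable_hasD v F w :
  derivable (fun t : R => complex.Re (F (line w v t))) 0 1 ->
  derivable (fun t : R => complex.Im (F (line w v t))) 0 1 -> hasD v F w (dirD v F w).
Proof.
move=> a b; rewrite /dirD !derive1E; split.
  by apply: DeriveDef; [exact: a|exact: erefl].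
by apply: DeriveDef; [exact: b|exact: erefl].
Qed.

Lemma hasD_derivable v F w l : hasD v F w l ->
  derivable (fun t : R => complex.Re (F (line w v t))) 0 1 /\
  derivable (fun t : R => complex.Im (F (line w v t))) 0 1.
Proof. move=> [[a _] [b _]]; split; [exact: a|exact: b]. Qed.

(** Neighbourhoods in C are measured by positive elements of C; these are real, which reduces
    estimates to R. *)
Lemma near_real_complex (e : C) : 0 < e -> exists2 d : R, 0 < d & real_complex R d <= e.
Proof.
case: e => x y; rewrite ltcE /= => /andP[/eqP -> x0]; exists x => //.
Qed.

Lemma norm_real_complex (x : R) : `|real_complex R x : C| = real_complex R `|x|.
Proof. by rewrite normc_def /= expr0n addr0 sqrtr_sqr. Qed.

Lemma real_complex_continuous : continuous (real_complex R : R -> C).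
Proof.
move=> x; apply/(@cvgrPdist_lt C) => e e0; have [d d0 de] := near_real_complex e0.
near=> y; rewrite -rmorphB; apply: lt_le_trans de.
rewrite norm_real_complex ltcR; near: y; exact: cvgr_dist_lt.
Unshelve. all: by end_near. Qed.

Lemma Re_continuous : continuous (fun x : C => complex.Re x).
Proof.
move=> x; apply/(@cvgrPdist_lt R R C (nbhs x) (nbhs_filter x)) => e e0.
near=> y; rewrite -ltcR.
have -> : complex.Re x - complex.Re y = complex.Re (x - y) by case: (x); case: (y).
apply: le_lt_trans (normc_ge_Re _) _; near: y.
have e0' : 0 < (real_complex R e : C) by rewrite ltcR.
exact: (@cvgr_dist_lt C C C (nbhs x) _ id x cvg_id _ e0').
Unshelve. all: by end_near. Qed.

Lemma Im_Re (x : C) : complex.Im x = complex.Re (- 'i * x).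
Proof. by case: x => a b; rewrite /= !(mul0r, mulr0, mul1r, mulNr, oppr0); ring. Qed.

Lemma Im_continuous : continuous (fun x : C => complex.Im x).
Proof.
move=> x; rewrite (_ : (fun x : C => complex.Im x) = fun x : C => complex.Re (- 'i * x)); last first.
  by apply/funext => y; exact: Im_Re.
apply: (@continuous_comp _ _ _ (fun y : C => - 'i * y) (fun y : C => complex.Re y)).
  by apply: (@cvgM C C (nbhs x)); [exact: cvg_cst|exact: cvg_id].
exact: Re_continuous.
Qed.

Lemma conj_continuous : continuous (fun x : C => x^*).
Proof.
move=> x; apply/(@cvgrPdist_lt C C C (nbhs x) (nbhs_filter x)) => e e0; near=> y.
rewrite -rmorphB norm_conjC; near: y.
exact: (@cvgr_dist_lt C C C (nbhs x) _ id x cvg_id _ e0).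
Unshelve. all: by end_near. Qed.

Lemma line2_continuous v : continuous (fun p : 'rV[C]_m * R => line p.1 v p.2).
Proof.
move=> p; apply: cvgD; first exact: cvg_fst.
apply: cvgZr_tmp; apply: continuous_comp; first exact: cvg_snd.
exact: real_complex_continuous.
Qed.

Lemma line_continuous w v : continuous (line w v).
Proof.
move=> t; apply: cvgD; first exact: cvg_cst.
by apply: cvgZr_tmp; exact: real_complex_continuous.
Qed.

Lemma near_line U w v : open U -> U w -> \forall t \near (0 : R), U (line w v t).
Proof.
move=> oU Uw; have := @line_continuous w v 0; apply; rewrite line0.
exact: open_nbhs_nbhs.
Qed.

Lemma eq_on_hasD U F G : open U -> (forall w, U w -> F w = G w) ->
  forall v w l, U w -> hasD v F w l -> hasD v G w l.
Proof.
move=> oU e v w l Uw; apply: derC_near.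
by apply: filterS (near_line v oU Uw) => t; exact: e.
Qed.

Lemma eq_on_dirD U F G : open U -> (forall w, U w -> F w = G w) ->
  forall v w, U w -> dirD v F w = dirD v G w.
Proof.
move=> oU e v w Uw; rewrite /dirD !derive1E; congr Complex; apply: near_eq_derive;
  by apply: filterS (near_line v oU Uw) => t /e ->.
Qed.

(** One layer of [smooth_on]: what each iterated derivative has to satisfy. *)
Definition reg U F := forall w, U w ->
  {for w, continuous F} /\ forall a, exists l, hasD (rdir R a) F w l.

Lemma smooth_onP U F : smooth_on U F <-> reg U F /\ forall a, smooth_on U (dirD (rdir R a) F).
Proof.
split=> [sF|[rF sF] s w Uw].
  split=> [w Uw|a s w Uw].
    have [c d] := sF [::] w Uw; split=> // a; have [d1 d2] := d a.
    exists (dirD (rdir R a) F w); exact: (derivable_hasD d1 d2).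
  by have := sF (rcons s a) w Uw; rewrite foldr_rcons.
elim/last_ind: s => [|s a _]; last by rewrite /= foldr_rcons; exact: sF.
have [c d] := rF w Uw; split=> // a; have [l hl] := d a; exact: hasD_derivable hl.
Qed.

Lemma smooth_reg U F : smooth_on U F -> reg U F.
Proof. by move=> /smooth_onP[]. Qed.
Lemma smooth_dirD U F a : smooth_on U F -> smooth_on U (dirD (rdir R a) F).
Proof. by move=> /smooth_onP[]. Qed.
Lemma smooth_hasD U F a w : smooth_on U F -> U w ->
  hasD (rdir R a) F w (dirD (rdir R a) F w).
Proof.
by move=> /smooth_reg H Uw; have [_ /(_ a)[l hl]] := H w Uw; rewrite (hasD_dirD hl).
Qed.

Lemma eq_on_reg U F G : open U -> (forall w, U w -> F w = G w) -> reg U F -> reg U G.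
Proof.
move=> oU e rF w Uw; have [c d] := rF w Uw; split.
  have c' : F x @[x --> w] --> F w := c; rewrite (e w Uw) in c'.
  suff : G x @[x --> w] --> G w by [].
  have nU : nbhs w U by apply: open_nbhs_nbhs.
  have nE : {near nbhs w, F =1 G} by apply: filterS nU => x /e.
  exact: (cvg_trans (@near_eq_cvg _ _ (nbhs w) (nbhs_filter w) F G nE) c').
by move=> a; have [l hl] := d a; exists l; exact: (eq_on_hasD oU e Uw hl).
Qed.

Local Opaque smooth_on dirD.

(** Coinduction in place of Leibniz and chain rules for iterated derivatives: every iterated
    derivative agrees on U with a member of [P], and regularity passes to it because U is open. *)
Lemma smooth_coind U (P : ('rV[C]_m -> C) -> Prop) : open U ->
  (forall F, P F -> reg U F) ->
  (forall F a, P F -> exists2 G, P G & forall w, U w -> dirD (rdir R a) F w = G w) ->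
  forall F, P F -> smooth_on U F.
Proof.
move=> oU Pr Pd F PF s.
suff [G PG e] : exists2 G, P G & forall w, U w -> foldr (fun a => dirD (rdir R a)) F s w = G w.
  have := eq_on_reg oU (fun w Uw => esym (e w Uw)) (Pr _ PG).
  move=> H w Uw; have [c d] := H w Uw; split=> // a; have [l hl] := d a.
  exact: hasD_derivable hl.
elim: s => [|a s [G PG e]] /=; first by exists F.
have [G' PG' e'] := Pd G a PG; exists G' => // w Uw.
by rewrite (eq_on_dirD oU e) // e'.
Qed.

Lemma eq_on_smooth U F G : open U -> (forall w, U w -> F w = G w) ->
  smooth_on U F -> smooth_on U G.
Proof.
move=> oU e sF.
apply: (@smooth_coind U (fun G => exists2 F, smooth_on U F & forall w, U w -> F w = G w)) => //.
- by move=> {}G [{e}F' sF' e]; apply: eq_on_reg e _ => //; exact: smooth_reg.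
- move=> {}G a [{e}F' sF' e]; exists (dirD (rdir R a) F') => [|w Uw].
    by exists (dirD (rdir R a) F'); [exact: smooth_dirD|].
  by rewrite (eq_on_dirD oU e).
- by exists F.
Qed.

(** The invariant class for [smooth_coind]: products or inverses of smooth functions alone are not
    visibly stable under differentiation, but the algebra they generate is. *)
Inductive smooth_alg U : ('rV[C]_m -> C) -> Prop :=
| SAbase F of smooth_on U F : smooth_alg U F
| SAadd F G of smooth_alg U F & smooth_alg U G : smooth_alg U (fun w => F w + G w)
| SAmul F G of smooth_alg U F & smooth_alg U G : smooth_alg U (fun w => F w * G w)
| SAconj F of smooth_alg U F : smooth_alg U (fun w => (F w)^*)
| SAinv F of smooth_alg U F & (forall w, U w -> F w != 0) : smooth_alg U (fun w => (F w)^-1).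

Lemma hasD_add v F G w l k : hasD v F w l -> hasD v G w k -> hasD v (fun w => F w + G w) w (l + k).
Proof. exact: derCD. Qed.
Lemma hasD_mul v F G w l k : hasD v F w l -> hasD v G w k ->
  hasD v (fun w => F w * G w) w (l * G w + F w * k).
Proof. by move=> a b; have := derCM a b; rewrite !line0. Qed.
Lemma hasD_conj v F w l : hasD v F w l -> hasD v (fun w => (F w)^*) w l^*.
Proof. exact: derC_conj. Qed.
Lemma hasD_inv v F w l : F w != 0 -> hasD v F w l ->
  hasD v (fun w => (F w)^-1) w (- l / F w ^+ 2).
Proof. by move=> F0 a; have := derCV _ a; rewrite !line0; apply. Qed.
Lemma hasD_cst v c w : hasD v (fun=> c) w 0.
Proof. exact: derC_cst. Qed.

Lemma hasD_coord v w k : hasD v (fun w => w 0 k) w (v 0 k).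
Proof.
have i1 : derC (fun t => real_complex R t : C) 0 1.
  by split; [have := @is_derive_id R R 0 1|have := @is_derive_cst R R R 0 0 1]; apply.
rewrite /hasD (_ : (fun t => _) = fun t => (w 0 k) + (real_complex R t : C) * v 0 k).
  apply: derC_eq (derCD (derC_cst _ _) (derCM i1 (derC_cst _ _))) _.
  by rewrite mulr0 addr0 add0r mul1r.
by apply/funext => t; rewrite /line !mxE.
Qed.

Local Opaque derC hasD.
Lemma smooth_cst U c : smooth_on U (fun=> c).
Proof.
move=> s w _ /=.
have -> : foldr (fun a => dirD (rdir R a)) (fun=> c) s = fun=> (if s is [::] then c else 0).
  elim: s => [//|a s /= ->]; apply/funext => x.
  by apply: hasD_dirD; exact: hasD_cst.
split; first exact: cst_continuous.
by move=> a; exact: (hasD_derivable (hasD_cst (rdir R a) _ w)).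
Qed.

Lemma smooth_alg_smooth U F : open U -> smooth_alg U F -> smooth_on U F.
Proof.
move=> oU; apply: smooth_coind => //.
  move=> {}F; elim=> {F} [F /smooth_reg//|F G _ rF _ rG|F G _ rF _ rG|F _ rF|F _ rF F0] w Uw.
  - have [c d] := rF w Uw; have [c' d'] := rG w Uw; split; first exact: (@cvgD C C _ (nbhs w) (nbhs_filter w) F G _ _ c c').
    by move=> a; have [l hl] := d a; have [k hk] := d' a; eexists; exact: hasD_add hl hk.
  - have [c d] := rF w Uw; have [c' d'] := rG w Uw; split; first exact: (@cvgM C _ (nbhs w) (nbhs_filter w) F G _ _ c c').
    by move=> a; have [l hl] := d a; have [k hk] := d' a; eexists; exact: hasD_mul hl hk.
  - have [c d] := rF w Uw; split.
      apply: (@continuous_comp _ _ _ F (fun x : C => x^*)) c _; exact: conj_continuous.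
    by move=> a; have [l hl] := d a; eexists; exact: hasD_conj hl.
  - have [c d] := rF w Uw; split; first exact: (@cvgV C _ (nbhs w) (nbhs_filter w) F _ (F0 w Uw) c).
    by move=> a; have [l hl] := d a; eexists; apply: hasD_inv hl; exact: F0.
have K : forall F, smooth_alg U F -> forall a, exists2 G, smooth_alg U G & forall w, U w -> hasD (rdir R a) F w (G w).
  move=> {}F; elim=> {F} [F sF|F G sF rF sG rG|F G sF rF sG rG|F sF rF|F sF rF F0] a.
  - by exists (dirD (rdir R a) F) => [|w Uw]; [exact/SAbase/smooth_dirD|exact: (smooth_hasD a sF Uw)].
  - have [F' sF' dF] := rF a; have [G' sG' dG] := rG a.
    by exists (fun w => F' w + G' w) => [|w Uw]; [exact: SAadd|apply: hasD_add; [exact: dF|exact: dG]].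
  - have [F' sF' dF] := rF a; have [G' sG' dG] := rG a.
    exists (fun w => F' w * G w + F w * G' w) => [|w Uw].
      by apply: SAadd; exact: SAmul.
    by apply: hasD_mul; [exact: dF|exact: dG].
  - have [F' sF' dF] := rF a.
    by exists (fun w => (F' w)^*) => [|w Uw]; [exact: SAconj|apply: hasD_conj; exact: dF].
  - have [F' sF' dF] := rF a.
    (* The derivative - F' / F^2, spelled with the constructors of [smooth_alg]. *)
    exists (fun w => (-1 * F' w) * (F w * F w)^-1) => [|w Uw].
      apply: SAmul; first by apply: SAmul => //; apply/SAbase/smooth_cst.
      by apply: SAinv => [|w Uw]; [exact: SAmul|rewrite mulf_neq0 ?F0].
    by have := hasD_inv (F0 w Uw) (dF w Uw); rewrite mulN1r expr2.
move=> {}F a /K/(_ a)[G sG dG]; exists G => // w Uw; apply: hasD_dirD; exact: dG.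
Qed.

Section SmoothOps.
Variables (U : set 'rV[C]_m) (oU : open U).
Lemma smoothD F G : smooth_on U F -> smooth_on U G -> smooth_on U (fun w => F w + G w).
Proof. by move=> sF sG; apply: smooth_alg_smooth => //; apply: SAadd; exact: SAbase. Qed.
Lemma smoothMul F G : smooth_on U F -> smooth_on U G -> smooth_on U (fun w => F w * G w).
Proof. by move=> sF sG; apply: smooth_alg_smooth => //; apply: SAmul; exact: SAbase. Qed.
Lemma smooth_conj F : smooth_on U F -> smooth_on U (fun w => (F w)^*).
Proof. by move=> sF; apply: smooth_alg_smooth => //; apply: SAconj; exact: SAbase. Qed.
Lemma smoothV F : smooth_on U F -> (forall w, U w -> F w != 0) -> smooth_on U (fun w => (F w)^-1).
Proof. by move=> sF F0; apply: smooth_alg_smooth => //; apply: SAinv => //; exact: SAbase. Qed.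
Lemma smoothN F : smooth_on U F -> smooth_on U (fun w => - F w).
Proof.
move=> sF; rewrite (_ : (fun w => _) = (fun w => -1 * F w)).
  by apply: smoothMul; [exact: smooth_cst|exact: sF].
by apply/funext => w; rewrite mulN1r.
Qed.
Lemma smooth_sum (I : Type) (s : seq I) (P : pred I) (G : I -> 'rV[C]_m -> C) :
  (forall i, P i -> smooth_on U (G i)) -> smooth_on U (fun w => \sum_(i <- s | P i) G i w).
Proof.
move=> H; elim: s => [|i s IH].
  by rewrite (_ : (fun w => _) = fun=> 0); [exact: smooth_cst|apply/funext => w; rewrite big_nil].
rewrite (_ : (fun w => _) = fun w => (if P i then G i w else 0) + \sum_(i <- s | P i) G i w).
  apply: smoothD; last exact: IH.
  by case Pi: (P i); [exact: H|exact: smooth_cst].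
by apply/funext => w; rewrite big_cons; case: ifP => // _; rewrite add0r.
Qed.
Lemma smooth_prod (I : Type) (s : seq I) (P : pred I) (G : I -> 'rV[C]_m -> C) :
  (forall i, P i -> smooth_on U (G i)) -> smooth_on U (fun w => \prod_(i <- s | P i) G i w).
Proof.
move=> H; elim: s => [|i s IH].
  by rewrite (_ : (fun w => _) = fun=> 1); [exact: smooth_cst|apply/funext => w; rewrite big_nil].
rewrite (_ : (fun w => _) = fun w => (if P i then G i w else 1) * \prod_(i <- s | P i) G i w).
  apply: smoothMul; last exact: IH.
  by case Pi: (P i); [exact: H|exact: smooth_cst].
by apply/funext => w; rewrite big_cons; case: ifP => // _; rewrite mul1r.
Qed.
End SmoothOps.

Lemma rdir_coord a k : rdir R a 0 k = if a is inl i then (k == i)%:R else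
  if a is inr i then 'i * (k == i)%:R else 0 :> C.
Proof. by case: a => i; rewrite /= !mxE eqxx. Qed.

Lemma smooth_coord U k : smooth_on U (fun w => w 0 k).
Proof.
apply/smooth_onP; split=> [w _|a].
  split; first exact: coord_continuous.
  by move=> a; eexists; exact: hasD_coord.
rewrite (_ : dirD _ _ = fun=> rdir R a 0 k); first exact: smooth_cst.
by apply/funext => w; apply: hasD_dirD; exact: hasD_coord.
Qed.
End SmoothCalculus.

(** * Mean value theorem, symmetry of mixed derivatives, chain rule along curves *)

Section MeanValue.
Variables (R : realType) (m : nat).
Local Notation C := (Cplx R).
Implicit Types (f D : 'rV[C]_m -> R) (U : set 'rV[C]_m) (w v : 'rV[C]_m).

Definition hasDr v f w (l : R) := is_derive (0 : R) (1 : R) (fun t => f (line w v t)) l.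

Lemma hasDr_line v f w (t l : R) : hasDr v f (line w v t) l ->
  is_derive t (1 : R) (fun u => f (line w v u)) l.
Proof.
rewrite /hasDr (_ : (fun u => _) = (fun u => f (line w v (u + t)))); last first.
  by apply/funext => u; rewrite -lineD addrC.
by move/(is_derive_translate (fun u => f (line w v u))); rewrite add0r.
Qed.

Lemma mvt_line f D v w (h : R) :
  (forall t : R, `|t| <= `|h| -> hasDr v f (line w v t) (D (line w v t))) ->
  exists2 t : R, `|t| <= `|h| & f (line w v h) - f w = D (line w v t) * h.
Proof.
move=> H; pose g t := f (line w v t).
have dg t : `|t| <= `|h| -> is_derive t (1 : R) g (D (line w v t)).
  by move=> th; apply: hasDr_line; exact: H.
have [h0|h0] := leP 0 h.
- have in1 (t : R) : t \in `[0, h]%R -> `|t| <= `|h|.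
    by rewrite in_itv /= => /andP[t0 th]; rewrite !ger0_norm.
  have [||c ch E] := @MVT_segment R g (fun t => D (line w v t)) 0 h h0.
  + by move=> t /subset_itv_oo_cc /in1 /dg.
  + apply: derivable_within_continuous => t /in1 /dg d; exact: ex_derive.
  by exists c; [exact: in1|move: E; rewrite /g line0 subr0].
- have in1 (t : R) : t \in `[h, 0]%R -> `|t| <= `|h|.
    by rewrite in_itv /= => /andP[t0 th]; rewrite !ler0_norm ?lerN2 // ltW.
  have [||c ch E] := @MVT_segment R g (fun t => D (line w v t)) h 0 (ltW h0).
  + by move=> t /subset_itv_oo_cc /in1 /dg.
  + apply: derivable_within_continuous => t /in1 /dg d; exact: ex_derive.
  exists c; first exact: in1.
  by move: E; rewrite /g line0 sub0r mulrN => /(congr1 -%R); rewrite opprB opprK.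
Qed.

Lemma near_line2 (A : set 'rV[C]_m) w v : nbhs w A ->
  exists2 B, nbhs w B & exists2 e : R, 0 < e & forall x t, B x -> `|t| < e -> A (line x v t).
Proof.
move=> wA; have := @line2_continuous R m v (w, 0).
rewrite /continuous_at /= line0 => /(_ A wA) [[B1 B2] /= [b1 b2] BA].
exists B1; first exact: b1.
have /nbhs_ballP[e /= e0 eB] := b2.
exists e; first exact: e0.
move=> x t Bx te; apply: (BA (x, t)); split=> /=; first exact: Bx.
by apply: eB; rewrite /ball /= sub0r normrN.
Qed.

(** The second difference of f over the parallelogram spanned by t a and t b, computed in either
    order by two mean value theorems, is t^2 times one or the other mixed derivative at nearby
    points. *)
Lemma derive_comm f Da Db Dab Dba (U : set 'rV[C]_m) (a b : 'rV[C]_m) w : open U -> U w ->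
  (forall x, U x -> hasDr a f x (Da x)) -> (forall x, U x -> hasDr b f x (Db x)) ->
  (forall x, U x -> hasDr b Da x (Dba x)) -> (forall x, U x -> hasDr a Db x (Dab x)) ->
  {for w, continuous Dab} -> {for w, continuous Dba} -> Dab w = Dba w.
Proof.
move=> oU Uw da db dba dab cab cba.
have lineC x (s t : R) : line (line x a s) b t = line (line x b t) a s by rewrite /line addrAC.
apply/eqP; rewrite -subr_eq0 -normr_le0 leNgt; apply/negP => gt0.
set e := `|_| in gt0.
have e2 : 0 < e / 2 by rewrite divr_gt0.
(* On [A] each mixed derivative is within half of the supposed gap of its value at w, so the two
   cannot take a common value at points of [A]. *)
pose A := [set x | [/\ U x, `|Dab w - Dab x| < e / 2 & `|Dba w - Dba x| < e / 2]].
have nA : nbhs w A.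
  have n1 := open_nbhs_nbhs (conj oU Uw).
  have n2 := @cvgr_dist_lt R R _ (nbhs w) (nbhs_filter w) Dab _ cab _ e2.
  have n3 := @cvgr_dist_lt R R _ (nbhs w) (nbhs_filter w) Dba _ cba _ e2.
  by apply: filterS3 n1 n2 n3 => x; split.
have [B1 nB1 [e1 e10 B1A]] := near_line2 b nA.
have [B2 nB2 [e3 e30 B2B]] := near_line2 a nB1.
have [t [t0 te1 te3]] : exists t : R, [/\ 0 < t, t < e1 & t < e3].
  have m0 : 0 < Num.min e1 e3 by rewrite lt_min e10.
  have tmin : Num.min e1 e3 / 2 < Num.min e1 e3 by rewrite ltr_pdivrMr // ltr_pMr ?ltr1n.
  exists (Num.min e1 e3 / 2); split; first by rewrite divr_gt0.
    by apply: lt_le_trans tmin _; rewrite ge_min lexx.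
  by apply: lt_le_trans tmin _; rewrite ge_min lexx orbT.
have ab x y : `|x| <= `|t| -> `|y| <= `|t| -> A (line (line w a x) b y).
  move=> xt yt; rewrite (gtr0_norm t0) in xt yt.
  apply: B1A; last exact: (le_lt_trans yt te1).
  apply: B2B; last exact: (le_lt_trans xt te3).
  exact: nbhs_singleton.
have l0 : `|0 : R| <= `|t| by rewrite normr0.
have lt_ : `|t| <= `|t| by [].
have hB (v : 'rV[C]_m) (p q : 'rV[C]_m -> R) x l k : hasDr v p x l -> hasDr v q x k -> hasDr v (fun y => p y - q y) x (l - k).
  by move=> ? ?; exact: is_deriveB.
have shift_b c x l (p : 'rV[C]_m -> R) : hasDr a p (line x b c) l -> hasDr a (fun y => p (line y b c)) x l.
  by rewrite /hasDr; congr is_derive; apply/funext => u; rewrite lineC.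
have shift_a c x l (p : 'rV[C]_m -> R) : hasDr b p (line x a c) l -> hasDr b (fun y => p (line y a c)) x l.
  by rewrite /hasDr; congr is_derive; apply/funext => u; rewrite lineC.
have [x xt Ex] : exists2 x : R, `|x| <= `|t| &
    (f (line (line w a t) b t) - f (line w a t)) - (f (line w b t) - f w) =
    (Da (line (line w a x) b t) - Da (line w a x)) * t.
  apply: (@mvt_line (fun y => f (line y b t) - f y) (fun y => Da (line y b t) - Da y) a w t) => u ut.
  apply: hB; last by apply: da; have [] := ab u 0 ut l0; rewrite line0.
  by apply: shift_b; apply: da; have [] := ab u t ut lt_.
have [y yt Ey] := @mvt_line Da Dba b (line w a x) t (fun u ut => dba _ (let: And3 p _ _ := ab x u xt ut in p)).
have [x' xt' Ex'] : exists2 x : R, `|x| <= `|t| &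
    (f (line (line w b t) a t) - f (line w b t)) - (f (line w a t) - f w) =
    (Db (line (line w b x) a t) - Db (line w b x)) * t.
  apply: (@mvt_line (fun y => f (line y a t) - f y) (fun y => Db (line y a t) - Db y) b w t) => u ut.
  apply: hB; last by apply: db; have [] := ab 0 u l0 ut; rewrite line0.
  by apply: shift_a; apply: db; have [] := ab t u lt_ ut; rewrite lineC.
have [y' yt' Ey'] := @mvt_line Db Dab a (line w b x') t
  (fun u ut => dab _ (let: And3 p _ _ := eq_ind _ (fun z => A z) (ab u x' ut xt') _ (lineC w u x') in p)).
have EE : Dab (line (line w b x') a y') = Dba (line (line w a x) b y).
  have tn : t != 0 by rewrite gt_eqF.
  apply: (mulIf (mulf_neq0 tn tn)).
  rewrite /= !mulrA -Ey' -Ex' -Ey -Ex lineC; ring.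
have [_ _ A1] := ab x y xt yt; have [_ A2 _] := ab y' x' yt' xt'.
rewrite lineC EE in A2.
have := ltrD A2 A1; rewrite -splitr ltNge => /negP; apply.
rewrite /e [`|Dba w - _|]distrC; exact: ler_distD.
Qed.

Section CurveChainRule.
Variables (T : Type) (f : 'rV[C]_m -> R) (v : T -> 'rV[C]_m) (D : T -> 'rV[C]_m -> R)
  (U : set 'rV[C]_m) (w : 'rV[C]_m) (del : T -> R -> R) (del' : T -> R).
Hypotheses (oU : open U) (Uw : U w)
  (fD : forall a x, U x -> hasDr (v a) f x (D a x))
  (cD : forall a, {for w, continuous (D a)})
  (ddel : forall a, is_derive (0 : R) (1 : R) (del a) (del' a))
  (del0 : forall a, del a 0 = 0).

(** The end point of a polygonal path from w. Only derivatives along the given directions are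
    available, so a curve is followed one direction at a time. *)
Definition curve (s : seq T) (t : R) : 'rV[C]_m :=
  foldr (fun a x => line x (v a) (del a t)) w s.

Lemma curve0 s : curve s 0 = w.
Proof. by elim: s => [//|a s IH]; rewrite /= IH del0 line0. Qed.

Lemma del_small a e : 0 < e -> \forall t \near (0 : R), `|del a t| < e.
Proof.
move=> e0; have cd : {for 0, continuous (del a)}.
  apply: differentiable_continuous; apply/derivable1_diffP; exact: ex_derive.
have := @cvgr_dist_lt R R _ (nbhs (0 : R)) (nbhs_filter _) (del a) _ cd _ e0.
by apply: filterS => t; rewrite del0 sub0r normrN.
Qed.

Lemma curve_continuous s : {for (0 : R), continuous (curve s)}.
Proof.
elim: s => [|a s IH]; first exact: cst_continuous.
move=> A; rewrite curve0 => /(near_line2 (v a))[B nB [e e0 BA]].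
have nC : \forall t \near (0 : R), B (curve s t) by apply: IH; rewrite curve0.
have nd := del_small a e0.
by apply: filterS2 nC nd => t Bt dt /=; exact: BA.
Qed.

(** The mean value theorem writes the increment along the last leg as [D a] at an intermediate point
    times [del a t]; continuity of [D a] at w turns this into a Caratheodory slope. *)
Lemma curve_derive s :
  is_derive (0 : R) (1 : R) (fun t => f (curve s t)) (\sum_(a <- s) D a w * del' a).
Proof.
elim: s => [|a s IH]; first by rewrite big_nil; have i0 := @is_derive_cst R R R (f w) 0 1; exact: i0.
rewrite big_cons.
pose good t := forall u : R, `|u| <= `|del a t| -> U (line (curve s t) (v a) u).
have nU := open_nbhs_nbhs (conj oU Uw).
have [B nB [e e0 BU]] := near_line2 (v a) nU.
have ngood : \forall t \near (0 : R), good t.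
  have nC : \forall t \near (0 : R), B (curve s t).
    by apply: curve_continuous; rewrite curve0.
  apply: filterS2 nC (del_small a e0) => t Bt dt u ut.
  apply: BU => //; exact: (le_lt_trans ut dt).
(* Intermediate points are chosen for all t at once, with the dummy value 0 where the leg may leave
   U. *)
have /(@choice R R)[tau tauP] : forall t, exists u, good t -> `|u| <= `|del a t| /\
    f (line (curve s t) (v a) (del a t)) - f (curve s t) =
    D a (line (curve s t) (v a) u) * del a t.
  move=> t.
  have [gt|ngt] := pselect (good t); last by exists 0.
  have [u ut E] := @mvt_line f (D a) (v a) (curve s t) (del a t) (fun u ut => fD a (gt u ut)).
  by exists u.
pose q t := D a (line (curve s t) (v a) (tau t)).
have tau0 : tau 0 = 0.
  have [] := tauP 0 (nbhs_singleton ngood).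
  by rewrite del0 normr0 normr_le0 => /eqP.
have cq : {for (0 : R), continuous q}.
  move=> A; rewrite /q curve0 tau0 line0 => nA.
  have /(near_line2 (v a))[B' nB' [e' e0' BA]] := cD nA.
  have nC : \forall t \near (0 : R), B' (curve s t).
    by apply: curve_continuous; rewrite curve0.
  apply: filterS3 nC ngood (del_small a e0') => t Bt gt dt /=.
  apply: BA => //; have [tt _] := tauP t gt; exact: (le_lt_trans tt dt).
have dk : is_derive (0 : R) (1 : R) (fun t => q t * del a t) (D a w * del' a).
  have /is_derive1_caratheodory[h [hE ch h0]] := ddel a.
  apply/is_derive1_caratheodory; exists (fun t => q t * h t); split.
  - by move=> z; have := hE z; rewrite del0 mulr0 !subr0 => ->; rewrite mulrA.
  - exact: (@cvgM R _ (nbhs (0 : R)) (nbhs_filter _) q h _ _ cq ch).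
  - by rewrite h0 /q curve0 tau0 line0.
have dsum := is_deriveD_eta dk IH.
apply: near_eq_is_derive dsum.
apply: filterS ngood => t gt; have [_ E] := tauP t gt.
by rewrite /q -E /= subrK.
Qed.
End CurveChainRule.
End MeanValue.

Local Opaque smooth_on dirD.

(** * Wirtinger derivatives *)

Section Wirtinger.
Variables (R : realType) (m : nat).
Local Notation C := (Cplx R).
Implicit Types (F G : 'rV[C]_m -> C) (U : set 'rV[C]_m) (w v : 'rV[C]_m) (a b : 'I_m + 'I_m).

Lemma smooth_cont U F w : smooth_on U F -> U w -> {for w, continuous F}.
Proof. by move=> /smooth_reg H Uw; have [] := H w Uw. Qed.

Lemma dirD_comm U F a b w : open U -> U w -> smooth_on U F ->
  dirD (rdir R a) (dirD (rdir R b) F) w = dirD (rdir R b) (dirD (rdir R a) F) w.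
Proof.
move=> oU Uw sF.
have sa := smooth_dirD a sF; have sb := smooth_dirD b sF.
have main (p : C -> R) : continuous p ->
    (forall c G x, smooth_on U G -> U x ->
       hasDr (rdir R c) (fun x => p (G x)) x (p (dirD (rdir R c) G x))) ->
    p (dirD (rdir R a) (dirD (rdir R b) F) w) = p (dirD (rdir R b) (dirD (rdir R a) F) w).
  move=> cp hp; have cG G : smooth_on U G -> {for w, continuous (fun x => p (G x))}.
    move=> sG; apply: (@continuous_comp _ _ _ G p); last exact: cp.
    exact: (smooth_cont sG Uw).
  exact: (@derive_comm R m (fun x => p (F x)) (fun x => p (dirD (rdir R a) F x))
    (fun x => p (dirD (rdir R b) F x)) (fun x => p (dirD (rdir R a) (dirD (rdir R b) F) x))
    (fun x => p (dirD (rdir R b) (dirD (rdir R a) F) x)) U (rdir R a) (rdir R b) w oU Uw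
    (fun x => hp a F x sF) (fun x => hp b F x sF) (fun x => hp b _ x sa) (fun x => hp a _ x sb)
    (cG _ (smooth_dirD a sb)) (cG _ (smooth_dirD b sa))).
apply: ReIm_eq; [apply: (main _ (@Re_continuous R))|apply: (main _ (@Im_continuous R))];
  move=> c G x sG Ux; have [d d'] := smooth_hasD c sG Ux; [exact: d|exact: d'].
Qed.

(** The factor of the y-derivative, so that one formula covers d/dz and its conjugate. *)
Let ca (a : idx m) : C := match a with inl _ => - 'i | inr _ => 'i end.
Let ka (a : idx m) : 'I_m := match a with inl k => k | inr k => k end.

Lemma pdE a F w : pd a F w = 2^-1 * (dirD (rdir R (inl (ka a))) F w + ca a * dirD (rdir R (inr (ka a))) F w).
Proof. by case: a => k; rewrite /= ?mulNr. Qed.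

Lemma pd_lin F w l1 l2 a : hasD (rdir R (inl (ka a))) F w l1 -> hasD (rdir R (inr (ka a))) F w l2 ->
  pd a F w = 2^-1 * (l1 + ca a * l2).
Proof. by move=> /hasD_dirD <- /hasD_dirD <-; exact: pdE. Qed.

Lemma eq_on_pd U F G a w : open U -> (forall x, U x -> F x = G x) -> U w -> pd a F w = pd a G w.
Proof. by move=> oU e Uw; rewrite !pdE !(eq_on_dirD oU e). Qed.

Lemma smooth_pd U F a : open U -> smooth_on U F -> smooth_on U (pd a F).
Proof.
move=> oU sF.
have E : pd a F = fun w => 2^-1 * (dirD (rdir R (inl (ka a))) F w + ca a * dirD (rdir R (inr (ka a))) F w).
  by apply/funext => w; exact: pdE.
rewrite E; apply: (smoothMul oU); first exact: smooth_cst.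
apply: (smoothD oU); first exact: smooth_dirD.
by apply: (smoothMul oU); [exact: smooth_cst|exact: smooth_dirD].
Qed.

Local Opaque derC hasD.
(* [ring] compares atoms up to conversion, which diverges on [dirD]. *)
Local Ltac ring_dirD := repeat (match goal with |- context [dirD ?v ?F ?w] =>
  generalize (dirD v F w) end); intros; ring.
Section OnOpen.
Variables (U : set 'rV[C]_m) (w : 'rV[C]_m).
Hypotheses (oU : open U) (Uw : U w).

Lemma pdD F G a : smooth_on U F -> smooth_on U G ->
  pd a (fun x => F x + G x) w = pd a F w + pd a G w.
Proof.
move=> sF sG.
have H e := hasD_add (smooth_hasD e sF Uw) (smooth_hasD e sG Uw).
by rewrite (@pd_lin (fun x => F x + G x) w _ _ a (H _) (H _)) !pdE; ring_dirD.
Qed.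
Lemma pdM F G a : smooth_on U F -> smooth_on U G ->
  pd a (fun x => F x * G x) w = pd a F w * G w + F w * pd a G w.
Proof.
move=> sF sG.
have H e := hasD_mul (smooth_hasD e sF Uw) (smooth_hasD e sG Uw).
by rewrite (@pd_lin (fun x => F x * G x) w _ _ a (H _) (H _)) !pdE; ring_dirD.
Qed.
Lemma pd_cst c a : pd a (fun=> c) w = 0.
Proof.
by rewrite (@pd_lin (fun=> c) w _ _ a (hasD_cst _ c w) (hasD_cst _ c w)) mulr0 addr0 mulr0.
Qed.
Lemma pdZ F c a : smooth_on U F -> pd a (fun x => c * F x) w = c * pd a F w.
Proof. by move=> sF; rewrite (pdM a (@smooth_cst R m U c) sF) pd_cst mul0r add0r. Qed.
Lemma pdN F a : smooth_on U F -> pd a (fun x => - F x) w = - pd a F w.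
Proof.
move=> sF; rewrite (_ : (fun x => _) = (fun x => -1 * F x)).
  by rewrite (pdZ _ _ sF) mulN1r.
by apply/funext => x; rewrite mulN1r.
Qed.
Lemma pdV F a : smooth_on U F -> F w != 0 ->
  pd a (fun x => (F x)^-1) w = - pd a F w / F w ^+ 2.
Proof.
move=> sF F0; have H e := hasD_inv F0 (smooth_hasD e sF Uw).
by rewrite (@pd_lin (fun x => (F x)^-1) w _ _ a (H _) (H _)) pdE; ring_dirD.
Qed.
Lemma pd_sum (I : Type) (s : seq I) (P : pred I) (G : I -> 'rV[C]_m -> C) a :
  (forall i, P i -> smooth_on U (G i)) ->
  pd a (fun x => \sum_(i <- s | P i) G i x) w = \sum_(i <- s | P i) pd a (G i) w.
Proof.
move=> sG; elim: s => [|i s IH].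
  rewrite big_nil (_ : (fun x => _) = fun=> 0) ?pd_cst //.
  by apply/funext => x; rewrite big_nil.
rewrite big_cons -IH (_ : (fun x => _) = (fun x =>
    if P i then G i x + \sum_(i <- s | P i) G i x else \sum_(i <- s | P i) G i x)); last first.
  by apply/funext => x; rewrite big_cons.
case Pi: (P i); last exact: erefl.
exact: (pdD a (sG i Pi) (smooth_sum oU s sG)).
Qed.
Lemma pd_comm F a b : smooth_on U F -> pd a (pd b F) w = pd b (pd a F) w.
Proof.
move=> sF.
have E c d : pd c (pd d F) w = 2^-1 * 2^-1 *
   (dirD (rdir R (inl (ka c))) (dirD (rdir R (inl (ka d))) F) w
    + ca d * dirD (rdir R (inl (ka c))) (dirD (rdir R (inr (ka d))) F) w
    + ca c * dirD (rdir R (inr (ka c))) (dirD (rdir R (inl (ka d))) F) w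
    + ca c * ca d * dirD (rdir R (inr (ka c))) (dirD (rdir R (inr (ka d))) F) w).
  have H e : hasD (rdir R e) (pd d F) w (0 * (dirD (rdir R (inl (ka d))) F w + ca d * dirD (rdir R (inr (ka d))) F w) +
       2^-1 * (dirD (rdir R e) (dirD (rdir R (inl (ka d))) F) w +
       (0 * dirD (rdir R (inr (ka d))) F w + ca d * dirD (rdir R e) (dirD (rdir R (inr (ka d))) F) w))).
    rewrite (_ : pd d F = fun w => 2^-1 * (dirD (rdir R (inl (ka d))) F w + ca d * dirD (rdir R (inr (ka d))) F w)); last first.
      by apply/funext => x; exact: pdE.
    have s1 := smooth_hasD e (smooth_dirD (inl (ka d)) sF) Uw.
    have s2 := smooth_hasD e (smooth_dirD (inr (ka d)) sF) Uw.
    exact: (hasD_mul (hasD_cst _ _ _) (hasD_add s1 (hasD_mul (hasD_cst _ _ _) s2))).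
  by rewrite (@pd_lin (pd d F) w _ _ c (H _) (H _)); ring_dirD.
rewrite !E.
move: (dirD_comm (inl (ka a)) (inl (ka b)) oU Uw sF).
move: (dirD_comm (inl (ka a)) (inr (ka b)) oU Uw sF).
move: (dirD_comm (inr (ka a)) (inl (ka b)) oU Uw sF).
move: (dirD_comm (inr (ka a)) (inr (ka b)) oU Uw sF).
repeat (match goal with |- context [dirD ?v ?F ?w] => generalize (dirD v F w) end).
by intros; subst; ring.
Qed.
End OnOpen.

Lemma pd_coord a w k : pd a (fun x => x 0 k) w = (a == inl k)%:R.
Proof.
have ii : ('i : C) * 'i = -1 by rewrite -expr2 sqrCi.
rewrite (@pd_lin (fun x => x 0 k) w _ _ a (hasD_coord _ w k) (hasD_coord _ w k)) !rdir_coord; case: a => l /=.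
  rewrite mulrA mulNr ii opprK mul1r [k == l]eq_sym -[inl l == inl k]/(l == k).
  by case: (l == k); rewrite /= ?addr0 ?mulr0 // -mulr2n mulVf ?pnatr_eq0.
by rewrite mulrA ii mulN1r subrr mulr0.
Qed.

Lemma pd_coord_conj a w k : pd a (fun x => (x 0 k)^*) w = (a == inr k)%:R.
Proof.
have ii : ('i : C) * 'i = -1 by rewrite -expr2 sqrCi.
rewrite (@pd_lin (fun x => (x 0 k)^*) w _ _ a (hasD_conj (hasD_coord _ w k)) (hasD_conj (hasD_coord _ w k))) !rdir_coord.
rewrite rmorphM /= conjCi !conjC_nat; case: a => l /=.
  by rewrite mulrA mulrNN ii mulN1r subrr mulr0.
rewrite mulrA mulrN ii opprK mul1r [k == l]eq_sym -[inr l == inr k]/(l == k).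
by case: (l == k); rewrite /= ?addr0 ?mulr0 // -mulr2n mulVf ?pnatr_eq0.
Qed.
End Wirtinger.

(** * Chain rule and smoothness of composites *)

Section Composition.
Variables (R : realType).
Local Notation C := (Cplx R).

Lemma row_continuous (T : topologicalType) n (phi : T -> 'rV[C]_n) (x : T) :
  (forall k, {for x, continuous (fun y => phi y 0 k)}) -> {for x, continuous phi}.
Proof.
move=> H.
have E : phi = fun y => \sum_(k < n) phi y 0 k *: delta_mx 0 k.
  by apply/funext => y; exact: row_sum_delta.
rewrite E; elim: (index_enum _) => [|k s IH].
  rewrite (_ : (fun y => _) = fun=> 0); first exact: cst_continuous.
  by apply/funext => y; rewrite big_nil.
rewrite (_ : (fun y => _) = fun y => phi y 0 k *: delta_mx 0 k + \sum_(k <- s) phi y 0 k *: delta_mx 0 k); last first.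
  by apply/funext => y; rewrite big_cons.
apply: (@cvgD C 'rV[C]_n _ (nbhs x) (nbhs_filter x)); last exact: IH.
exact: (@cvgZr_tmp C 'rV[C]_n _ (nbhs x) (nbhs_filter x) _ _ _ (H k)).
Qed.

(** The 2n real coordinate displacements present the given path as a [curve]; the resulting real
    chain rule is regrouped into Wirtinger derivatives. *)
Lemma derC_comp n (V : set 'rV[C]_n) (F : 'rV[C]_n -> C) (gam : R -> 'rV[C]_n) (g : 'I_n -> C) :
  open V -> V (gam 0) -> smooth_on V F -> (forall k, derC (fun t => gam t 0 k) 0 (g k)) ->
  derC (fun t => F (gam t)) 0
    (\sum_k (pd (inl k) F (gam 0) * g k + pd (inr k) F (gam 0) * (g k)^*)).
Proof.
move=> oV V0 sF dg.
pose del (a : 'I_n + 'I_n) (t : R) : R := match a with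
  | inl k => complex.Re (gam t 0 k) - complex.Re (gam 0 0 k)
  | inr k => complex.Im (gam t 0 k) - complex.Im (gam 0 0 k) end.
pose del' (a : 'I_n + 'I_n) : R := match a with
  | inl k => complex.Re (g k) | inr k => complex.Im (g k) end.
have ddel a : is_derive (0 : R) (1 : R) (del a) (del' a).
  case: a => k; have [d1 d2] := dg k.
    apply: is_derive_eq1 (is_deriveB_eta d1 (@is_derive_cst R R R _ 0 1)) _.
    exact: subr0.
  apply: is_derive_eq1 (is_deriveB_eta d2 (@is_derive_cst R R R _ 0 1)) _.
  exact: subr0.
have del0 a : del a 0 = 0 by case: a => k /=; rewrite subrr.
have E : gam = curve (@rdir R n) (gam 0) del (index_enum _).
  apply/funext => t.
  have cE s : curve (@rdir R n) (gam 0) del s t = gam 0 + \sum_(a <- s) (real_complex R (del a t) : C) *: rdir R a.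
    elim: s => [|a s IH]; first by rewrite big_nil addr0.
    by rewrite /= -/(curve _ _ _ _ _) IH big_cons /line -addrA [_ + _ *: _]addrC.
  rewrite cE big_sumType /= -big_split /=; apply/rowP => k; rewrite mxE summxE.
  rewrite (bigD1 k) //= big1 => [|l /negbTE lk]; last first.
    by rewrite !mxE eqxx eq_sym lk !mulr0 addr0.
  rewrite !mxE !eqxx !mulr1 addr0.
  case: (gam t 0 k) => x y; case: (gam 0 0 k) => x0 y0.
  by apply: ReIm_eq; rewrite ?(complexReD, complexImD, complexReM, complexImM) /=; ring.
have main (p : C -> R) : continuous p ->
    (forall a x, V x -> hasDr (rdir R a) (fun x => p (F x)) x (p (dirD (rdir R a) F x))) ->
    is_derive (0 : R) (1 : R) (fun t => p (F (gam t))) (\sum_a p (dirD (rdir R a) F (gam 0)) * del' a).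
  move=> cp hp; rewrite [X in is_derive _ _ X _](_ : _ = fun t => p (F (curve (@rdir R n) (gam 0) del (index_enum _) t))); last first.
    by apply/funext => t; rewrite -E.
  apply: (@curve_derive R n _ (fun x => p (F x)) (@rdir R n) (fun a x => p (dirD (rdir R a) F x)) V (gam 0) del del' oV V0 hp _ ddel del0).
  move=> a; apply: (@continuous_comp _ _ _ (dirD (rdir R a) F) p); last exact: cp.
  exact: (smooth_cont (smooth_dirD a sF) V0).
have hRe a x : V x -> hasDr (rdir R a) (fun x => complex.Re (F x)) x (complex.Re (dirD (rdir R a) F x)).
  by move=> Vx; have [d _] := smooth_hasD a sF Vx; exact: d.
have hIm a x : V x -> hasDr (rdir R a) (fun x => complex.Im (F x)) x (complex.Im (dirD (rdir R a) F x)).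
  by move=> Vx; have [_ d] := smooth_hasD a sF Vx; exact: d.
have -> : \sum_k (pd (inl k) F (gam 0) * g k + pd (inr k) F (gam 0) * (g k)^*) =
    \sum_k (dirD (rdir R (inl k)) F (gam 0) * real_complex R (complex.Re (g k)) +
       dirD (rdir R (inr k)) F (gam 0) * real_complex R (complex.Im (g k))).
  apply: eq_bigr => k _; rewrite /pd.
  generalize (dirD (rdir R (inl k)) F (gam 0)) => X; generalize (dirD (rdir R (inr k)) F (gam 0)) => Y.
  have ii : ('i : C) * 'i = -1 by rewrite -expr2 sqrCi.
  have h2 : (2 : C) != 0 by rewrite pnatr_eq0.
  have gE : g k = real_complex R (complex.Re (g k)) + 'i * real_complex R (complex.Im (g k)).
    by case: (g k) => a b; apply: ReIm_eq; rewrite ?(complexReD, complexImD, complexReM, complexImM) /=; ring.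
  have gcE : (g k)^* = real_complex R (complex.Re (g k)) - 'i * real_complex R (complex.Im (g k)).
    by case: (g k) => a b; apply: ReIm_eq; rewrite ?(complexReD, complexImD, complexReM, complexImM, complexReN, complexImN) /=; ring.
  rewrite gcE {1}gE.
  generalize (real_complex R (complex.Re (g k)) : C) => a; generalize (real_complex R (complex.Im (g k)) : C) => b.
  transitivity (X * a - Y * b * ('i * 'i)); last by rewrite ii; ring.
  by field.
have ReS (s : seq 'I_n) (G : 'I_n -> C) : complex.Re (\sum_(k <- s) G k) = \sum_(k <- s) complex.Re (G k).
  by elim: s => [|k s IH]; rewrite ?big_nil // !big_cons complexReD IH.
have ImS (s : seq 'I_n) (G : 'I_n -> C) : complex.Im (\sum_(k <- s) G k) = \sum_(k <- s) complex.Im (G k).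
  by elim: s => [|k s IH]; rewrite ?big_nil // !big_cons complexImD IH.
split.
  apply: is_derive_eq1 (main _ (@Re_continuous R) hRe) _.
  rewrite ReS big_sumType /= -big_split /=; apply: eq_bigr => k _.
  repeat (match goal with |- context [dirD ?v ?F ?w] => generalize (dirD v F w) end).
  by intros; rewrite complexReD !complexReM /=; ring.
apply: is_derive_eq1 (main _ (@Im_continuous R) hIm) _.
rewrite ImS big_sumType /= -big_split /=; apply: eq_bigr => k _.
repeat (match goal with |- context [dirD ?v ?F ?w] => generalize (dirD v F w) end).
by intros; rewrite complexImD !complexImM /=; ring.
Qed.

Section Maps.
Variables (m n : nat) (U : set 'rV[C]_m) (V : set 'rV[C]_n) (phi : 'rV[C]_m -> 'rV[C]_n).
Hypotheses (oU : open U) (oV : open V) (UV : forall w, U w -> V (phi w))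
  (sphi : forall k, smooth_on U (fun w => phi w 0 k)).
Let phic k (w : 'rV[C]_m) : C := phi w 0 k.

Lemma hasD_comp F v w (l : 'I_n -> C) : smooth_on V F -> U w ->
  (forall k, hasD v (phic k) w (l k)) ->
  hasD v (fun w => F (phi w)) w
    (\sum_k (pd (inl k) F (phi w) * l k + pd (inr k) F (phi w) * (l k)^*)).
Proof.
move=> sF Uw H.
have := @derC_comp n V F (fun t => phi (line w v t)) l oV _ sF H.
by rewrite line0; apply; exact: UV.
Qed.

Lemma pd_comp F w a : smooth_on V F -> U w ->
  pd a (fun w => F (phi w)) w =
    \sum_k (pd (inl k) F (phi w) * pd a (phic k) w +
            pd (inr k) F (phi w) * pd a (fun w => (phic k w)^*) w).
Proof.
move=> sF Uw.
have H e : hasD (rdir R e) (fun w => F (phi w)) w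
    (\sum_k (pd (inl k) F (phi w) * dirD (rdir R e) (phic k) w +
             pd (inr k) F (phi w) * (dirD (rdir R e) (phic k) w)^*)).
  exact: (hasD_comp sF Uw (fun k => smooth_hasD e (sphi k) Uw)).
rewrite (@pd_lin R m (fun w => F (phi w)) w _ _ a (H _) (H _)) mulr_sumr -big_split mulr_sumr.
apply: eq_bigr => k _ /=.
have Hc e : hasD (rdir R e) (fun w => (phic k w)^*) w (dirD (rdir R e) (phic k) w)^*.
  exact: (hasD_conj (smooth_hasD e (sphi k) Uw)).
rewrite (@pd_lin R m (fun w => (phic k w)^*) w _ _ a (Hc _) (Hc _)) [pd a (phic k) w]pdE.
move: (pd (inl k) F (phi w)) (pd (inr k) F (phi w)); rewrite /phic /rdir {H Hc}; case: a => i;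
  repeat (match goal with |- context [dirD ?v ?F ?w] => generalize (dirD v F w) end);
  by intros; ring.
Qed.

(** The derivative of a composite is a sum of products of composites with functions smooth on U, so
    this algebra is stable under differentiation and [smooth_coind] applies. *)
Inductive comp_alg : ('rV[C]_m -> C) -> Prop :=
| CAcomp F of smooth_on V F : comp_alg (fun w => F (phi w))
| CAbase F of smooth_on U F : comp_alg F
| CAadd F G of comp_alg F & comp_alg G : comp_alg (fun w => F w + G w)
| CAmul F G of comp_alg F & comp_alg G : comp_alg (fun w => F w * G w).

Lemma smooth_comp F : smooth_on V F -> smooth_on U (fun w => F (phi w)).
Proof.
move=> sF; apply: (@smooth_coind R m U comp_alg oU); last exact: CAcomp.
  move=> {sF}F; elim=> {F} [F sF|F sF|F G _ rF _ rG|F G _ rF _ rG] w Uw.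
  - split.
      apply: (@continuous_comp _ _ _ phi F).
        by apply: row_continuous => k; exact: (smooth_cont (sphi k) Uw).
      exact: (smooth_cont sF (UV Uw)).
    by move=> a; eexists; exact: (hasD_comp sF Uw (fun k => smooth_hasD a (sphi k) Uw)).
  - exact: (smooth_reg sF Uw).
  - have [c d] := rF w Uw; have [c' d'] := rG w Uw.
    split; first exact: (@cvgD C C _ (nbhs w) (nbhs_filter w) F G _ _ c c').
    by move=> a; have [l hl] := d a; have [k hk] := d' a; eexists; exact: hasD_add hl hk.
  - have [c d] := rF w Uw; have [c' d'] := rG w Uw.
    split; first exact: (@cvgM C _ (nbhs w) (nbhs_filter w) F G _ _ c c').
    by move=> a; have [l hl] := d a; have [k hk] := d' a; eexists; exact: hasD_mul hl hk.
have K : forall F, comp_alg F -> forall a, exists2 G, comp_alg G & forall w, U w -> hasD (rdir R a) F w (G w).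
  move=> {sF}F; elim=> {F} [F sF|F sF|F G sF rF sG rG|F G sF rF sG rG] a.
  - exists (fun w => \sum_k (pd (inl k) F (phi w) * dirD (rdir R a) (phic k) w +
       pd (inr k) F (phi w) * (dirD (rdir R a) (phic k) w)^*)); last first.
      by move=> w Uw; exact: (hasD_comp sF Uw (fun k => smooth_hasD a (sphi k) Uw)).
    elim: (index_enum _) => [|k s IH].
      rewrite (_ : (fun w => _) = fun=> 0); first by apply: CAbase; exact: smooth_cst.
      by apply/funext => w; rewrite big_nil.
    rewrite (_ : (fun w => _) = fun w => (pd (inl k) F (phi w) * dirD (rdir R a) (phic k) w +
       pd (inr k) F (phi w) * (dirD (rdir R a) (phic k) w)^*) +
       \sum_(k <- s) (pd (inl k) F (phi w) * dirD (rdir R a) (phic k) w +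
       pd (inr k) F (phi w) * (dirD (rdir R a) (phic k) w)^*)); last first.
      by apply/funext => w; rewrite big_cons.
    apply: CAadd; last exact: IH.
    have sd := smooth_dirD a (sphi k).
    apply: CAadd; apply: CAmul.
    + apply: (@CAcomp (pd (inl k) F)); exact: smooth_pd.
    + apply: CAbase; exact: sd.
    + apply: (@CAcomp (pd (inr k) F)); exact: smooth_pd.
    + apply: CAbase; exact: (smooth_conj oU sd).
  - exists (dirD (rdir R a) F); first by apply: CAbase; exact: smooth_dirD.
    by move=> w Uw; exact: (smooth_hasD a sF Uw).
  - have [F' sF' dF] := rF a; have [G' sG' dG] := rG a.
    exists (fun w => F' w + G' w); first exact: CAadd.
    by move=> w Uw; apply: hasD_add; [exact: dF|exact: dG].
  - have [F' sF' dF] := rF a; have [G' sG' dG] := rG a.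
    exists (fun w => F' w * G w + F w * G' w); first by apply: CAadd; exact: CAmul.
    by move=> w Uw; apply: hasD_mul; [exact: dF|exact: dG].
move=> {sF}F a /K/(_ a)[G sG dG]; exists G; first exact: sG.
by move=> w Uw; apply: hasD_dirD; exact: dG.
Qed.
End Maps.
End Composition.

(** * Smooth functions on the cone *)

Section SmoothRing.
Variables (R : realType) (n s : nat).
Local Notation C := (Cplx R).
Implicit Types (z : 'rV[C]_n.+1).

Definition Jpos : set 'rV[C]_n.+1 := [set z | 0 < Jfun s z].

Lemma Jfun_real z : complex.Im (Jfun s z) = 0.
Proof.
have : Jfun s z \is Num.real.
  rewrite CrealE /Jfun rmorph_sum; apply/eqP/eq_bigr => k _.
  by rewrite !rmorphM /= nu_conj conjCK [X in _ * X]mulrC.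
by case: (Jfun s z) => a b; rewrite complex_real => /eqP.
Qed.

Lemma smooth_Jfun U : open U -> smooth_on U (@Jfun R n s).
Proof.
move=> oU; apply: (smooth_sum oU) => k _; apply: (smoothMul oU); first exact: smooth_cst.
by apply: (smoothMul oU); [exact: smooth_coord|apply: (smooth_conj oU); exact: smooth_coord].
Qed.

Lemma open_Jpos : open Jpos.
Proof.
have -> : Jpos = [set z | 0 < complex.Re (Jfun s z)].
  have E z : (0 < Jfun s z) = (0 < complex.Re (Jfun s z)) by rewrite ltcE Jfun_real eqxx.
  by apply/seteqP; split=> z; rewrite /Jpos /= E.
apply: (@open_comp _ _ (fun z => complex.Re (Jfun s z)) [set x : R | 0 < x]); last exact: open_gt.
move=> z _; apply: (@continuous_comp _ _ _ (@Jfun R n s) (fun x : C => complex.Re x)).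
  exact: (smooth_cont (smooth_Jfun openT) I).
exact: Re_continuous.
Qed.

Definition smooth_pred (F : 'rV[C]_n.+1 -> C) : bool :=
  `[< smooth_on Jpos F /\ forall w, ~ Jpos w -> F w = 0 >].

(* Extension by 0 makes equality in [conefun] the equality on the cone {J > 0}. *)
Record conefun := SFun { conefunv :> 'rV[C]_n.+1 -> C; conefunP : smooth_pred conefunv }.
HB.instance Definition _ := [isSub for conefunv].
HB.instance Definition _ := [Choice of conefun by <:].
Implicit Types f g h : conefun.

Lemma conefun_smooth f : smooth_on Jpos f.
Proof. by case: f => F /= /asboolP[]. Qed.

Lemma conefun_eq f g : (forall w, Jpos w -> f w = g w) -> f = g.
Proof.
move=> e; apply: val_inj; apply/funext => w /=.
have [Jw|Jw] := pselect (Jpos w); first exact: e.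
case: f g {e} => F pF [G pG] /=.
by move/asboolP: pF => [_ ->//]; move/asboolP: pG => [_ ->].
Qed.

Lemma cutP (F : 'rV[C]_n.+1 -> C) (sF : smooth_on Jpos F) :
  smooth_pred (fun w => if `[< Jpos w >] then F w else 0).
Proof.
apply/asboolP; split=> [|w Jw]; last by case: asboolP.
apply: (eq_on_smooth open_Jpos _ sF) => w Jw; by case: asboolP.
Qed.
Definition cut F (sF : smooth_on Jpos F) : conefun := SFun (cutP sF).

Lemma cutE F (sF : smooth_on Jpos F) w : Jpos w -> cut sF w = F w.
Proof. by move=> Jw /=; case: asboolP. Qed.

Definition sadd f g := cut (smoothD open_Jpos (conefun_smooth f) (conefun_smooth g)).
Definition smul f g := cut (smoothMul open_Jpos (conefun_smooth f) (conefun_smooth g)).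
Definition sopp f := cut (smoothN open_Jpos (conefun_smooth f)).
Definition scst (c : C) := cut (@smooth_cst R n.+1 Jpos c).

Lemma saddA : associative sadd.
Proof. by move=> f g h; apply: conefun_eq => w Jw; rewrite !cutE // addrA. Qed.
Lemma saddC : commutative sadd.
Proof. by move=> f g; apply: conefun_eq => w Jw; rewrite !cutE // addrC. Qed.
Lemma sadd0 : left_id (scst 0) sadd.
Proof. by move=> f; apply: conefun_eq => w Jw; rewrite !cutE // add0r. Qed.
Lemma saddN : left_inverse (scst 0) sopp sadd.
Proof. by move=> f; apply: conefun_eq => w Jw; rewrite !cutE // addNr. Qed.
HB.instance Definition _ := GRing.isZmodule.Build conefun saddA saddC sadd0 saddN.

Lemma smulA : associative smul.
Proof. by move=> f g h; apply: conefun_eq => w Jw; rewrite !cutE // mulrA. Qed.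
Lemma smulC : commutative smul.
Proof. by move=> f g; apply: conefun_eq => w Jw; rewrite !cutE // mulrC. Qed.
Lemma smul1 : left_id (scst 1) smul.
Proof. by move=> f; apply: conefun_eq => w Jw; rewrite !cutE // mul1r. Qed.
Lemma smulDl : left_distributive smul +%R.
Proof. by move=> f g h; apply: conefun_eq => w Jw; rewrite !cutE // mulrDl. Qed.
HB.instance Definition _ := GRing.Zmodule_isComPzRing.Build conefun smulA smulC smul1 smulDl.

Lemma conefunD f g w : Jpos w -> (f + g) w = f w + g w.
Proof. exact: cutE. Qed.
Lemma conefunM f g w : Jpos w -> (f * g) w = f w * g w.
Proof. exact: cutE. Qed.
Lemma conefunN f w : Jpos w -> (- f) w = - f w.
Proof. exact: cutE. Qed.
Lemma conefunB f g w : Jpos w -> (f - g) w = f w - g w.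
Proof. by move=> Jw; rewrite conefunD // conefunN. Qed.
Lemma conefun0 w : (0 : conefun) w = 0.
Proof. by rewrite /=; case: asboolP. Qed.
Lemma conefun1 w : Jpos w -> (1 : conefun) w = 1.
Proof. exact: cutE. Qed.
Lemma conefun_sum (I : Type) (r : seq I) (P : pred I) (F : I -> conefun) w : Jpos w ->
  (\sum_(i <- r | P i) F i) w = \sum_(i <- r | P i) F i w.
Proof.
move=> Jw; apply: (big_morph (fun f : conefun => f w) _ (conefun0 w)) => f g; exact: conefunD.
Qed.
Lemma scstE c w : Jpos w -> scst c w = c.
Proof. exact: cutE. Qed.

Lemma scst_zmod : zmod_morphism scst.
Proof. by move=> a b; apply: conefun_eq => w Jw; rewrite conefunB // !scstE. Qed.
HB.instance Definition _ := GRing.isZmodMorphism.Build C conefun scst scst_zmod.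
Lemma scst_monoid : monoid_morphism scst.
Proof. by split=> [//|a b]; apply: conefun_eq => w Jw; rewrite conefunM // !scstE. Qed.
HB.instance Definition _ := GRing.isMonoidMorphism.Build C conefun scst scst_monoid.

Definition sev (p : {z : 'rV[C]_n.+1 | Jpos z}) (f : conefun) : C := f (sval p).
Lemma sev_zmod p : zmod_morphism (sev p).
Proof. by move=> f g; rewrite /sev conefunB //; exact: svalP. Qed.
HB.instance Definition _ p := GRing.isZmodMorphism.Build conefun C (sev p) (sev_zmod p).
Lemma sev_monoid p : monoid_morphism (sev p).
Proof.
by split=> [|f g]; rewrite /sev ?conefun1 ?conefunM //; exact: svalP.
Qed.
HB.instance Definition _ p := GRing.isMonoidMorphism.Build conefun C (sev p) (sev_monoid p).

Definition sd (a : idx n.+1) (f : conefun) : conefun := cut (smooth_pd a open_Jpos (conefun_smooth f)).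
Lemma sdE a f w : Jpos w -> sd a f w = pd a f w.
Proof. exact: cutE. Qed.

Lemma sd_zmod a : zmod_morphism (sd a).
Proof.
move=> f g; apply: conefun_eq => w Jw; rewrite conefunB // !sdE //.
rewrite (@eq_on_pd R n.+1 Jpos (f - g) (fun x => f x + (- g) x) a w open_Jpos _ Jw); last first.
  by move=> x Jx; rewrite conefunD.
rewrite (pdD Jw a (conefun_smooth f) (conefun_smooth (- g))).
rewrite (@eq_on_pd R n.+1 Jpos (- g) (fun x => - g x) a w open_Jpos _ Jw); last first.
  by move=> x Jx; rewrite conefunN.
by rewrite (pdN Jw a (conefun_smooth g)).
Qed.
HB.instance Definition _ a := GRing.isZmodMorphism.Build conefun conefun (sd a) (sd_zmod a).

Lemma sdM a f g : sd a (f * g) = sd a f * g + f * sd a g.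
Proof.
apply: conefun_eq => w Jw; rewrite conefunD // !conefunM // !sdE //.
rewrite (@eq_on_pd R n.+1 Jpos (f * g) (fun x => f x * g x) a w open_Jpos _ Jw); last first.
  by move=> x Jx; rewrite conefunM.
exact: (pdM Jw a (conefun_smooth f) (conefun_smooth g)).
Qed.

Lemma sd_comm a b f : sd a (sd b f) = sd b (sd a f).
Proof.
apply: conefun_eq => w Jw; rewrite !sdE //.
rewrite (@eq_on_pd R n.+1 Jpos (sd b f) (pd b f) a w open_Jpos _ Jw); last first.
  by move=> x Jx; exact: sdE.
rewrite (@eq_on_pd R n.+1 Jpos (sd a f) (pd a f) b w open_Jpos _ Jw); last first.
  by move=> x Jx; exact: sdE.
exact: (pd_comm open_Jpos Jw a b (conefun_smooth f)).
Qed.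

Lemma sd_cst a c : sd a (scst c) = 0.
Proof.
apply: conefun_eq => w Jw; rewrite sdE // conefun0.
rewrite (@eq_on_pd R n.+1 Jpos (scst c) (fun=> c) a w open_Jpos _ Jw); last first.
  by move=> x Jx; exact: scstE.
exact: pd_cst.
Qed.

Definition szv (A : 'I_n.+1) : conefun := cut (@smooth_coord R n.+1 Jpos A).
Definition szb (A : 'I_n.+1) : conefun := cut (smooth_conj open_Jpos (@smooth_coord R n.+1 Jpos A)).
Definition snu (A : 'I_n.+1) : conefun := scst (nu R s A).
Lemma Jpos_neq0 w : Jpos w -> Jfun s w != 0.
Proof. by move=> Jw; rewrite gt_eqF. Qed.
Definition sJi : conefun := cut (smoothV open_Jpos (smooth_Jfun open_Jpos) Jpos_neq0).

Lemma sd_szv a A : sd a (szv A) = (a == inl A)%:R.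
Proof.
apply: conefun_eq => w Jw; rewrite sdE //.
rewrite (@eq_on_pd R n.+1 Jpos (szv A) (fun x => x 0 A) a w open_Jpos _ Jw); last first.
  by move=> x Jx; exact: cutE.
by rewrite pd_coord; case: (a == _); rewrite ?conefun1 ?conefun0.
Qed.
Lemma sd_szb a A : sd a (szb A) = (a == inr A)%:R.
Proof.
apply: conefun_eq => w Jw; rewrite sdE //.
rewrite (@eq_on_pd R n.+1 Jpos (szb A) (fun x => (x 0 A)^*) a w open_Jpos _ Jw); last first.
  by move=> x Jx; exact: cutE.
by rewrite pd_coord_conj; case: (a == _); rewrite ?conefun1 ?conefun0.
Qed.

Lemma snu2 A : snu A * snu A = 1.
Proof. by rewrite -rmorphM nu_sqr rmorph1. Qed.

Lemma sJJi : (\sum_A snu A * (szv A * szb A)) * sJi = 1.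
Proof.
apply: conefun_eq => w Jw; rewrite conefunM // conefun_sum // conefun1 // cutE //.
rewrite (eq_bigr (fun A => nu R s A * (w 0 A * (w 0 A)^*))) ?divff ?Jpos_neq0 // => A _.
by rewrite !conefunM // !cutE.
Qed.
End SmoothRing.
Arguments scst {R n s} c.
Arguments snu {R n s} A.
Arguments szv {R n s} A.
Arguments szb {R n s} A.

(** * The coefficients of the series *)

Section Coefficients.
Variable R : realType.
Local Notation C := (Cplx R).
Implicit Types a b c : fps C.

(** A coefficient of a product depends only on truncations, so the laws of [fps_mul] are inherited
    from polynomials. *)
Definition ptr N a : {poly C} := \poly_(i < N) a i.

Lemma fps_mulE N a b m : (m < N)%N -> fps_mul a b m = (ptr N a * ptr N b)`_m.
Proof.
move=> mN; rewrite coefM; apply: eq_bigr => i _.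
by rewrite !coef_poly !(leq_ltn_trans _ mN) ?leq_subr // -ltnS.
Qed.

Lemma fps_mulC : commutative (@fps_mul R).
Proof.
by move=> a b; apply/funext => m; rewrite !(fps_mulE _ _ (ltnSn m)) mulrC.
Qed.

Lemma fps_mulA : associative (@fps_mul R).
Proof.
move=> a b c; apply/funext => m.
have E x y z : fps_mul (fps_mul x y) z m = (ptr m.+1 x * ptr m.+1 y * ptr m.+1 z)`_m.
  rewrite coefM; apply: eq_bigr => i _.
  by rewrite (fps_mulE _ _ (ltn_ord i)) coef_poly ltnS leq_subr.
by rewrite fps_mulC !E; congr (_`_m); rewrite mulrC mulrA.
Qed.

Lemma fps_mul1 : left_id (@fps_one R) (@fps_mul R).
Proof.
move=> a; apply/funext => m; rewrite /fps_mul big_ord_recl /= mul1r subn0.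
by rewrite big1 ?addr0 // => i _; rewrite /fps_one /bump /= mul0r.
Qed.
Lemma fps_mulr1 : right_id (@fps_one R) (@fps_mul R).
Proof. by move=> a; rewrite fps_mulC fps_mul1. Qed.
HB.instance Definition _ := Monoid.isLaw.Build (fps C) (@fps_one R) (@fps_mul R)
  fps_mulA fps_mul1 fps_mulr1.

Lemma coef_red0 m : coef_red R 0 m = (m == 0%N)%:R.
Proof. by rewrite /coef_red big_geq // fps_mulr1. Qed.

Lemma fps_lam_mul r a m : fps_mul (fps_lam R r) a m = if (r <= m)%N then a (m - r)%N else 0.
Proof.
rewrite /fps_mul /fps_lam; case: leqP => rm.
  rewrite (bigD1 (inord r)) //= inordK // eqxx mul1r big1 ?addr0 // => i.
  rewrite -val_eqE /= inordK // => /negbTE ->; exact: mul0r.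
by rewrite big1 // => i _; rewrite ltn_eqF ?mul0r // (leq_ltn_trans _ rm) // -ltnS.
Qed.

Lemma coef_red_gt r m : (m < r)%N -> coef_red R r m = 0.
Proof. by move=> mr; rewrite /coef_red fps_lam_mul leqNgt mr. Qed.

(** Coefficientwise form of (1 - r lambda) a_(r+1) = lambda a_r for the series a_r = lambda^r / ((1
    - lambda) ... (1 - (r-1) lambda)). For r >= 1 the coefficients are Stirling numbers of the
    second kind. *)
Lemma coef_redS r m : coef_red R r m + r%:R * coef_red R r.+1 m = coef_red R r.+1 m.+1.
Proof.
pose p r : fps C := \big[@fps_mul R/@fps_one R]_(1 <= k < r) fps_geom R k.
have pS k : p r.+1 k.+1 = p r k.+1 + r%:R * p r.+1 k.
  case: r => [|r].
    by rewrite /p !big_geq // /fps_one /=; ring.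
  have pE l : p r.+2 l = \sum_(i < l.+1) p r.+1 i * r.+1%:R ^+ (l - i).
    by rewrite {1}/p big_nat_recr.
  rewrite !pE big_ord_recr /= subnn expr0 mulr1 addrC; congr (_ + _).
  rewrite mulr_sumr; apply: eq_bigr => i _; rewrite subSn; last by rewrite -ltnS.
  by rewrite exprS; ring.
rewrite /coef_red !fps_lam_mul ltnS subSS.
have [rm|mr|rm] := ltngtP r m; last 2 first.
- by rewrite mulr0 addr0.
- rewrite rm subnn mulr0 addr0; case: m {rm pS p} => [|m]; first by rewrite !big_geq.
  rewrite [in RHS]big_nat_recr //= /fps_mul big_ord_recl big_ord0 addr0.
  by rewrite /fps_geom expr0 mulr1.
have -> : (m - r = (m - r.+1).+1)%N by rewrite subnSK.
by rewrite -!/(p _) pS.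
Qed.

Definition cred r m : C := (r`!%:R)^-1 * coef_red R r m.

Lemma cred0 m : cred 0 m = (m == 0%N)%:R.
Proof. by rewrite /cred invr1 mul1r coef_red0. Qed.
Lemma cred_gt r m : (m < r)%N -> cred r m = 0.
Proof. by move=> mr; rewrite /cred coef_red_gt ?mulr0. Qed.
(** This is [coef_redS] divided by r!; the factors r + 1 come from (r+1)! = (r+1) r!. *)
Lemma credS r m : cred r m + (r.+1 * r)%:R * cred r.+1 m = r.+1%:R * cred r.+1 m.+1.
Proof.
pose x : C := r.+1%:R; pose y : C := r`!%:R.
have x0 : x != 0 by rewrite pnatr_eq0.
have y0 : y != 0 by rewrite pnatr_eq0 -lt0n fact_gt0.
have E k : cred r.+1 k = (x * y)^-1 * coef_red R r.+1 k.
  by rewrite /cred factS natrM.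
rewrite !E -coef_redS -[cred r m]/(y^-1 * coef_red R r m) -[r.+1%:R in RHS]/x.
have -> : ((r.+1 * r)%:R : C) = x * r%:R by rewrite natrM.
generalize (r%:R : C) (coef_red R r m) (coef_red R r.+1 m) => t a b.
by clear E; clearbody x y; field; rewrite x0 y0.
Qed.
Lemma cred11 : cred 1 1 = 1.
Proof. by rewrite /cred invr1 mul1r /coef_red big_geq // fps_mulr1 /fps_lam. Qed.
Lemma cred01 : cred 0 1 = 0.
Proof. by rewrite cred0. Qed.
End Coefficients.

(** * The star product on the cone *)

Section ConeStar.
Variables (R : realType) (n s : nat).
Local Notation C := (Cplx R).
Local Notation S := (conefun R n s).
Implicit Types f g h : S.
Local Notation zv := (@szv R n s).
Local Notation zb := (@szb R n s).
Local Notation cst := (@scst R n s).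

Definition dh (A : 'I_n.+1) : {additive S -> S} := sd (inl A).
Definition da (A : 'I_n.+1) : {additive S -> S} := sd (inr A).

Definition cwick r f g : S := wick dh da (@szv R n s) (@szb R n s) (@snu R n s) r f g.
Definition cstar m f g : S :=
  wickS dh da (@szv R n s) (@szb R n s) (@snu R n s) (@scst R n s) (@cred R) m f g.

(** Infinitesimal invariance under the group of nonzero complex scalings, by its two Euler
    fields. *)
Definition proj_inv f : Prop :=
  \sum_A zv A * dh A f = 0 /\ \sum_A zb A * da A f = 0.

Lemma dhE A f w : @Jpos R n s w -> dh A f w = pd (inl A) f w. Proof. exact: cutE. Qed.
Lemma daE A f w : @Jpos R n s w -> da A f w = pd (inr A) f w. Proof. exact: cutE. Qed.
Lemma zvE A w : @Jpos R n s w -> zv A w = w 0 A. Proof. exact: cutE. Qed.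
Lemma zbE A w : @Jpos R n s w -> zb A w = (w 0 A)^*. Proof. exact: cutE. Qed.
Lemma snuE A w : @Jpos R n s w -> (@snu R n s A) w = @nu R n s A. Proof. exact: cutE. Qed.
Lemma dh_z A B : dh A (zv B) = (A == B)%:R. Proof. exact: sd_szv. Qed.
Lemma da_zb A B : da A (zb B) = (A == B)%:R. Proof. exact: sd_szb. Qed.
Lemma dh_zb A B : dh A (zb B) = 0. Proof. exact: sd_szb. Qed.
Lemma da_z A B : da A (zv B) = 0. Proof. exact: sd_szv. Qed.
Lemma dh_cst A k : dh A (cst k) = 0. Proof. exact: sd_cst. Qed.
Lemma da_cst A k : da A (cst k) = 0. Proof. exact: sd_cst. Qed.
Lemma dhM A f g : dh A (f * g) = dh A f * g + f * dh A g. Proof. exact: sdM. Qed.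
Lemma daM A f g : da A (f * g) = da A f * g + f * da A g. Proof. exact: sdM. Qed.
Lemma dhC A B f : dh A (dh B f) = dh B (dh A f). Proof. exact: sd_comm. Qed.
Lemma daC A B f : da A (da B f) = da B (da A f). Proof. exact: sd_comm. Qed.
Lemma dha A B f : dh A (da B f) = da B (dh A f). Proof. exact: sd_comm. Qed.

Lemma cstar_assoc m f g h : proj_inv f -> proj_inv g -> proj_inv h ->
  \sum_(i < m.+1) cstar i f (cstar (m - i) g h) =
  \sum_(i < m.+1) cstar i (cstar (m - i) f g) h.
Proof.
move=> [f1 f2] [g1 g2] [h1 h2]; apply/eqP; rewrite -subr_eq0 -sumrB; apply/eqP.
apply: (assoc_eq0 dhM daM dhC daC dha dh_z da_zb dh_zb da_z (fun A B => dh_cst A _)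
  (fun A B => da_cst A _) (@snu2 R n s) (@sJJi R n s) dh_cst da_cst (@cred0 R) (@cred_gt R)
  (@credS R) f2 g1 g2 (ev := fun p => @sev R n s p)) h1.
- move=> p k; exact: (scstE k (svalP p)).
(* J > 0 forces some coordinate of the point to be nonzero. *)
- move=> p; apply/existsP; apply: contraT => /existsPn z0.
  have := svalP p; rewrite /Jpos /= /Jfun big1 ?ltxx // => A _.
  have E : sev p (zv A) = (sval p) 0 A by exact: (cutE _ (svalP p)).
  have /eqP : sev p (zv A) == 0 := negbNE (z0 A).
  rewrite E => ->.
  by rewrite mul0r mulr0.
- move=> x H; apply: conefun_eq => w Jw; rewrite conefun0; exact: (H (exist _ w Jw)).
Qed.

Lemma cstar1r m f : cstar m f 1 = if m is 0%N then f else 0.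
Proof. exact: (wickS1r _ _ _ _ dhM _ (@cred0 R)). Qed.
Lemma cstar1l m f : cstar m 1 f = if m is 0%N then f else 0.
Proof. exact: (wickS1l _ _ _ _ daM _ (@cred0 R)). Qed.
Lemma cstarDr m f g h : cstar m f (g + h) = cstar m f g + cstar m f h.
Proof. exact: wickSDr. Qed.
Lemma cstarDl m f g h : cstar m (g + h) f = cstar m g f + cstar m h f.
Proof. exact: wickSDl. Qed.
Lemma cstarZr m k f g : cstar m f (cst k * g) = cst k * cstar m f g.
Proof. exact: (wickSZr _ _ _ _ dhM _ dh_cst). Qed.
Lemma cstarZl m k f g : cstar m (cst k * f) g = cst k * cstar m f g.
Proof. exact: (wickSZl _ _ _ _ daM _ da_cst). Qed.
Lemma cstarE m f g : cstar m f g = \sum_(r < m.+1) cst (cred R r m) * cwick r f g.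
Proof. by []. Qed.
End ConeStar.
Arguments dh {R n s} A.
Arguments da {R n s} A.

(** * Functions on M_red as scale-invariant functions on the cone *)

Section Projection.
Variables (R : realType) (n s : nat).
Local Notation C := (Cplx R).
Local Notation M := (Mred R n s).
Local Notation J := (@Jfun R n s).
Local Notation Jpos := (@Jpos R n s).
Implicit Types (z : 'rV[C]_n.+1) (w : 'rV[C]_n) (j : 'I_n.+1) (p : M).

Lemma Jfun_scale (c : C) z : J (c *: z) = `|c| ^+ 2 * J z.
Proof.
rewrite normCK mulr_sumr; apply: eq_bigr => k _.
by rewrite mxE rmorphM /=; ring.
Qed.

Lemma Jpos_scale (c : C) z : c != 0 -> Jpos (c *: z) <-> Jpos z.
Proof.
move=> c0; rewrite /Jpos /= Jfun_scale pmulr_rgt0 //.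
by rewrite exprn_gt0 // normr_gt0.
Qed.

Lemma projM_pos z : Jpos z ->
  exists2 x : Zlevel R n s, val x = (sqrtC (J z))^-1 *: z & projM s z = Some (\pi_M x).
Proof.
move=> Jz; have q0 : 0 < sqrtC (J z) by rewrite sqrtC_gt0.
have J1 : J ((sqrtC (J z))^-1 *: z) == 1.
  rewrite Jfun_scale normfV (gtr0_norm q0) exprVn sqrtCK mulVf //; exact: Jpos_neq0.
exists (exist (fun z : 'rV[C]_n.+1 => J z == 1) _ J1 : Zlevel R n s); first by [].
rewrite /projM (insubT (fun z : 'rV[C]_n.+1 => J z == 1) J1).
by congr (Some (\pi _)); exact: val_inj.
Qed.

Lemma projM_npos z : ~ Jpos z -> projM s z = None.
Proof.
move=> Jz; rewrite /projM insubN //; apply/negP => /eqP; rewrite Jfun_scale => e.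
apply: Jz; rewrite /Jpos /=.
have c0 : 0 < `|(sqrtC (J z))^-1| ^+ 2.
  rewrite lt_def exprn_ge0 // andbT; apply: contra_eqN e => /eqP ->.
  by rewrite mul0r eq_sym oner_eq0.
by rewrite -(pmulr_rgt0 _ c0) e ltr01.
Qed.

(** Both points satisfy J = 1, which forces |c| = 1. *)
Lemma Zlevel_rel (x y : Zlevel R n s) (c : C) : val y = c *: val x -> \pi_M x = \pi_M y.
Proof.
move=> e; apply/eqmodP/asboolP; exists c; split=> //.
have := valP y; rewrite e Jfun_scale (eqP (valP x)) mulr1 => /eqP c1.
by apply/eqP; rewrite -(@eqrXn2 _ 2) ?expr1n ?c1.
Qed.

Lemma projM_scale (c : C) z : c != 0 -> projM s (c *: z) = projM s z.
Proof.
move=> c0; have [Jz|Jz] := pselect (Jpos z); last first.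
  by rewrite !projM_npos // => /Jpos_scale; auto.
have [x ex ->] := projM_pos Jz.
have [y ey ->] := projM_pos ((Jpos_scale z c0).2 Jz).
have q0 : sqrtC (J z) != 0 by rewrite sqrtC_eq0 Jpos_neq0.
congr Some; apply/esym/(@Zlevel_rel _ _ ((sqrtC (J (c *: z)))^-1 * c * sqrtC (J z))).
by rewrite ey ex !scalerA; congr (_ *: _); rewrite -!mulrA divff ?mulr1.
Qed.

Definition lift_pt p : 'rV[C]_n.+1 := val (repr p).

Lemma J_lift_pt p : J (lift_pt p) = 1.
Proof. exact/eqP/(valP (repr p)). Qed.
Lemma Jpos_lift_pt p : Jpos (lift_pt p).
Proof. by rewrite /Jpos /= J_lift_pt ltr01. Qed.

Lemma projM_lift_pt p : projM s (lift_pt p) = Some p.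
Proof.
have [x ex ->] := projM_pos (Jpos_lift_pt p); congr Some.
rewrite -[RHS]reprK; congr (\pi _); apply: val_inj.
by rewrite ex J_lift_pt sqrtC1 invr1 scale1r.
Qed.

Lemma lift_pt_projM z p : projM s z = Some p -> exists2 c : C, c != 0 & lift_pt p = c *: z.
Proof.
have [Jz|Jz] := pselect (Jpos z); last by rewrite projM_npos.
have q0 : sqrtC (J z) != 0 by rewrite sqrtC_eq0 Jpos_neq0.
have [x ex ->] := projM_pos Jz => -[xp].
have /eqmodP/asboolP[u [u1 e]] : \pi_M (repr p) = \pi_M x by rewrite reprK.
have u0 : u != 0 by rewrite -normr_eq0 u1 oner_eq0.
exists (u^-1 * (sqrtC (J z))^-1); first by rewrite mulf_neq0 ?invr_eq0.
by rewrite -scalerA -ex e scalerA mulVf // scale1r.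
Qed.

Lemma sec_hcoord j z : z 0 j != 0 -> sec j (hcoord j z) = (z 0 j)^-1 *: z.
Proof.
move=> z0; apply/rowP => i; rewrite !mxE; case: unliftP => [k ->|->].
  by rewrite mxE mulrC.
by rewrite mulVf.
Qed.

Lemma chart_img_hcoord j z : Jpos z -> z 0 j != 0 -> chart_img s j (hcoord j z).
Proof.
by move=> Jz z0; rewrite /chart_img /= sec_hcoord //; apply/(Jpos_scale z); rewrite ?invr_eq0.
Qed.

Lemma chart_cover z : Jpos z -> exists j, z 0 j != 0.
Proof.
move=> Jz; apply/existsP; apply: contraT => /existsPn z0.
have := Jz; rewrite /Jpos /= /Jfun big1 ?ltxx // => A _.
by have /negbNE/eqP -> := z0 A; rewrite mul0r mulr0.
Qed.

(** The pullback of f to the cone; the value 0 elsewhere matches the convention of [loc]. *)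
Definition hat (f : M -> C) z : C := oapp f 0 (projM s z).

Lemma loc_hat j f w : loc j f w = hat f (sec j w).
Proof. by []. Qed.
Lemma hat_scale f (c : C) z : c != 0 -> hat f (c *: z) = hat f z.
Proof. by move=> c0; rewrite /hat projM_scale. Qed.
Lemma hat_lift_pt f p : hat f (lift_pt p) = f p.
Proof. by rewrite /hat projM_lift_pt. Qed.
Lemma hat_out f z : ~ Jpos z -> hat f z = 0.
Proof. by move=> Jz; rewrite /hat projM_npos. Qed.
Lemma loc_hcoord f j z : z 0 j != 0 -> loc j f (hcoord j z) = hat f z.
Proof. by move=> z0; rewrite loc_hat sec_hcoord // hat_scale // invr_eq0. Qed.

Lemma hat_of (G : 'rV[C]_n.+1 -> C) z : (forall (c : C) z, c != 0 -> Jpos z -> G (c *: z) = G z) ->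
  Jpos z -> hat (fun p => G (lift_pt p)) z = G z.
Proof.
move=> HG Jz; have [x _ ex] := projM_pos Jz.
rewrite /hat ex /=; have [c c0 ->] := lift_pt_projM ex; exact: HG.
Qed.

(** In every chart around p the section returns a rescaling of the lifted point, so expressions
    stemming from one scale-invariant G agree, whichever chart [glue] picks. *)
Lemma glue_lift (u : 'I_n.+1 -> 'rV[C]_n -> C) (G : 'rV[C]_n.+1 -> C) :
  (forall (c : C) z, c != 0 -> Jpos z -> G (c *: z) = G z) ->
  (forall j w, chart_img s j w -> u j w = G (sec j w)) ->
  @Defs.glue R n s u = fun p => G (lift_pt p).
Proof.
move=> HG Hu; apply/funext => p; rewrite /Defs.glue.
set j := odflt _ _.
have zj : lift_pt p 0 j != 0.
  rewrite /j; case: pickP => [//|] H; have [k zk] := chart_cover (Jpos_lift_pt p).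
  by have := H k; rewrite /chart_dom -/(lift_pt p) zk.
rewrite /chart -/(lift_pt p) Hu; last exact: (chart_img_hcoord (Jpos_lift_pt p) zj).
by rewrite sec_hcoord // HG ?invr_eq0 //; exact: Jpos_lift_pt.
Qed.

Lemma chart_independent_lift (u : 'I_n.+1 -> 'rV[C]_n -> C) (G : 'rV[C]_n.+1 -> C) :
  (forall (c : C) z, c != 0 -> Jpos z -> G (c *: z) = G z) ->
  (forall j w, chart_img s j w -> u j w = G (sec j w)) -> chart_independent s u.
Proof.
move=> HG Hu.
have H p j : chart_dom j p -> u j (chart j p) = G (lift_pt p).
  rewrite /chart_dom /chart -/(lift_pt p) => zj; rewrite Hu.
    by rewrite sec_hcoord // HG ?invr_eq0 //; exact: Jpos_lift_pt.
  exact: (chart_img_hcoord (Jpos_lift_pt p) zj).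
by move=> p j k pj pk; rewrite !H.
Qed.

Lemma smooth_sec j A U : open U -> smooth_on U (fun w => sec j w 0 A).
Proof.
move=> oU; rewrite (_ : (fun w => _) = fun w : 'rV[C]_n => if unlift j A is Some k then w 0 k else 1).
  by case: (unlift j A) => [k|]; [exact: smooth_coord|exact: smooth_cst].
by apply/funext => w; rewrite mxE.
Qed.

Lemma open_chart_img j : open (@chart_img R n s j).
Proof.
apply: (@open_comp _ _ (sec j : 'rV[C]_n -> 'rV[C]_n.+1) Jpos); last exact: open_Jpos.
move=> w _; apply: row_continuous => k; exact: (smooth_cont (smooth_sec j k openT) I).
Qed.

Lemma smooth_on_sec j F : smooth_on Jpos F -> smooth_on (@chart_img R n s j) (fun w => F (sec j w)).
Proof.
move=> sF.
have H1 w : chart_img s j w -> Jpos (sec j w) by [].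
have H2 k : smooth_on (@chart_img R n s j) (fun w => sec j w 0 k).
  by apply: smooth_sec; exact: open_chart_img.
exact: (@smooth_comp R n n.+1 (@chart_img R n s j) Jpos (sec j) (@open_chart_img j) (@open_Jpos R n s) H1 H2 F sF).
Qed.

(** Where z_j is nonzero the pullback is the chart expression composed with [hcoord j]; smoothness
    is local, so one chart per point is enough. *)
Lemma smooth_hat f : smoothM f -> smooth_on Jpos (hat f).
Proof.
move=> sf l z Jz; have [j zj] := chart_cover Jz.
pose U := [set z | Jpos z /\ z 0 j != 0].
have oU : open U.
  have -> : U = Jpos `&` [set z : 'rV[C]_n.+1 | z 0 j != 0] by [].
  apply: openI; first exact: open_Jpos.
  apply: (@open_comp _ _ (fun z : 'rV[C]_n.+1 => z 0 j) [set x : C | x != 0]).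
    move=> x _; exact: coord_continuous.
  rewrite (_ : [set x : C | x != 0] = ~` [set 0]).
    exact/closed_openC/accessible_closed_set1/hausdorff_accessible/norm_hausdorff.
  by apply/seteqP; split=> x /= => [/eqP//|xx]; apply/eqP.
suff sU : smooth_on U (hat f) by apply: sU.
have H1 x : U x -> chart_img s j (hcoord j x) by move=> [Jx xj]; exact: chart_img_hcoord.
have H2 k : smooth_on U (fun z => hcoord j z 0 k).
  rewrite (_ : (fun z => _) = fun z : 'rV[C]_n.+1 => z 0 (lift j k) * (z 0 j)^-1); last first.
    by apply/funext => x; rewrite mxE.
  apply: (smoothMul oU); first exact: smooth_coord.
  by apply: (smoothV oU); [exact: smooth_coord|move=> x []].
have sc := @smooth_comp R n.+1 n U (@chart_img R n s j) (hcoord j) oU (@open_chart_img j) H1 H2 (loc j f) (sf j).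
by apply: (eq_on_smooth oU _ sc) => x [Jx xj]; exact: loc_hcoord.
Qed.

Lemma smoothM_hat f : smooth_on Jpos (hat f) -> smoothM f.
Proof.
move=> sf j; rewrite (_ : loc j f = fun w => hat f (sec j w)); last exact: erefl.
by apply: smooth_on_sec; exact: sf.
Qed.

Lemma smoothM_of (G : 'rV[C]_n.+1 -> C) : (forall (c : C) z, c != 0 -> Jpos z -> G (c *: z) = G z) ->
  smooth_on Jpos G -> smoothM (fun p : M => G (lift_pt p)).
Proof.
move=> HG sG; apply: smoothM_hat; apply: (eq_on_smooth (@open_Jpos R n s) _ sG) => z Jz.
exact/esym/(hat_of HG Jz).
Qed.

Lemma derC_line1 (a : C) : derC (fun t : R => 1 + (real_complex R t : C) * a) 0 a.
Proof.
have i1 : derC (fun t => real_complex R t : C) 0 1.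
  by split; [have := @is_derive_id R R 0 1|have := @is_derive_cst R R R 0 0 1]; apply.
apply: derC_eq (derCD (derC_cst _ _) (derCM i1 (derC_cst a _))) _.
by rewrite mulr0 addr0 add0r mul1r.
Qed.

(* Euler's identities for functions of degree 0 in z and in its conjugate. *)
Lemma scale_inv_proj_inv (f : conefun R n s) :
  (forall (c : C) z, c != 0 -> Jpos z -> f (c *: z) = f z) -> proj_inv f.
Proof.
move=> Hf.
(* The curve (1 + t a) z stays in one scaling orbit, so f is constant on it near t = 0. Taking a = 1
   and a = i gives the sum and i times the difference of the two Euler sums. *)
have E z (a : C) : Jpos z -> \sum_k (pd (inl k) f z * (a * z 0 k) + pd (inr k) f z * (a * z 0 k)^*) = 0.
  move=> Jz; have d : forall k, derC (fun t => line z (a *: z) t 0 k) 0 (a * z 0 k).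
    by move=> k; have := hasD_coord (a *: z) z k; rewrite mxE.
  have := @derC_comp R n.+1 Jpos f (line z (a *: z)) _ (@open_Jpos R n s) _ (conefun_smooth f) d.
  rewrite line0 => /(_ Jz) D1.
  apply: (derC_unique D1).
  apply: (@derC_near R (fun=> f z)); last exact: derC_cst.
  have n1 : \forall t \near (0 : R), complex.Re (1 + (real_complex R t : C) * a) != 0.
    have c : {for (0 : R), continuous (fun t : R => complex.Re (1 + (real_complex R t : C) * a))}.
      have [d1 _] := derC_line1 a.
      by apply: differentiable_continuous; apply/derivable1_diffP; exact: ex_derive.
    have := @cvgr_neq0 R R R (nbhs (0 : R)) (nbhs_filter _) _ _ c; apply.
    by rewrite rmorph0 mul0r addr0 oner_neq0.
  apply: filterS n1 => t t0; rewrite /line scalerA -[X in X + _]scale1r -scalerDl Hf //.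
  by apply: contraNneq t0 => ->.
have conjI (x : C) : ('i * x)^* = - 'i * x^* by rewrite rmorphM /= conjCi.
have E1 z : Jpos z -> \sum_k pd (inl k) f z * z 0 k = 0 /\ \sum_k pd (inr k) f z * (z 0 k)^* = 0.
  move=> Jz; have e1 := E z 1 Jz; have e2 := E z 'i Jz.
  rewrite big_split /= in e1; rewrite big_split /= in e2.
  set X := \sum_k pd (inl k) f z * z 0 k; set Y := \sum_k pd (inr k) f z * (z 0 k)^*.
  have {}e1 : X + Y = 0.
    by rewrite -{}e1; congr (_ + _); apply: eq_bigr => k _; rewrite mul1r.
  have {}e2 : 'i * (X - Y) = 0.
    rewrite -{}e2 mulrBr !mulr_sumr -sumrN; congr (_ + _); apply: eq_bigr => k _.
      by rewrite mulrCA.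
    by rewrite conjI mulNr mulrN mulrCA.
  have XY : X - Y = 0.
    by move/eqP: e2; rewrite mulf_eq0 (negbTE (neq0Ci _)) => /eqP.
  have h2 : (2 : C) != 0 by rewrite pnatr_eq0.
  have X0 : X = 0.
    by apply: (mulfI h2); rewrite mulr0 -[RHS](addr0 0) -{1}e1 -XY; ring.
  by split; [exact: X0|move: e1; rewrite X0 add0r].
split; apply: conefun_eq => z Jz; rewrite conefun_sum // conefun0.
  rewrite -[RHS](E1 z Jz).1; apply: eq_bigr => k _.
  by rewrite (conefunM _ _ Jz) (dhE _ _ Jz) (zvE _ Jz) mulrC.
rewrite -[RHS](E1 z Jz).2; apply: eq_bigr => k _.
by rewrite (conefunM _ _ Jz) (daE _ _ Jz) (zbE _ Jz) mulrC.
Qed.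
End Projection.

Section Scaling.
Variables (R : realType) (n s : nat).
Local Notation C := (Cplx R).
Local Notation S := (conefun R n s).
Local Notation Jpos := (@Jpos R n s).
Local Notation cst := (@scst R n s).
Implicit Types f g : S.

Lemma pd_scale (c : C) f f' z A : c != 0 -> (forall z, Jpos z -> f' z = f (c *: z)) -> Jpos z ->
  dh A f' z = c * dh A f (c *: z) /\ da A f' z = c^* * da A f (c *: z).
Proof.
move=> c0 e Jz; have Jcz : Jpos (c *: z) by apply/Jpos_scale.
have sphi k : smooth_on Jpos (fun x : 'rV[C]_n.+1 => (c *: x) 0 k).
  rewrite (_ : (fun x => _) = fun x : 'rV[C]_n.+1 => c * x 0 k); last first.
    by apply/funext => x; rewrite mxE.
  by apply: (smoothMul (@open_Jpos R n s)); [exact: smooth_cst|exact: smooth_coord].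
have H a : pd a f' z = \sum_k (pd (inl k) f (c *: z) * (c * (a == inl k)%:R) +
    pd (inr k) f (c *: z) * (c^* * (a == inr k)%:R)).
  rewrite (eq_on_pd a (@open_Jpos R n s) e Jz).
  rewrite (@pd_comp R n.+1 n.+1 Jpos Jpos (fun x => c *: x) (@open_Jpos R n s)
    (fun x Jx => (Jpos_scale s x c0).2 Jx) sphi f z a (conefun_smooth f) Jz).
  apply: eq_bigr => k _; congr (_ * _ + _ * _).
    rewrite (_ : (fun x => _) = fun x : 'rV[C]_n.+1 => c * x 0 k); last first.
      by apply/funext => x; rewrite mxE.
    by rewrite (pdZ Jz _ _ (@smooth_coord R n.+1 Jpos k)) pd_coord.
  rewrite (_ : (fun x => _) = fun x : 'rV[C]_n.+1 => c^* * (x 0 k)^*); last first.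
    by apply/funext => x; rewrite mxE rmorphM.
  by rewrite (pdZ Jz _ _ (smooth_conj (@open_Jpos R n s) (@smooth_coord R n.+1 Jpos k))) pd_coord_conj.
rewrite !dhE // !daE // !H; split.
  rewrite (bigD1 A) //= eqxx big1 => [|k /negbTE kA].
    by rewrite ?mulr0 ?mulr1 ?addr0 ?add0r mulrC.
  by rewrite -?[inl A == inl k]/(A == k) [A == k]eq_sym kA /= ?mulr0 ?addr0.
rewrite (bigD1 A) //= eqxx big1 => [|k /negbTE kA].
  by rewrite ?mulr0 ?mulr1 ?addr0 ?add0r mulrC.
by rewrite -?[inr A == inr k]/(A == k) [A == k]eq_sym kA /= ?mulr0 ?addr0.
Qed.

Lemma cwick0E f g z : Jpos z -> cwick 0 f g z = f z * g z.
Proof. exact: cutE. Qed.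

Lemma cwickSE r f g z : Jpos z -> cwick r.+1 f g z = \sum_A \sum_B
  (Jfun s z * nu R s A * (A == B)%:R - (z 0 A)^* * z 0 B) * cwick r (da A f) (dh B g) z.
Proof.
move=> Jz; rewrite /cwick wickSr conefun_sum //; apply: eq_bigr => A _.
rewrite conefun_sum //; apply: eq_bigr => B _; rewrite conefunM //; congr (_ * _).
rewrite conefunB // !conefunM // snuE // zbE // zvE //; congr (_ * _ * _ - _).
  rewrite conefun_sum //; apply: eq_bigr => D _.
  by rewrite !conefunM // snuE // zbE // zvE.
by case: (A == B); rewrite ?conefun1 ?conefun0.
Qed.

Lemma cwickZr r f g k : cwick r f (cst k * g) = cst k * cwick r f g.
Proof. rewrite /cwick; apply: wickMr => [A f1 g1|A]; [exact: dhM|exact: dh_cst]. Qed.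
Lemma cwickZl r f g k : cwick r (cst k * f) g = cst k * cwick r f g.
Proof. rewrite /cwick; apply: wickMl => [A f1 g1|A]; [exact: daM|exact: da_cst]. Qed.

(** At the scaled point each contraction picks up 1/c and its conjugate from the derivatives, which
    the factor P, of bidegree (1, 1), compensates. *)
Lemma cwick_scale r (c : C) f g f' g' : c != 0 ->
  (forall z, Jpos z -> f' z = f (c *: z)) -> (forall z, Jpos z -> g' z = g (c *: z)) ->
  forall z, Jpos z -> cwick r f' g' z = cwick r f g (c *: z).
Proof.
move=> c0; elim: r f g f' g' => [|r IH] f g f' g' ef eg z Jz;
  have Jcz : Jpos (c *: z) by apply/Jpos_scale.
  by rewrite !cwick0E // ef // eg.
have cc0 : c^* != 0 by rewrite conjC_eq0.
rewrite !cwickSE //; apply: eq_bigr => A _; apply: eq_bigr => B _.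
(* Normalized by the inverse scale factors, the derivatives of f' and g' are again the rescaled
   derivatives of f and g. *)
have {}IH := IH (da A f) (dh B g) (cst (c^*)^-1 * da A f') (cst c^-1 * dh B g') _ _ z Jz.
rewrite -{}IH; last 2 first.
- move=> x Jx; rewrite conefunM // scstE // (pd_scale A c0 ef Jx).2 mulKf //.
- move=> x Jx; rewrite conefunM // scstE // (pd_scale B c0 eg Jx).1 mulKf //.
rewrite cwickZr cwickZl !conefunM // !scstE // Jfun_scale !mxE rmorphM normCK /=.
by field; rewrite c0 cc0.
Qed.
End Scaling.

(** * Charts and the Levi-Civita connection *)

Section ChartFrame.
Variables (R : realType) (n s : nat) (j : 'I_n.+1).
Local Notation C := (Cplx R).
Local Notation S := (conefun R n s).
Local Notation Jpos := (@Jpos R n s).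
Local Notation D := (@chart_img R n s j).
Local Notation K w := (Jfun s (sec j w)).
Implicit Types (f g : S) (w : 'rV[C]_n) (t : bool) (a b c : 'I_n).

(** The boolean is true on the antiholomorphic half of the frame; [cj], [dz] and [zz] follow it, so
    that one argument serves both halves. *)
Definition ix t a : idx n := if t then inr a else inl a.
Definition cj t (x : C) : C := if t then x^* else x.
Definition dz t (A : 'I_n.+1) : {additive S -> S} := if t then da A else dh A.
Definition zz t (A : 'I_n.+1) : S := if t then @szb R n s A else @szv R n s A.
(* The components of d log J along the chart. *)
Definition uu t b w : C := nu R s (lift j b) * cj (~~ t) (w 0 b) * (K w)^-1.
(* The frame field number b, lifted to a horizontal vector at sec j w. *)
Definition xi t b w (A : 'I_n.+1) : C :=
  (A == lift j b)%:R - uu t b w * cj t (sec j w 0 A).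

(** Iterated derivatives on the cone, contracted with horizontal lifts at [sec j w]; the lifts enter
    as coefficients and are not differentiated. *)
Fixpoint tau t f (bs : seq 'I_n) w : C :=
  if bs is b :: bs' then \sum_A xi t b w A * tau t (dz t A f) bs' w else f (sec j w).

Let oD : open D := @open_chart_img R n s j.

Lemma K_neq0 w : D w -> K w != 0. Proof. exact: Jpos_neq0. Qed.
Lemma smooth_K : smooth_on D (fun w => K w).
Proof. exact: (smooth_on_sec (@smooth_Jfun R n s _ (@open_Jpos R n s))). Qed.
Lemma smooth_Ki : smooth_on D (fun w => (K w)^-1).
Proof. by apply: (smoothV oD smooth_K) => w; exact: K_neq0. Qed.
Lemma smooth_cj m U t (F : 'rV[C]_m -> C) : open U -> smooth_on U F -> smooth_on U (fun x => cj t (F x)).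
Proof. by move=> oU sF; case: t; [exact: (smooth_conj oU sF)|exact: sF]. Qed.
Lemma smooth_uu t b : smooth_on D (uu t b).
Proof.
apply: (smoothMul oD); last exact: smooth_Ki.
apply: (smoothMul oD); first exact: smooth_cst.
by apply: (smooth_cj _ oD); exact: smooth_coord.
Qed.
Lemma smooth_cjsec t A : smooth_on D (fun w => cj t (sec j w 0 A)).
Proof. by apply: (smooth_cj _ oD); exact: smooth_sec. Qed.
Lemma smooth_xi t b A : smooth_on D (fun w => xi t b w A).
Proof.
apply: (smoothD oD); first exact: smooth_cst.
apply: (smoothN oD); apply: (smoothMul oD); [exact: smooth_uu|exact: smooth_cjsec].
Qed.
Lemma smooth_tau t f bs : smooth_on D (tau t f bs).
Proof.
elim: bs f => [|b bs IH] f; first exact: (smooth_on_sec (conefun_smooth f)).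
by apply: (smooth_sum oD) => A _; apply: (smoothMul oD); [exact: smooth_xi|exact: IH].
Qed.

Lemma pd_cjcoord t t' a b w : pd (ix t a) (fun w : 'rV[C]_n => cj t' (w 0 b)) w =
  ((t == t') && (a == b))%:R.
Proof.
by case: t; case: t'; rewrite /ix /cj ?pd_coord ?pd_coord_conj //.
Qed.

Lemma pd_cjsec t a A w : D w -> pd (ix t a) (fun w => cj t (sec j w 0 A)) w = (A == lift j a)%:R.
Proof.
move=> Dw; case: (unliftP j A) => [k|] ->.
  rewrite (_ : (fun w => _) = fun w => cj t (w 0 k)); last by apply/funext => x; rewrite sec_lift.
  by rewrite pd_cjcoord eqxx (inj_eq lift_inj) eq_sym.
rewrite (_ : (fun w => _) = fun=> 1); last first.
  by apply/funext => x; rewrite sec_diag /cj rmorph1; case: t.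
by rewrite (negbTE (neq_lift _ _)) pd_cst.
Qed.

Lemma pd_K t a w : D w -> pd (ix t a) (fun w => K w) w = nu R s (lift j a) * cj (~~ t) (w 0 a).
Proof.
move=> Dw.
have sc k : smooth_on D (fun w : 'rV[C]_n => w 0 k) := @smooth_coord R n D k.
have scc k : smooth_on D (fun w : 'rV[C]_n => (w 0 k)^*) := smooth_conj oD (sc k).
have sn k : smooth_on D (fun w : 'rV[C]_n => nu R s (lift j k) * ((w 0 k)^* * w 0 k)).
  by apply: (smoothMul oD (@smooth_cst R n D _)); apply: (smoothMul oD).
rewrite (_ : (fun w => K w) = fun w => nu R s j + \sum_k nu R s (lift j k) * ((w 0 k)^* * w 0 k)); last first.
  by apply/funext => x; exact: Jfun_sec.
rewrite (pdD Dw _ (@smooth_cst R n D _) (smooth_sum oD _ (fun k _ => sn k))) pd_cst add0r.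
rewrite (pd_sum oD Dw _ _ (fun k _ => sn k)) (bigD1 a) //= big1 => [|k /negbTE ka]; last first.
  rewrite (pdZ Dw _ _ (smoothMul oD (scc k) (sc k))) (pdM Dw _ (scc k) (sc k)).
  rewrite (pd_cjcoord t true a k) (pd_cjcoord t false a k) [a == k]eq_sym ka !andbF.
  by rewrite mul0r mulr0 addr0 mulr0.
rewrite (pdZ Dw _ _ (smoothMul oD (scc a) (sc a))) (pdM Dw _ (scc a) (sc a)).
rewrite (pd_cjcoord t true a a) (pd_cjcoord t false a a) eqxx !andbT addr0; congr (_ * _).
by case: t; rewrite /cj /= ?(mul1r, mulr1, mul0r, mulr0, addr0, add0r).
Qed.

Lemma pd_Ki t a w : D w -> pd (ix t a) (fun w => (K w)^-1) w = - uu t a w * (K w)^-1.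
Proof.
move=> Dw; rewrite (pdV Dw _ smooth_K (K_neq0 Dw)) (pd_K _ _ Dw) /uu.
have := K_neq0 Dw; move: (K w) (cj (~~ t) (w 0 a)) => k x k0.
by field.
Qed.

Lemma pd_uu t a b w : D w -> pd (ix t a) (uu t b) w = - (uu t a w * uu t b w).
Proof.
move=> Dw.
have s1 : smooth_on D (fun w : 'rV[C]_n => nu R s (lift j b) * cj (~~ t) (w 0 b)).
  apply: (smoothMul oD (@smooth_cst R n D _)).
  exact: (smooth_cj _ oD (@smooth_coord R n D b)).
have -> : uu t b = fun w => nu R s (lift j b) * cj (~~ t) (w 0 b) * (K w)^-1 by [].
rewrite (pdM Dw _ s1 smooth_Ki) (pd_Ki _ _ Dw).
rewrite (pdZ Dw _ _ (smooth_cj _ oD (@smooth_coord R n D b))) pd_cjcoord.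
rewrite (_ : t == ~~ t = false) /= ?mulr0 ?mul0r ?add0r; last by case: (t).
by rewrite /uu; ring.
Qed.

Lemma pd_xi t a b A w : D w -> pd (ix t a) (fun w => xi t b w A) w = - (uu t b w * xi t a w A).
Proof.
move=> Dw.
have s1 := smoothMul oD (smooth_uu t b) (smooth_cjsec t A).
have -> : (fun w => xi t b w A) = fun w => (A == lift j b)%:R + - (uu t b w * cj t (sec j w 0 A)) by [].
rewrite (pdD Dw _ (@smooth_cst R n D _) (smoothN oD s1)) pd_cst add0r.
rewrite (pdN Dw _ s1) (pdM Dw _ (smooth_uu t b) (smooth_cjsec t A)) (pd_uu _ _ _ Dw) (pd_cjsec _ _ _ Dw).
by rewrite /xi; ring.
Qed.

Lemma pd_sec t f a w : D w -> pd (ix t a) (fun w => f (sec j w)) w = dz t (lift j a) f (sec j w).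
Proof.
move=> Dw; have H1 x : D x -> Jpos (sec j x) by [].
rewrite (@pd_comp R n n.+1 D Jpos (sec j) (@open_Jpos R n s) H1 (fun k => smooth_sec j k oD) f w _ (conefun_smooth f) Dw).
transitivity (\sum_A ((~~ t)%:R * (pd (inl A) f (sec j w) * (A == lift j a)%:R) +
    t%:R * (pd (inr A) f (sec j w) * (A == lift j a)%:R))).
  apply: eq_bigr => A _.
  have h1 := pd_cjsec t a A Dw.
  have h2 : pd (ix t a) (fun w => cj (~~ t) (sec j w 0 A)) w = 0.
    case: (unliftP j A) => [k|] ->.
      rewrite (_ : (fun w => _) = fun w => cj (~~ t) (w 0 k)); last by apply/funext => x; rewrite sec_lift.
      by rewrite pd_cjcoord; case: t {h1}.
    rewrite (_ : (fun w => _) = fun=> 1); last first.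
      by apply/funext => x; rewrite sec_diag /cj rmorph1; case: t {h1}.
    exact: pd_cst.
  have hl : pd (ix t a) (fun w => sec j w 0 A) w = (~~ t)%:R * (A == lift j a)%:R.
    case: (t) h1 h2 => h1 h2; first exact: etrans h2 (esym (mul0r _)).
    exact: etrans h1 (esym (mul1r _)).
  have hr : pd (ix t a) (fun w => (sec j w 0 A)^*) w = t%:R * (A == lift j a)%:R.
    case: (t) h1 h2 {hl} => h1 h2; first exact: etrans h1 (esym (mul1r _)).
    exact: etrans h2 (esym (mul0r _)).
  rewrite hl hr; congr (_ + _); exact: mulrCA.
rewrite (bigD1 (lift j a)) //= eqxx big1 => [|A /negbTE ->]; last by rewrite !mulr0 addr0.
case: t; rewrite /dz /= ?(mul0r, mul1r, mulr1, addr0, add0r).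
  exact/esym/(daE _ _ (H1 _ Dw)).
exact/esym/(dhE _ _ (H1 _ Dw)).
Qed.

Lemma dzC t A B f : dz t A (dz t B f) = dz t B (dz t A f).
Proof. by case: t; [exact: daC|exact: dhC]. Qed.
Lemma dz_euler t k A f : \sum_B zz t B * dz t B f = - (k%:R * f) ->
  \sum_B zz t B * dz t B (dz t A f) = - (k.+1%:R * dz t A f).
Proof.
case: t => h; first exact: (Eb_db (@daM R n s) (@daC R n s) (@da_zb R n s) A h).
exact: (E_d (@dhM R n s) (@dhC R n s) (@dh_z R n s) A h).
Qed.

Lemma tau_swap t f a b bs w : tau t f (a :: b :: bs) w = tau t f (b :: a :: bs) w.
Proof.
rewrite /=; under eq_bigr do rewrite mulr_sumr.
under [RHS]eq_bigr do rewrite mulr_sumr.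
rewrite exchange_big; apply: eq_bigr => B _; apply: eq_bigr => A _ /=.
by rewrite dzC mulrCA.
Qed.

Lemma tau_cons_eq t b s1 s2 w : (forall f, tau t f s1 w = tau t f s2 w) ->
  forall f, tau t f (b :: s1) w = tau t f (b :: s2) w.
Proof. by move=> H f /=; apply: eq_bigr => A _; rewrite H. Qed.

Lemma tau_perm t s1 s2 w : perm_eq s1 s2 -> forall f, tau t f s1 w = tau t f s2 w.
Proof.
have mid b s3 s4 : forall f, tau t f (s3 ++ b :: s4) w = tau t f (b :: s3 ++ s4) w.
  elim: s3 => [//|x s3 IH] f; rewrite tau_swap; exact: tau_cons_eq.
elim: s1 s2 => [|b s1 IH] s2 p f.
  by rewrite perm_sym in p; rewrite (perm_nilP p).
have /splitPr bs : b \in s2 by rewrite -(perm_mem p) mem_head.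
case: s2 / bs p => s3 s4 p; rewrite mid; apply: tau_cons_eq; apply: IH.
by rewrite -(perm_cons b) (perm_trans p) // perm_catC /= perm_cons perm_catC.
Qed.

(** Along the section the frame field a is its lift [xi t a] plus [uu t a] times an Euler field,
    whose action in degree -(k + size bs) gives the second term. Differentiating the lifts by
    [pd_xi] puts a in place of one entry of [bs]. For k = 0 these are the Christoffel
    corrections. *)
Lemma pd_tau t k f a bs w : D w -> \sum_B zz t B * dz t B f = - (k%:R * f) ->
  pd (ix t a) (tau t f bs) w = tau t f (a :: bs) w
    - (k + size bs)%:R * uu t a w * tau t f bs w
    - \sum_(i < size bs) uu t (nth a bs i) w * tau t f (set_nth a bs i a) w.
Proof.
move=> Dw; have Jw : Jpos (sec j w) by [].
elim: bs k f => [|b bs IH] k f hf.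
  rewrite big_ord0 subr0 addn0 [tau t f [:: a] w]/= [tau t f [::]]/= (pd_sec _ _ _ Dw).
  have e : \sum_A cj t (sec j w 0 A) * dz t A f (sec j w) = - (k%:R * f (sec j w)).
    have : (\sum_B zz t B * dz t B f) (sec j w) = (- (k%:R * f)) (sec j w) by rewrite hf.
    rewrite conefun_sum // conefunN // conefunM //.
    have -> : (k%:R : S) (sec j w) = k%:R.
      by rewrite -(rmorph_nat (@scst R n s)); exact: scstE.
    move=> <-; apply: eq_bigr => A _; rewrite conefunM //; congr (_ * _).
    by rewrite /zz /cj; case: (t); rewrite ?zbE ?zvE.
  transitivity (\sum_A ((A == lift j a)%:R * dz t A f (sec j w)
     - uu t a w * (cj t (sec j w 0 A) * dz t A f (sec j w))) - k%:R * uu t a w * f (sec j w)); last first.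
    by congr (_ - _); apply: eq_bigr => A _; rewrite /xi; ring.
  rewrite sumrB -mulr_sumr e (bigD1 (lift j a)) //= eqxx big1 => [|A /negbTE ->].
    by rewrite mul1r addr0; ring.
  by rewrite mul0r.
have -> : tau t f (b :: bs) = fun w => \sum_A xi t b w A * tau t (dz t A f) bs w by [].
rewrite (pd_sum oD Dw _ _ (fun A _ => smoothMul oD (smooth_xi t b A) (smooth_tau t (dz t A f) bs))).
rewrite tau_swap [size (b :: bs)]/= addnS [X in _ = _ - X]big_ord_recl.
transitivity (\sum_A (xi t b w A * tau t (dz t A f) (a :: bs) w
   - (k + size bs).+1%:R * uu t a w * (xi t b w A * tau t (dz t A f) bs w)
   - (uu t b w * (xi t a w A * tau t (dz t A f) bs w)
      + \sum_(i < size bs) uu t (nth a bs i) w * (xi t b w A * tau t (dz t A f) (set_nth a bs i a) w)))).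
  apply: eq_bigr => A _.
  rewrite (pdM Dw _ (smooth_xi t b A) (smooth_tau t (dz t A f) bs)) (pd_xi _ _ _ _ Dw).
  rewrite (IH _ _ (dz_euler A hf)) addSn.
  rewrite [X in _ = _ - (_ + X)](_ : _ = xi t b w A * \sum_(i < size bs) uu t (nth a bs i) w * tau t (dz t A f) (set_nth a bs i a) w); last first.
    by rewrite mulr_sumr; apply: eq_bigr => i _; ring.
  set X := \sum_(i < _) _; set Y := tau t _ (a :: bs) w; set Z := tau t _ bs w.
  by move: X Y Z (xi t b w A) (xi t a w A) (uu t a w) (uu t b w) => X Y Z p q u v; ring.
rewrite !sumrB big_split /= -!mulr_sumr; congr (_ - _ - (_ + _)).
rewrite exchange_big /=; apply: eq_bigr => i _ /=.
by rewrite -mulr_sumr.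
Qed.
End ChartFrame.
Arguments dz {R n s} t A.
Arguments zz {R n s} t A.

(** * The Levi-Civita connection and its symmetrized derivatives *)

Section LeviCivita.
Variables (R : realType) (n s : nat) (j : 'I_n.+1).
Local Notation C := (Cplx R).
Local Notation D := (@chart_img R n s j).
Local Notation K w := (Jfun s (sec j w)).
Local Notation u := (@uu R n s j).
Local Notation ix := (@ix n).
Local Notation nuj k := (@nu R n s (lift j k)).
Implicit Types (w : 'rV[C]_n) (t : bool) (a b c d e : 'I_n) (x y : idx n).

Let oD : open D := @open_chart_img R n s j.

Definition pair_idx x y : {ffun 'I_2 -> idx n} := [ffun i => if i == ord0 then x else y].

Lemma ord2P (P : 'I_2 -> Prop) : P ord0 -> P (lift ord0 ord0) -> forall i, P i.
Proof.
move=> p0 p1 i; case: (unliftP ord0 i) => [k|] -> //.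
by rewrite (ord1 k).
Qed.

Definition gmet x y w : C := gred R n s j w (pair_idx x y).

(* Twice the component of g along coordinate b of type t and d of the other type. *)
Definition gmix t b d w : C :=
  (nuj d * (d == b)%:R - nuj d * cj t (w 0 d) * u t b w) * (K w)^-1.

Lemma gmetC x y w : gmet x y w = gmet y x w.
Proof. by rewrite /gmet !gredE !ffunE /= addrC. Qed.

Lemma gmet_same t b d w : gmet (ix t b) (ix t d) w = 0.
Proof. by rewrite /gmet gredE !ffunE /=; case: t; rewrite /= addr0 mulr0. Qed.

Lemma gmet_mix t b d w : gmet (ix t b) (ix (~~ t) d) w = 2^-1 * gmix t b d w.
Proof.
rewrite /gmet gredE !ffunE /gmix /uu /cj /=; congr (_ * _); case: t => /=.
  rewrite addr0 [b == d]eq_sym; case: eqP => [->|_] /=; last first.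
    by rewrite !mulr0 mul0r expr2 invfM; ring.
  by rewrite expr2 invfM; ring.
by rewrite add0r expr2 invfM; ring.
Qed.

Lemma smooth_gmix t b d : smooth_on D (gmix t b d).
Proof.
apply: (smoothMul oD); last exact: smooth_Ki.
apply: (smoothD oD); first exact: smooth_cst.
apply: (smoothN oD); apply: (smoothMul oD); last exact: smooth_uu.
apply: (smoothMul oD (@smooth_cst R n D _)).
by apply: (smooth_cj _ oD); exact: smooth_coord.
Qed.

(** The symmetry of the right side in a and b is the Kaehler property; Koszul's formula then yields
    the symbols of [Gam_pure]. *)
Lemma pd_gmix t a b d w : D w ->
  pd (ix t a) (gmix t b d) w = - (u t a w * gmix t b d w + u t b w * gmix t a d w).
Proof.
move=> Dw.
have s0 : smooth_on D (fun w : 'rV[C]_n => cj t (w 0 d)) := smooth_cj t oD (@smooth_coord R n D d).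
have s1 := smoothMul oD (@smooth_cst R n D (nuj d)) s0.
have s2 := smoothMul oD s1 (smooth_uu t b).
have s3 := smoothD oD (@smooth_cst R n D (nuj d * (d == b)%:R)) (smoothN oD s2).
rewrite (pdM Dw _ s3 (@smooth_Ki R n s j)) (pd_Ki _ _ Dw).
rewrite (pdD Dw _ (@smooth_cst R n D _) (smoothN oD s2)) pd_cst add0r (pdN Dw _ s2).
rewrite (pdM Dw _ s1 (smooth_uu t b)) (pdZ Dw _ _ s0) (pd_uu _ _ _ Dw) pd_cjcoord eqxx [a == d]eq_sym.
rewrite /gmix; move: (u t a w) (u t b w) (cj t (w 0 d)) ((K w)^-1) (nuj d) => p q x y v.
by rewrite /=; ring.
Qed.

Lemma sum_nu_cj t w : \sum_d nuj d * cj t (w 0 d) * cj (~~ t) (w 0 d) = K w - nu R s j.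
Proof.
rewrite Jfun_sec addrC addKr; apply: eq_bigr => d _; case: t; rewrite /cj /=; ring.
Qed.

Lemma uuK t b w : D w -> u t b w * K w = nuj b * cj (~~ t) (w 0 b).
Proof. by move=> Dw; rewrite /uu mulfVK //; exact: (K_neq0 Dw). Qed.

Lemma gmix_inj t w (del : 'I_n -> C) : D w ->
  (forall d, \sum_c del c * gmix t c d w = 0) -> forall c, del c = 0.
Proof.
move=> Dw H e; have K0 := K_neq0 Dw.
(* A column of the inverse matrix of [gmix t]; its entries are those of H_red. *)
pose gi d := K w * (nuj d * (d == e)%:R + nu R s j * (cj (~~ t) (w 0 d) * cj t (w 0 e))).
have E c : \sum_d gmix t c d w * gi d = (c == e)%:R.
  transitivity (\sum_d ((d == c)%:R * ((nuj d * nuj d) * (d == e)%:R + nuj d * nu R s j * (cj (~~ t) (w 0 d) * cj t (w 0 e)))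
     - (d == e)%:R * ((nuj d * nuj d) * cj t (w 0 d) * u t c w)
     - u t c w * nu R s j * cj t (w 0 e) * (nuj d * cj t (w 0 d) * cj (~~ t) (w 0 d)))).
    apply: eq_bigr => d _; rewrite /gmix /gi.
    move: K0; move: (K w) (u t c w) (cj t (w 0 d)) (cj (~~ t) (w 0 d)) => k p x y k0.
    by field.
  rewrite sumrB -mulr_sumr sum_nu_cj sumrB.
  rewrite (bigD1 c) //= eqxx big1 => [|d /negbTE ->]; last by rewrite mul0r.
  rewrite (bigD1 e) //= eqxx big1 => [|d /negbTE ->]; last by rewrite mul0r.
  rewrite !nu_sqr !addr0 !mul1r.
  transitivity ((c == e)%:R + nu R s j * cj t (w 0 e) * (nuj c * cj (~~ t) (w 0 c) - u t c w * K w)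
     + u t c w * cj t (w 0 e) * (nu R s j * nu R s j - 1)); first by ring.
  by rewrite uuK // nu_sqr !subrr !mulr0 !addr0.
transitivity (\sum_c del c * (c == e)%:R).
  rewrite (bigD1 e) //= eqxx mulr1 big1 ?addr0 // => c /negbTE ->; exact: mulr0.
under eq_bigr => c _ do rewrite -E mulr_sumr.
rewrite exchange_big big1 //= => d _.
transitivity ((\sum_c del c * gmix t c d w) * gi d); last by rewrite H mul0r.
by rewrite mulr_suml; apply: eq_bigr => c _; ring.
Qed.

Lemma sum_ix t (F : idx n -> C) : \sum_x F x = \sum_c F (ix t c) + \sum_c F (ix (~~ t) c).
Proof. by rewrite big_sumType /=; case: t => /=; [exact: addrC|]. Qed.

Variable Gam : 'I_n.+1 -> christoffel R n.
Hypothesis hGam : levi_civita s (gred R n s) Gam.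
Local Notation Ga := (Gam j).

Lemma gmet_compat (a x y : idx n) w : D w -> pd a (gmet x y) w =
  \sum_c Ga w c a x * gmet c y w + \sum_c Ga w c a y * gmet x c w.
Proof.
move=> Dw; have [_ /(_ w Dw a (pair_idx x y))] := hGam j.
rewrite /nabla big_ord_recl big_ord1 => /eqP; rewrite subr_eq0 => /eqP.
have -> : (fun w' => gred R n s j w' (pair_idx x y)) = gmet x y by [].
move=> ->; congr (_ + _); apply: eq_bigr => c _; rewrite !ffunE /=; congr (_ * _).
  by congr (gred R n s j w _); apply/ffunP => i; rewrite !ffunE; case: eqP.
by congr (gred R n s j w _); apply/ffunP; apply: ord2P; rewrite !ffunE.
Qed.

(** Koszul's formula: of the six terms produced by metric compatibility, torsion-freeness cancels
    four. It determines an arbitrary [Gam] from the metric, which is nondegenerate by [gmix_inj]. *)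
Lemma Gam_koszul (x y v : idx n) w : D w ->
  2 * \sum_c Ga w c x y * gmet c v w =
    pd x (gmet y v) w + pd y (gmet x v) w - pd v (gmet x y) w.
Proof.
move=> Dw; have [tf _] := hGam j.
rewrite !gmet_compat //.
have sw (p q v' : idx n) : \sum_c Ga w c p q * gmet v' c w = \sum_c Ga w c p q * gmet c v' w.
  by apply: eq_bigr => c _; rewrite gmetC.
have tq (p q v' : idx n) : \sum_c Ga w c p q * gmet c v' w = \sum_c Ga w c q p * gmet c v' w.
  by apply: eq_bigr => c _; rewrite tf.
rewrite !sw (tq y x v) (tq v y x) (tq v x y).
by ring.
Qed.

(** The metric has no components with two indices of the same type, so Koszul's formula with three
    indices of one type has right side 0. *)
Lemma Gam_mixed t a b c w : D w -> Ga w (ix (~~ t) c) (ix t a) (ix t b) = 0.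
Proof.
move=> Dw.
have G0 b' d' : gmet (ix t b') (ix t d') = fun=> 0 by apply/funext => x; exact: gmet_same.
apply: (gmix_inj (t := ~~ t) Dw (del := fun c => Ga w (ix (~~ t) c) (ix t a) (ix t b))) => d.
have := Gam_koszul (ix t a) (ix t b) (ix t d) Dw.
rewrite !G0 !pd_cst addr0 subr0 (sum_ix t) big1 => [|k _]; last by rewrite gmet_same mulr0.
rewrite add0r => /eqP; rewrite mulf_eq0 pnatr_eq0 /= => /eqP.
move=> e; apply: (mulfI (invr_neq0 (_ : (2 : C) != 0))); first by rewrite pnatr_eq0.
rewrite mulr0 -[RHS]e mulr_sumr; apply: eq_bigr => k _.
by have := gmet_mix (~~ t) k d w; rewrite negbK => ->; ring.
Qed.

Lemma Gam_pure t a b c w : D w ->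
  Ga w (ix t c) (ix t a) (ix t b) = - (u t a w * (c == b)%:R + u t b w * (c == a)%:R).
Proof.
move=> Dw; apply/eqP; rewrite -subr_eq0; apply/eqP; move: c.
have h2 : (2 : C) != 0 by rewrite pnatr_eq0.
apply: (gmix_inj (t := t) Dw) => d.
have G0 b' d' : gmet (ix t b') (ix t d') = fun=> 0 by apply/funext => x; exact: gmet_same.
have Gm b' d' : gmet (ix t b') (ix (~~ t) d') = fun w => 2^-1 * gmix t b' d' w.
  by apply/funext => x; exact: gmet_mix.
have := Gam_koszul (ix t a) (ix t b) (ix (~~ t) d) Dw.
rewrite (sum_ix t) [X in _ * (_ + X)]big1 => [|k _]; last by rewrite Gam_mixed // mul0r.
rewrite addr0 !Gm G0 pd_cst subr0 !(pdZ Dw _ _ (smooth_gmix _ _ _)) !pd_gmix //.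
under eq_bigr do rewrite Gm mulrCA.
rewrite -mulr_sumr mulVKf // => e.
under eq_bigr do rewrite mulrBl.
rewrite sumrB e.
have -> : \sum_c - (u t a w * (c == b)%:R + u t b w * (c == a)%:R) * gmix t c d w =
    - (u t a w * gmix t b d w + u t b w * gmix t a d w).
  transitivity (- (u t a w * (\sum_c (c == b)%:R * gmix t c d w) + u t b w * (\sum_c (c == a)%:R * gmix t c d w))).
    rewrite !mulr_sumr -big_split -sumrN; apply: eq_bigr => c _ /=.
    by move: (gmix t c d w) => q; ring.
  rewrite (bigD1 b) //= eqxx big1 => [|c /negbTE ->]; last by rewrite mul0r.
  rewrite (bigD1 a) //= eqxx big1 => [|c /negbTE ->]; last by rewrite mul0r.
  by rewrite !addr0 !mul1r.
move: (gmix t b d w) (gmix t a d w) (u t a w) (u t b w) => p q v x.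
by field.
Qed.

Section Iterated.
Variables (t : bool) (f : Mred R n s -> C) (F : conefun R n s).
Hypotheses (fF : forall w, D w -> loc j f w = F (sec j w))
  (eF : \sum_A zz t A * dz t A F = 0).
Local Notation T := (@tau R n s j t F).

Definition lst r (B : {ffun 'I_r -> 'I_n}) : seq 'I_n := [seq B i | i <- enum 'I_r].
Definition ixf r (B : {ffun 'I_r -> 'I_n}) : {ffun 'I_r -> idx n} := [ffun i => ix t (B i)].
Definition upd r (B : {ffun 'I_r -> 'I_n}) i c : {ffun 'I_r -> 'I_n} :=
  [ffun l => if l == i then c else B l].

Lemma size_lst r (B : {ffun 'I_r -> 'I_n}) : size (lst B) = r.
Proof. by rewrite size_map size_enum_ord. Qed.
Lemma nth_lst r (B : {ffun 'I_r -> 'I_n}) (k0 : 'I_n) (i : 'I_r) : nth k0 (lst B) i = B i.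
Proof. by rewrite (nth_map i) ?size_enum_ord // nth_ord_enum. Qed.

Lemma lst_upd r (B : {ffun 'I_r -> 'I_n}) (k0 : 'I_n) i c : lst (upd B i c) = set_nth k0 (lst B) i c.
Proof.
apply: (@eq_from_nth _ k0) => [|k]; first by rewrite size_set_nth !size_lst; apply/esym/maxn_idPr.
rewrite size_lst => kr; rewrite (nth_lst _ _ (Ordinal kr)) ffunE nth_set_nth /=.
by rewrite -val_eqE /=; case: eqP => // _; rewrite (nth_lst _ _ (Ordinal kr)).
Qed.

Lemma lst_cons r (B : {ffun 'I_r.+1 -> 'I_n}) :
  lst B = B ord0 :: lst [ffun i => B (lift ord0 i)].
Proof.
rewrite /lst enum_ordSl /= -map_comp; congr (_ :: _); apply: eq_map => i /=.
by rewrite ffunE.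
Qed.

Lemma lst_perm r (B : {ffun 'I_r -> 'I_n}) (sg : 'S_r) : perm_eq (lst [ffun i => B (sg i)]) (lst B).
Proof.
rewrite (_ : lst _ = map B (map sg (enum 'I_r))); last first.
  by rewrite -map_comp; apply: eq_map => i; rewrite /= ffunE.
apply: perm_map; apply: uniq_perm; rewrite ?(map_inj_uniq perm_inj) ?enum_uniq // => i.
by rewrite mem_enum; apply/mapP; exists ((sg^-1)%g i); rewrite ?mem_enum // permKV.
Qed.

(** The Christoffel terms cancel the last two terms of [pd_tau] at k = 0. Components with all
    indices of one type suffice, since H_red pairs antiholomorphic with holomorphic indices. *)
Lemma nabla_tau r (om : tensor R n r) a (B : {ffun 'I_r -> 'I_n}) w :
  (forall w B, D w -> om w (ixf B) = T (lst B) w) -> D w ->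
  nabla Ga (ix t a) om w (ixf B) = T (a :: lst B) w.
Proof.
move=> Hom Dw; rewrite /nabla.
rewrite (eq_on_pd (ix t a) oD (fun w' Dw' => Hom w' B Dw') Dw).
have eF0 : \sum_A zz t A * dz t A F = - (0%:R * F) by rewrite eF mul0r oppr0.
rewrite (pd_tau _ _ Dw eF0) add0n size_lst.
have -> : \sum_(i < r) \sum_c Ga w c (ix t a) (ixf B i) * om w [ffun l => if l == i then c else ixf B l]
   = - \sum_(i < r) (u t a w * T (lst B) w + u t (nth a (lst B) i) w * T (set_nth a (lst B) i a) w).
  rewrite -sumrN; apply: eq_bigr => i _.
  have updE c : [ffun l => if l == i then ix t c else ixf B l] = ixf (upd B i c).
    by apply/ffunP => l; rewrite !ffunE; case: eqP.
  rewrite (sum_ix t) [X in _ + X]big1 => [|c _]; last first.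
    by rewrite ffunE Gam_mixed // mul0r.
  rewrite addr0 nth_lst.
  transitivity (- (u t a w * (\sum_c (c == B i)%:R * T (lst (upd B i c)) w) +
     u t (B i) w * (\sum_c (c == a)%:R * T (lst (upd B i c)) w))).
    rewrite !mulr_sumr -big_split -sumrN; apply: eq_bigr => c _ /=.
    rewrite updE Hom // ffunE Gam_pure //.
    by move: (T _ w) (u t a w) (u t (B i) w) => p q v; ring.
  rewrite (bigD1 (B i)) //= eqxx big1 => [|c /negbTE ->]; last by rewrite mul0r.
  rewrite (bigD1 a) //= eqxx big1 => [|c /negbTE ->]; last by rewrite mul0r.
  rewrite !addr0 !mul1r (_ : upd B i (B i) = B) ?(lst_upd _ a) //.
  by apply/ffunP => l; rewrite ffunE; case: eqP => // ->.
rewrite big_split /= sumr_const card_ord.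
move: (\sum_(i < r) _) (T (a :: lst B) w) (T (lst B) w) (u t a w) => X Y Z p.
by rewrite -[_ *+ r]mulr_natr; ring.
Qed.

(** [tau] is symmetric in its indices, so all permutations in the symmetrization contribute the same
    value and averaging changes nothing. *)
Lemma Dsym_tau r (B : {ffun 'I_r -> 'I_n}) w : D w ->
  @Dsym_iter R n Ga r (loc j f) w (ixf B) = T (lst B) w.
Proof.
elim: r B w => [|r IH] B w Dw.
  by rewrite /= /scal fF // /lst (size0nil (size_enum_ord 0)).
rewrite [LHS]/=; set om := @Dsym_iter R n Ga r (loc j f).
rewrite /Dsym /vee /Sym.
have E (sg : 'S_r.+1) : \sum_a tens (@dcoord R n a) (nabla Ga a om) w [ffun i => ixf B (sg i)] =
    T (lst B) w.
  (* The coordinate form in the first slot selects a single direction of differentiation. *)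
  rewrite (bigD1 (ix t (B (sg ord0)))) //= big1 => [|a /negbTE ha]; last first.
    rewrite /tens /dcoord !ffunE (_ : lshift r ord0 = ord0) ?ffunE; last exact: val_inj.
    by rewrite eq_sym ha mul0r.
  rewrite addr0 /tens /dcoord !ffunE (_ : lshift r ord0 = ord0); last exact: val_inj.
  rewrite ?ffunE eqxx mul1r.
  have -> : [ffun i => [ffun i0 => ixf B (sg i0)] (rshift 1 i)] = ixf [ffun i => B (sg (lift ord0 i))].
    apply/ffunP => i; rewrite !ffunE (_ : rshift 1 i = lift ord0 i) //; exact: val_inj.
  rewrite (nabla_tau _ _ (fun w' B' => IH B' w') Dw); apply: tau_perm.
  have -> : B (sg ord0) :: lst [ffun i => B (sg (lift ord0 i))] = lst [ffun i => B (sg i)].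
    by rewrite [RHS]lst_cons ffunE; congr (_ :: lst _); apply/ffunP => i; rewrite !ffunE.
  exact: lst_perm.
rewrite -mulr_sumr exchange_big /=.
rewrite (eq_bigr (fun=> T (lst B) w)) => [|sg _]; last exact: E.
rewrite sumr_const card_Sn -[T (lst B) w *+ _]mulr_natr mulrCA mulVf ?mulr1 //.
Qed.
End Iterated.
End LeviCivita.

(** * The pairing with H_red as a contraction on the cone *)

Section FfunSums.
Variables (R : realType).
Local Notation C := (Cplx R).

Lemma big_ffun_cons (T : finType) r (G : {ffun 'I_r.+1 -> T} -> C) :
  \sum_B G B = \sum_b \sum_(B : {ffun 'I_r -> T})
    G [ffun i => if unlift ord0 i is Some i' then B i' else b].
Proof.
rewrite pair_bigA /=.
rewrite (reindex (fun p : T * {ffun 'I_r -> T} =>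
  [ffun i => if unlift ord0 i is Some i' then p.2 i' else p.1])) //=.
exists (fun B : {ffun 'I_r.+1 -> T} => (B ord0, [ffun i => B (lift ord0 i)])) => [[b B]|B] _ /=.
  congr (_, _); first by rewrite ffunE unlift_none.
  by apply/ffunP => i; rewrite !ffunE liftK.
by apply/ffunP => i; rewrite ffunE; case: unliftP => [k|] ->; rewrite ?ffunE.
Qed.

Lemma exchange4 (I J K L : finType) (F : I -> J -> K -> L -> C) :
  \sum_i \sum_j \sum_k \sum_l F i j k l = \sum_k \sum_l \sum_i \sum_j F i j k l.
Proof.
rewrite [LHS]pair_bigA; under eq_bigr do rewrite pair_bigA.
rewrite exchange_big [RHS]pair_bigA; apply: eq_bigr => -[k l] _ /=.
by rewrite pair_bigA.
Qed.

Lemma sum_ffun_ix n t r (G : {ffun 'I_r -> idx n} -> C) :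
  (forall (A : {ffun 'I_r -> idx n}) i k, A i = ix (~~ t) k -> G A = 0) ->
  \sum_A G A = \sum_(B : {ffun 'I_r -> 'I_n}) G (ixf t B).
Proof.
move=> G0; pose un (x : idx n) : 'I_n := match x with inl k => k | inr k => k end.
rewrite (bigID (fun A : {ffun 'I_r -> idx n} => A \in codom (@ixf n t r))) /=.
rewrite [X in _ + X]big1 ?addr0 => [|A hA].
  rewrite (reindex_onto (@ixf n t r) (fun A => [ffun i => un (A i)])) /= => [|A /codomP[B ->]].
    apply: eq_bigl => B; rewrite codom_f; apply/eqP/ffunP => i; rewrite !ffunE.
    by rewrite /ix; case: t {G0}.
  by apply/ffunP => i; rewrite !ffunE /ix; case: t {G0}.
have [/forallP hall|/forallPn[i hi]] := boolP [forall i, A i == ix t (un (A i))].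
  case/negP: hA; apply/codomP; exists [ffun i => un (A i)].
  by apply/ffunP => i; rewrite !ffunE (eqP (hall i)) /ix; case: t {G0 hall}.
apply: (G0 A i (un (A i))); move: hi; rewrite /ix /un; case: (A i) => k; case: (t) => //=;
  by rewrite eqxx.
Qed.
End FfunSums.

Section Pairing.
Variables (R : realType) (n s : nat) (j : 'I_n.+1).
Local Notation C := (Cplx R).
Local Notation S := (conefun R n s).
Local Notation D := (@chart_img R n s j).
Local Notation K w := (Jfun s (sec j w)).
Local Notation u := (@uu R n s j).
Local Notation nuj k := (@nu R n s (lift j k)).
Local Notation xi := (@xi R n s j).
Local Notation tau := (@tau R n s j).
Implicit Types (w : 'rV[C]_n) (f g F G : S).

Definition hh w (a b : 'I_n) : C := Hred s j w (inr a) (inl b).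

Lemma hhE w a b : D w -> hh w a b =
  K w * (nu R s j * ((w 0 a)^* * w 0 b) + nuj a * (a == b)%:R).
Proof. by move=> Dw; rewrite /hh HredE. Qed.

Lemma cj_sec t w X : cj t (sec j w 0 X) = (X == j)%:R + \sum_a cj t (w 0 a) * (X == lift j a)%:R.
Proof.
case: (unliftP j X) => [k|] ->.
  rewrite sec_lift eq_sym (negbTE (neq_lift _ _)) add0r (bigD1 k) //= eqxx mulr1.
  by rewrite big1 ?addr0 // => a ak; rewrite (inj_eq lift_inj) eq_sym (negbTE ak) mulr0.
rewrite sec_diag eqxx big1 ?addr0 => [|a _]; first by case: t; rewrite /cj ?rmorph1.
by rewrite (negbTE (neq_lift _ _)) mulr0.
Qed.

Lemma sum_xi t w X : D w ->
  \sum_a cj t (w 0 a) * xi t a w X = nu R s j * cj t (sec j w 0 X) / K w - (X == j)%:R.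
Proof.
move=> Dw; have K0 := K_neq0 Dw.
transitivity (\sum_a cj t (w 0 a) * (X == lift j a)%:R -
   (\sum_a nuj a * cj t (w 0 a) * cj (~~ t) (w 0 a)) * (cj t (sec j w 0 X) / K w)).
  rewrite mulr_suml -sumrB; apply: eq_bigr => a _; rewrite /xi /uu; ring.
have -> : \sum_a cj t (w 0 a) * (X == lift j a)%:R = cj t (sec j w 0 X) - (X == j)%:R.
  by rewrite cj_sec addrC addKr.
by rewrite sum_nu_cj; move: (K w) K0 (cj t (sec j w 0 X)) => k k0 z; field.
Qed.

Lemma sum_uu t w X :
  \sum_a nuj a * ((X == lift j a)%:R * u (~~ t) a w) = (cj t (sec j w 0 X) - (X == j)%:R) / K w.
Proof.
rewrite cj_sec addrC addKr mulr_suml; apply: eq_bigr => a _; rewrite /uu negbK.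
transitivity ((nuj a * nuj a) * (cj t (w 0 a) * (X == lift j a)%:R / K w)); first by ring.
by rewrite nu_sqr mul1r.
Qed.

(** The bivector P at [sec j w] is the horizontal lift of H_red: this is where chart and cone
    meet. *)
Lemma hh_xi w (A B : 'I_n.+1) : D w ->
  \sum_a \sum_b hh w a b * (xi true a w A * xi false b w B) =
  Jfun s (sec j w) * nu R s A * (A == B)%:R - (sec j w 0 A)^* * sec j w 0 B.
Proof.
move=> Dw; have K0 := K_neq0 Dw.
pose zA := cj true (sec j w 0 A); pose zB := cj false (sec j w 0 B).
transitivity (K w * nu R s A * (A == B)%:R - zA * zB); last by [].
have S1 := sum_xi true A Dw; have S2 := sum_xi false B Dw.
have S3 : \sum_a nuj a * (xi true a w A * xi false a w B) =
   nu R s A * (A == B)%:R - nu R s j * ((A == j)%:R * (B == j)%:R)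
   - zB * (zA - (A == j)%:R) / K w - zA * (zB - (B == j)%:R) / K w + zA * zB * (K w - nu R s j) / K w ^+ 2.
  have e1 : \sum_a nuj a * ((A == lift j a)%:R * (B == lift j a)%:R) =
      nu R s A * (A == B)%:R - nu R s j * ((A == j)%:R * (B == j)%:R).
    case: (unliftP j A) => [k|] ->.
      rewrite (bigD1 k) //= eqxx big1 => [|a ak]; last first.
        by rewrite (inj_eq lift_inj) eq_sym (negbTE ak) mul0r mulr0.
      by rewrite [lift j k == j]eq_sym (negbTE (neq_lift _ _)) mul1r mul0r mulr0 subr0 addr0 [lift j k == B]eq_sym.
    rewrite eqxx mul1r [j == B]eq_sym subrr big1 // => a _.
    by rewrite (negbTE (neq_lift _ _)) mul0r mulr0.
  have e2 : \sum_a nuj a * ((A == lift j a)%:R * u false a w) = (zA - (A == j)%:R) / K w := sum_uu true w A.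
  have e3 : \sum_a nuj a * ((B == lift j a)%:R * u true a w) = (zB - (B == j)%:R) / K w := sum_uu false w B.
  have e4 : \sum_a nuj a * (u true a w * u false a w) = (K w - nu R s j) / K w ^+ 2.
    rewrite -(@sum_nu_cj R n s j true w) mulr_suml; apply: eq_bigr => a _.
    rewrite /uu /=; transitivity ((nuj a * nuj a) * (nuj a * cj false (w 0 a) * cj true (w 0 a) / K w ^+ 2)).
      by rewrite expr2 invfM /cj /=; move: (nuj a) ((K w)^-1) => p q; ring.
    by rewrite nu_sqr /cj /= mul1r; move: (nuj a) ((K w ^+ 2)^-1) => p q; ring.
  transitivity (\sum_a nuj a * ((A == lift j a)%:R * (B == lift j a)%:R)
    - zB * (\sum_a nuj a * ((A == lift j a)%:R * u false a w))
    - zA * (\sum_a nuj a * ((B == lift j a)%:R * u true a w))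
    + zA * zB * (\sum_a nuj a * (u true a w * u false a w))).
    rewrite !mulr_sumr -!sumrB -big_split; apply: eq_bigr => a _ /=.
    by rewrite /xi -/zA -/zB; move: (u true a w) (u false a w) => p q; ring.
  by rewrite e1 e2 e3 e4 !mulrA.
transitivity (K w * (nu R s j * ((\sum_a cj true (w 0 a) * xi true a w A) * (\sum_b cj false (w 0 b) * xi false b w B)) +
   \sum_a nuj a * (xi true a w A * xi false a w B))).
  rewrite mulr_suml mulr_sumr -big_split mulr_sumr; apply: eq_bigr => a _ /=.
  rewrite mulr_sumr mulr_sumr.
  transitivity (K w * (\sum_b nu R s j * (cj true (w 0 a) * xi true a w A * (cj false (w 0 b) * xi false b w B)) +
     \sum_b (nuj a * (xi true a w A * xi false b w B)) * (b == a)%:R)); last first.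
    congr (_ * (_ + _)); rewrite (bigD1 a) //= eqxx mulr1 big1 ?addr0 // => b /negbTE ->.
    exact: mulr0.
  rewrite -big_split mulr_sumr; apply: eq_bigr => b _ /=; rewrite hhE // [a == b]eq_sym.
  by move: (xi true a w A) (xi false b w B) (K w) => p q k; ring.
rewrite S1 S2 S3 -/zA -/zB.
(* Everything in excess of P carries the factor nu_j^2 - 1 = 0. *)
transitivity (K w * nu R s A * (A == B)%:R - zA * zB +
  (nu R s j * nu R s j - 1) * (nu R s j * zA * zB / K w - (A == j)%:R * zB - zA * (B == j)%:R)).
  by move: (K w) K0 => k k0; field.
by rewrite nu_sqr subrr mul0r addr0.
Qed.

Definition pairT r f g w : C := \sum_(A : {ffun 'I_r -> 'I_n}) \sum_(B : {ffun 'I_r -> 'I_n})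
  (\prod_(i < r) hh w (A i) (B i)) * tau true f (lst A) w * tau false g (lst B) w.

Lemma lst_ffun_cons r a (A : {ffun 'I_r -> 'I_n}) :
  lst [ffun i => if unlift ord0 i is Some i' then A i' else a] = a :: lst A.
Proof.
rewrite lst_cons ffunE unlift_none; congr (_ :: lst _).
by apply/ffunP => i; rewrite !ffunE liftK.
Qed.

Lemma prod_cons (h : 'I_n -> 'I_n -> C) r a b (A B : {ffun 'I_r -> 'I_n}) :
  \prod_(i < r.+1) h ([ffun i => if unlift ord0 i is Some i' then A i' else a] i)
    ([ffun i => if unlift ord0 i is Some i' then B i' else b] i) =
  h a b * \prod_(i < r) h (A i) (B i).
Proof.
rewrite big_ord_recl !ffunE unlift_none; congr (_ * _).
by apply: eq_bigr => i _; rewrite !ffunE liftK.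
Qed.

(** The heads of the two index lists meet in one factor [hh], which [hh_xi] turns into P; the tails
    form an instance for the derivatives [da A f] and [dh B g]. *)
Lemma pairT_cwick r f g w : D w -> pairT r f g w = cwick r f g (sec j w).
Proof.
move=> Dw; elim: r f g => [|r IH] f g.
  pose A0 : {ffun 'I_0 -> 'I_n} := [ffun i : 'I_0 => False_rect _ (notF (ltn_ord i))].
  have ff0 (F : {ffun 'I_0 -> 'I_n} -> C) : \sum_A F A = F A0.
    rewrite (bigD1 A0) //= big1 ?addr0 // => A /eqP hA; case: hA.
    by apply/ffunP => -[].
  rewrite /pairT cwick0E // !ff0 big_ord0 mul1r /lst (size0nil (size_enum_ord 0)) //.
rewrite cwickSE //.
transitivity (\sum_A \sum_B (\sum_a \sum_b hh w a b * (xi true a w A * xi false b w B)) *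
  pairT r (da A f) (dh B g) w); last first.
  by apply: eq_bigr => A _; apply: eq_bigr => B _; rewrite hh_xi // IH.
pose P (A B : {ffun 'I_r -> 'I_n}) := \prod_(i < r) hh w (A i) (B i).
have E a b : \sum_A \sum_B P A B * tau true f (a :: lst A) w * tau false g (b :: lst B) w =
    \sum_A0 \sum_B0 xi true a w A0 * xi false b w B0 * pairT r (da A0 f) (dh B0 g) w.
  transitivity (\sum_A \sum_B \sum_A0 \sum_B0 xi true a w A0 * xi false b w B0 *
      (P A B * tau true (da A0 f) (lst A) w * tau false (dh B0 g) (lst B) w)).
    apply: eq_bigr => A _; apply: eq_bigr => B _.
    rewrite -[tau true f _ w]/(\sum_A0 xi true a w A0 * tau true (da A0 f) (lst A) w).
    rewrite -[tau false g _ w]/(\sum_B0 xi false b w B0 * tau false (dh B0 g) (lst B) w).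
    rewrite -mulrA mulr_suml mulr_sumr; apply: eq_bigr => A0 _.
    rewrite !mulr_sumr; apply: eq_bigr => B0 _.
    by move: (P A B) (tau true _ _ w) (tau false _ _ w) (xi true a w A0) (xi false b w B0) => p x y u v; ring.
  rewrite exchange4; apply: eq_bigr => A0 _; apply: eq_bigr => B0 _.
  by rewrite /pairT mulr_sumr; apply: eq_bigr => A _; rewrite mulr_sumr.
transitivity (\sum_a \sum_b \sum_A \sum_B hh w a b * (P A B * tau true f (a :: lst A) w * tau false g (b :: lst B) w)).
  rewrite /pairT big_ffun_cons; apply: eq_bigr => a _.
  rewrite [RHS]exchange_big; apply: eq_bigr => A _.
  rewrite big_ffun_cons; apply: eq_bigr => b _; apply: eq_bigr => B _.
  rewrite prod_cons !lst_ffun_cons -/(P A B).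
  by move: (P A B) (tau true _ _ w) (tau false _ _ w) (hh w a b) => p x y h; ring.
transitivity (\sum_a \sum_b \sum_A \sum_B hh w a b * (xi true a w A * xi false b w B) *
    pairT r (da A f) (dh B g) w).
  apply: eq_bigr => a _; apply: eq_bigr => b _.
  transitivity (hh w a b * \sum_A \sum_B P A B * tau true f (a :: lst A) w * tau false g (b :: lst B) w).
    by rewrite mulr_sumr; apply: eq_bigr => A _; rewrite mulr_sumr.
  rewrite E mulr_sumr; apply: eq_bigr => A _; rewrite mulr_sumr.
  by apply: eq_bigr => B _; rewrite !mulrA.
rewrite exchange4; apply: eq_bigr => A _; apply: eq_bigr => B _.
by rewrite mulr_suml; apply: eq_bigr => a _; rewrite mulr_suml.
Qed.

(** H_red has only components of type antiholomorphic by holomorphic, so the sums over all frame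
    indices collapse to the pure types, where [al] and [be] are known. *)
Lemma pairing_cwick r (al be : tensor R n r) F G w : D w ->
  (forall A, al w (ixf true A) = tau true F (lst A) w) ->
  (forall B, be w (ixf false B) = tau false G (lst B) w) ->
  pairing al be (Hred s j) w = cwick r F G (sec j w).
Proof.
move=> Dw eal ebe; rewrite -(pairT_cwick _ _ _ Dw) /pairing.
rewrite (@sum_ffun_ix R n true r) => [|A i k Aik]; last first.
  by rewrite big1 // => B _; rewrite (bigD1 i) //= Aik HredE // !mul0r.
apply: eq_bigr => A _; rewrite (@sum_ffun_ix R n false r) => [|B i k Bik]; last first.
  by rewrite (bigD1 i) //= Bik ffunE HredE // !mul0r.
apply: eq_bigr => B _.
refine (congr2 *%R (congr2 *%R _ (eal A)) (ebe B)).
by apply: eq_bigr => i _; rewrite !ffunE.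
Qed.

Lemma diff0_cwick (f g : Mred R n s -> C) F G w :
  (forall w, D w -> loc j f w = F (sec j w)) -> (forall w, D w -> loc j g w = G (sec j w)) ->
  proj_inv F -> proj_inv G -> D w ->
  pairing (diff0 (loc j f)) (diff0 (loc j g)) (Hred s j) w = cwick 1 F G (sec j w).
Proof.
have H t (f' : Mred R n s -> C) F' B : (forall w, D w -> loc j f' w = F' (sec j w)) ->
    \sum_A zz t A * dz t A F' = 0 -> D w -> diff0 (loc j f') w (ixf t B) = tau t F' (lst B) w.
  move=> fF eF Dw; rewrite /diff0 ffunE (eq_on_pd _ (@open_chart_img R n s j) fF Dw).
  rewrite lst_cons /lst (size0nil (size_enum_ord 0)).
  have eF0 : \sum_A zz t A * dz t A F' = - (0%:R * F') by rewrite eF mul0r oppr0.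
  have := pd_tau (B ord0) [::] Dw eF0; rewrite big_ord0 subr0 mul0r mul0r subr0 => <-.
  by [].
move=> fF gG [_ F2] [G1 _] Dw; apply: pairing_cwick => // B; exact: H.
Qed.

Variable Gam : 'I_n.+1 -> christoffel R n.
Hypothesis hGam : levi_civita s (gred R n s) Gam.

Lemma Dpairing_cwick r (f g : Mred R n s -> C) F G w :
  (forall w, D w -> loc j f w = F (sec j w)) -> (forall w, D w -> loc j g w = G (sec j w)) ->
  proj_inv F -> proj_inv G -> D w ->
  Dpairing Gam r f g j w = cwick r F G (sec j w).
Proof.
move=> fF gG [_ F2] [G1 _] Dw; apply: pairing_cwick => // B.
  exact (Dsym_tau hGam (t := true) fF F2 B Dw).
exact (Dsym_tau hGam (t := false) gG G1 B Dw).
Qed.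
End Pairing.

(** * The star product on the reduced manifold *)

Section Descent.
Variables (R : realType) (n s : nat).
Local Notation C := (Cplx R).
Local Notation M := (Mred R n s).
Local Notation S := (conefun R n s).
Local Notation Jpos := (@Jpos R n s).
Implicit Types (f g h : M -> C) (F G H : S) (p : M).

(** The pullback as an element of the ring of cone functions, with default 0 when f is not smooth;
    hence the hypothesis of [hatSE]. *)
Definition hatS f : S := insubd (0 : S) (hat f).
Definition cone_inv F : Prop := forall (c : C) z, c != 0 -> Jpos z -> F (c *: z) = F z.
Definition descend F : M -> C := fun p => F (lift_pt p).

Lemma hatSE f z : smoothM f -> hatS f z = hat f z.
Proof.
move=> sf; have P : smooth_pred s (hat f).
  by apply/asboolP; split; [exact: smooth_hat|exact: hat_out].
by rewrite -[LHS]/(val (hatS f) z) val_insubd P.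
Qed.

Lemma hatS_inv f : smoothM f -> cone_inv (hatS f).
Proof. by move=> sf c z c0 _; rewrite !hatSE // hat_scale. Qed.
Lemma descend_smooth F : cone_inv F -> smoothM (descend F).
Proof. move=> iF; exact: (smoothM_of iF (conefun_smooth F)). Qed.
Lemma hatS_descend F : cone_inv F -> hatS (descend F) = F.
Proof.
move=> iF; apply: conefun_eq => z Jz; rewrite hatSE; last exact: descend_smooth.
exact: hat_of.
Qed.
Lemma descend_hatS f : smoothM f -> descend (hatS f) = f.
Proof. by move=> sf; apply/funext => p; rewrite /descend hatSE // hat_lift_pt. Qed.
Lemma loc_descend F j w : cone_inv F -> chart_img s j w -> loc j (descend F) w = F (sec j w).
Proof. by move=> iF Dw; rewrite loc_hat (hat_of iF). Qed.
Lemma loc_hatS f j w : smoothM f -> loc j f w = hatS f (sec j w).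
Proof. by move=> sf; rewrite hatSE. Qed.
Lemma hatS_proj f : smoothM f -> proj_inv (hatS f).
Proof. by move=> sf; apply: scale_inv_proj_inv; exact: hatS_inv. Qed.

Lemma descendD F G : descend (F + G) = fun p => descend F p + descend G p.
Proof. by apply/funext => p; rewrite /descend conefunD //; exact: Jpos_lift_pt. Qed.
Lemma descendN F : descend (- F) = fun p => - descend F p.
Proof. by apply/funext => p; rewrite /descend conefunN //; exact: Jpos_lift_pt. Qed.
Lemma descendM F G : descend (F * G) = fun p => descend F p * descend G p.
Proof. by apply/funext => p; rewrite /descend conefunM //; exact: Jpos_lift_pt. Qed.
Lemma descend_cst c : descend (scst c) = fun=> c.
Proof. by apply/funext => p; rewrite /descend scstE //; exact: Jpos_lift_pt. Qed.
Lemma descend_sum (I : Type) (r : seq I) (P : pred I) (F : I -> S) :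
  descend (\sum_(i <- r | P i) F i) = fun p => \sum_(i <- r | P i) descend (F i) p.
Proof. by apply/funext => p; rewrite /descend conefun_sum //; exact: Jpos_lift_pt. Qed.

Lemma inv_cst c : cone_inv (scst c).
Proof. by move=> k z k0 Jz; rewrite !scstE //; exact/Jpos_scale. Qed.
Lemma invD F G : cone_inv F -> cone_inv G -> cone_inv (F + G).
Proof.
by move=> iF iG k z k0 Jz; rewrite !conefunD ?iF ?iG //; exact/Jpos_scale.
Qed.
Lemma invN F : cone_inv F -> cone_inv (- F).
Proof. by move=> iF k z k0 Jz; rewrite !conefunN ?iF //; exact/Jpos_scale. Qed.
Lemma invM F G : cone_inv F -> cone_inv G -> cone_inv (F * G).
Proof.
by move=> iF iG k z k0 Jz; rewrite !conefunM ?iF ?iG //; exact/Jpos_scale.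
Qed.
Lemma inv_sum (I : Type) (r : seq I) (P : pred I) (F : I -> S) :
  (forall i, P i -> cone_inv (F i)) -> cone_inv (\sum_(i <- r | P i) F i).
Proof.
move=> iF k z k0 Jz; rewrite !conefun_sum //; last exact/Jpos_scale.
by apply: eq_bigr => i Pi; exact: iF.
Qed.
Lemma inv_cwick r F G : cone_inv F -> cone_inv G -> cone_inv (cwick r F G).
Proof.
move=> iF iG k z k0 Jz; apply/esym/(@cwick_scale R n s r k) => // x Jx; [by rewrite iF|by rewrite iG].
Qed.
Lemma inv_cstar m F G : cone_inv F -> cone_inv G -> cone_inv (cstar m F G).
Proof.
move=> iF iG; rewrite cstarE; apply: inv_sum => r _; apply: invM; first exact: inv_cst.
exact: inv_cwick.
Qed.

Lemma smoothM_cst c : smoothM (fun _ : M => c).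
Proof. by rewrite -(descend_cst c); apply: descend_smooth; exact: inv_cst. Qed.
Lemma hatS_cst c : hatS (fun _ : M => c) = scst c.
Proof. by rewrite -descend_cst hatS_descend //; exact: inv_cst. Qed.
Lemma hatSD f g : smoothM f -> smoothM g ->
  smoothM (fun p => f p + g p) /\ hatS (fun p => f p + g p) = hatS f + hatS g.
Proof.
move=> sf sg; have i := invD (hatS_inv sf) (hatS_inv sg).
have -> : (fun p => f p + g p) = descend (hatS f + hatS g) by rewrite descendD !descend_hatS.
by split; [exact: descend_smooth|exact: hatS_descend].
Qed.
Lemma hatSM f g : smoothM f -> smoothM g ->
  smoothM (fun p => f p * g p) /\ hatS (fun p => f p * g p) = hatS f * hatS g.
Proof.
move=> sf sg; have i := invM (hatS_inv sf) (hatS_inv sg).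
have -> : (fun p => f p * g p) = descend (hatS f * hatS g) by rewrite descendM !descend_hatS.
by split; [exact: descend_smooth|exact: hatS_descend].
Qed.
Lemma hatSZ c f : smoothM f ->
  smoothM (fun p => c * f p) /\ hatS (fun p => c * f p) = scst c * hatS f.
Proof. by move=> sf; have := hatSM (smoothM_cst c) sf; rewrite hatS_cst. Qed.

Variable Gam : 'I_n.+1 -> christoffel R n.
Hypothesis hGam : levi_civita s (gred R n s) Gam.

Lemma Dpairing_lift r f g j w : smoothM f -> smoothM g -> chart_img s j w ->
  Dpairing Gam r f g j w = cwick r (hatS f) (hatS g) (sec j w).
Proof.
move=> sf sg Dw; apply: (Dpairing_cwick hGam _ _ _ (hatS_proj sf) (hatS_proj sg) Dw) => x _;
  exact: loc_hatS.
Qed.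

Lemma Dpairing_independent r f g : smoothM f -> smoothM g ->
  chart_independent s (Dpairing Gam r f g).
Proof.
move=> sf sg; apply: (chart_independent_lift (inv_cwick r (hatS_inv sf) (hatS_inv sg))) => j w.
exact: Dpairing_lift.
Qed.

Definition starC m f g p : C :=
  \sum_(r < m.+1) (r`!%:R)^-1 * coef_red R r m * Defs.glue (Dpairing Gam r f g) p.

Lemma starCE m f g : smoothM f -> smoothM g -> starC m f g = descend (cstar m (hatS f) (hatS g)).
Proof.
move=> sf sg; rewrite cstarE descend_sum; apply/funext => p; apply: eq_bigr => r _.
rewrite descendM descend_cst; congr (_ * _).
rewrite (glue_lift (inv_cwick r (hatS_inv sf) (hatS_inv sg))) // => j w.
exact: Dpairing_lift.
Qed.

Lemma starC_smooth m f g : smoothM f -> smoothM g -> smoothM (starC m f g).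
Proof.
move=> sf sg; rewrite (starCE m sf sg).
exact: (descend_smooth (inv_cstar m (hatS_inv sf) (hatS_inv sg))).
Qed.

Definition brS F G : S := scst 'i^-1 * (cwick 1 F G - cwick 1 G F).

Lemma inv_brS F G : cone_inv F -> cone_inv G -> cone_inv (brS F G).
Proof.
move=> iF iG; apply: invM; first exact: inv_cst.
by apply: invD; [|apply: invN]; exact: inv_cwick.
Qed.

Lemma poissonE f g : smoothM f -> smoothM g ->
  poisson_red R n s f g = descend (brS (hatS f) (hatS g)).
Proof.
move=> sf sg; apply: (glue_lift (inv_brS (hatS_inv sf) (hatS_inv sg))) => j w Dw.
have E f' g' : smoothM f' -> smoothM g' ->
    pairing (diff0 (loc j f')) (diff0 (loc j g')) (Hred s j) w = cwick 1 (hatS f') (hatS g') (sec j w).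
  move=> sf' sg'; apply: (diff0_cwick _ _ (hatS_proj sf') (hatS_proj sg') Dw) => x _;
    exact: loc_hatS.
by rewrite (E _ _ sf sg) (E _ _ sg sf) (conefunM _ _ Dw) (scstE _ Dw) (conefunB _ _ Dw).
Qed.
Lemma poisson_smooth f g : smoothM f -> smoothM g -> smoothM (poisson_red R n s f g).
Proof.
move=> sf sg; rewrite (poissonE sf sg).
exact: (descend_smooth (inv_brS (hatS_inv sf) (hatS_inv sg))).
Qed.
Lemma hatS_poisson f g : smoothM f -> smoothM g ->
  hatS (poisson_red R n s f g) = brS (hatS f) (hatS g).
Proof.
move=> sf sg; rewrite (poissonE sf sg).
exact: (hatS_descend (inv_brS (hatS_inv sf) (hatS_inv sg))).
Qed.

Lemma cstar0E F G : cstar 0 F G = F * G.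
Proof. by rewrite cstarE big_ord1 cred0 rmorph1 mul1r. Qed.
Lemma cstar1E F G : cstar 1 F G = cwick 1 F G.
Proof.
by rewrite cstarE big_ord_recl big_ord1 cred01 rmorph0 mul0r add0r [cred _ _ _]cred11 rmorph1 mul1r.
Qed.

Lemma cwick1Mr F G H : cwick 1 F (G * H) = cwick 1 F G * H + G * cwick 1 F H.
Proof.
apply: conefun_eq => z Jz; rewrite conefunD // !conefunM // !cwickSE //.
rewrite mulr_suml mulr_sumr -big_split; apply: eq_bigr => A _.
rewrite [X in _ = X + _]mulr_suml mulr_sumr -big_split; apply: eq_bigr => B _; cbv beta.
rewrite !cwick0E // dhM conefunD // !conefunM //.
by move: (dh B G z) (dh B H z) (da A F z) => x y v; rewrite -[RHS]/(_ + _); ring.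
Qed.
Lemma cwick1Ml F G H : cwick 1 (F * G) H = F * cwick 1 G H + cwick 1 F H * G.
Proof.
apply: conefun_eq => z Jz; rewrite conefunD // !conefunM // !cwickSE //.
rewrite [X in _ = X + _]mulr_sumr mulr_suml -big_split; apply: eq_bigr => A _.
rewrite [X in _ = X + _]mulr_sumr mulr_suml -big_split; apply: eq_bigr => B _; cbv beta.
rewrite !cwick0E // daM conefunD // !conefunM //.
by move: (da A G z) (da A F z) (dh B H z) => x y v; rewrite -[RHS]/(_ + _); ring.
Qed.

Lemma cwick1B F G H : cwick 1 (F - G) H = cwick 1 F H - cwick 1 G H.
Proof. by rewrite -!cstar1E cstarDl -mulN1r -(rmorphN1 (@scst R n s)) cstarZl rmorphN1 mulN1r. Qed.
Lemma cwick1Br F G H : cwick 1 H (F - G) = cwick 1 H F - cwick 1 H G.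
Proof. by rewrite -!cstar1E cstarDr -mulN1r -(rmorphN1 (@scst R n s)) cstarZr rmorphN1 mulN1r. Qed.

(** Jacobi comes from associativity at order 2: in the alternating sum over the permutations of F,
    G, H the terms with [cstar 2] cancel by commutativity of the pointwise product. *)
Lemma cwick1_jacobi F G H : proj_inv F -> proj_inv G -> proj_inv H ->
  let b F G := cwick 1 F G - cwick 1 G F in
  b F (b G H) + b G (b H F) + b H (b F G) = 0.
Proof.
move=> pF pG pH b.
(* Associativity at order 2 solved for the right-nested product; substitution leaves left-nested
   products, which cancel against those of the double brackets. *)
have A2 (X Y Z : S) : proj_inv X -> proj_inv Y -> proj_inv Z ->
    cwick 1 X (cwick 1 Y Z) = cstar 2 X Y * Z + cwick 1 (cwick 1 X Y) Z + cstar 2 (X * Y) Z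
      - X * cstar 2 Y Z - cstar 2 X (Y * Z).
  move=> pX pY pZ; have := cstar_assoc 2 pX pY pZ.
  rewrite !big_ord_recl !big_ord0 !addr0 => e0.
  have : cstar 0 X (cstar 2 Y Z) + (cstar 1 X (cstar 1 Y Z) + cstar 2 X (cstar 0 Y Z)) =
    cstar 0 (cstar 2 X Y) Z + (cstar 1 (cstar 1 X Y) Z + cstar 2 (cstar 0 X Y) Z) := e0.
  rewrite !cstar0E !cstar1E => e.
  apply: (addIr (cstar 2 X (Y * Z))); rewrite subrK; apply: (addrI (X * cstar 2 Y Z)).
  rewrite [RHS]addrC subrK e; exact: addrA.
apply: conefun_eq => z Jz; rewrite conefun0 /b !(cwick1B, cwick1Br).
rewrite (A2 F G H) // (A2 G H F) // (A2 H F G) // (A2 F H G) // (A2 G F H) // (A2 H G F) //.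
rewrite [G * F]mulrC [H * F]mulrC [H * G]mulrC.
rewrite !(conefunD, conefunN, conefunM) //.
ring.
Qed.

Lemma poisson_red_bracket : is_poisson_bracket (poisson_red R n s).
Proof.
split.
- exact: poisson_smooth.
- move=> c f g h sf sg sh; have [scf ecf] := hatSZ c sf; have [sfg efg] := hatSD scf sg.
  rewrite !poissonE // efg ecf /brS -!cstar1E cstarDl cstarDr cstarZl cstarZr !cstar1E.
  set a := cwick _ _ _; set b := cwick _ _ _; set d := cwick _ _ _; set e := cwick _ _ _.
  apply/funext => p; have Jp := Jpos_lift_pt p.
  by rewrite /descend !(conefunM, conefunD, conefunN, scstE) //; ring.
- move=> f g sf sg; rewrite !poissonE // /brS -descendN -mulrN opprB //.
- move=> f g h sf sg sh; have [sgh egh] := hatSM sg sh.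
  rewrite !poissonE // egh /brS cwick1Mr cwick1Ml; apply/funext => p; have Jp := Jpos_lift_pt p.
  have eg : hatS g (lift_pt p) = g p by rewrite -[in RHS](descend_hatS sg).
  have eh : hatS h (lift_pt p) = h p by rewrite -[in RHS](descend_hatS sh).
  rewrite -eg -eh /descend.
  set a := cwick _ _ _; set b := cwick _ _ _; set d := cwick _ _ _; set e := cwick _ _ _.
  by rewrite !(conefunM, conefunD, conefunN, scstE) //; ring.
- move=> f g h sf sg sh p.
  have pf := hatS_proj sf; have pg := hatS_proj sg; have ph := hatS_proj sh.
  rewrite (poissonE sf (poisson_smooth sg sh)) (hatS_poisson sg sh).
  rewrite (poissonE sg (poisson_smooth sh sf)) (hatS_poisson sh sf).
  rewrite (poissonE sh (poisson_smooth sf sg)) (hatS_poisson sf sg).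
  have Jp := Jpos_lift_pt p.
  rewrite /descend -!conefunD //.
  have -> : brS (hatS f) (brS (hatS g) (hatS h)) + brS (hatS g) (brS (hatS h) (hatS f)) +
     brS (hatS h) (brS (hatS f) (hatS g)) = 0; last exact: conefun0.
  rewrite /brS -!cstar1E !cstarZr !cstarZl !cstar1E -!mulrBr -!mulrDr.
  by rewrite (cwick1_jacobi pf pg ph) !mulr0.
Qed.
End Descent.

(** * The coefficients as bidifferential operators *)

Section Combinations.
Variables (R : realType) (n : nat) (X A : Type) (U : set 'rV[Cplx R]_n)
  (ev : X -> A -> 'rV[Cplx R]_n -> Cplx R) (P : X -> bool) (OK : A -> Prop).
Local Notation C := (Cplx R).
Hypothesis oU : open U.

(** Coefficients and labels are chosen before the argument a, as for a differential operator; [ev]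
    will be a jet or a product of two jets, and [OK] smoothness. *)
Definition lincomb (T : A -> 'rV[C]_n -> C) : Prop :=
  exists (I : finType) (c : I -> 'rV[C]_n -> C) (k : I -> X),
    [/\ forall i, smooth_on U (c i), forall i, P (k i) &
        forall a, OK a -> forall w, U w -> T a w = \sum_i c i w * ev (k i) a w].

Lemma lincomb_eq T T' : (forall a, OK a -> forall w, U w -> T a w = T' a w) ->
  lincomb T' -> lincomb T.
Proof.
move=> e [I [c [k [sc Pk E]]]]; exists I, c, k; split=> // a oa w Uw.
by rewrite e // E.
Qed.

Lemma lincomb0 : lincomb (fun _ _ => 0).
Proof.
exists 'I_0, (fun _ _ => 0), (fun i : 'I_0 => False_rect _ (notF (ltn_ord i))).
by split=> [[]//|[]//|a _ w _]; rewrite big_ord0.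
Qed.

Lemma lincomb1 x : P x -> lincomb (ev x).
Proof.
move=> Px; exists unit, (fun _ _ => 1), (fun=> x); split=> // [_|a _ w _].
  exact: smooth_cst.
by rewrite (big_pred1 tt) ?mul1r // => -[].
Qed.

Lemma lincombD T T' : lincomb T -> lincomb T' -> lincomb (fun a w => T a w + T' a w).
Proof.
move=> [I [c [k [sc Pk E]]]] [I' [c' [k' [sc' Pk' E']]]].
exists (I + I')%type, (fun i => match i with inl i => c i | inr i => c' i end),
  (fun i => match i with inl i => k i | inr i => k' i end).
split=> [[i|i]|[i|i]|a oa w Uw]; [exact: sc|exact: sc'|exact: Pk|exact: Pk'|].
by rewrite big_sumType E // E'.
Qed.

Lemma lincombZ h T : smooth_on U h -> lincomb T -> lincomb (fun a w => h w * T a w).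
Proof.
move=> sh [I [c [k [sc Pk E]]]]; exists I, (fun i w => h w * c i w), k; split; [|exact: Pk|move=> a oa w Uw].
  by move=> i; exact: (smoothMul oU sh (sc i)).
by rewrite E // mulr_sumr; apply: eq_bigr => i _; rewrite mulrA.
Qed.

Lemma lincomb_sum (J : Type) (r : seq J) (T : J -> A -> 'rV[C]_n -> C) :
  (forall i, lincomb (T i)) -> lincomb (fun a w => \sum_(i <- r) T i a w).
Proof.
move=> HT; elim: r => [|i r IH].
  by apply: lincomb_eq lincomb0 => a _ w _; rewrite big_nil.
by apply: lincomb_eq (lincombD (HT i) IH) => a _ w _; rewrite big_cons.
Qed.
End Combinations.

Section Bidifferential.
Variables (R : realType) (n s : nat) (j : 'I_n.+1).
Local Notation C := (Cplx R).
Local Notation M := (Mred R n s).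
Local Notation D := (@chart_img R n s j).
Local Notation mi := (seq (idx n)).
Let oD : open D := @open_chart_img R n s j.

Definition jet (k : mi) (f : M -> C) : 'rV[C]_n -> C := foldr (@pd R n) (loc j f) k.
Definition dop N := lincomb D jet (fun k : mi => (size k <= N)%N) (@smoothM R n s).
Definition bdop N := lincomb D
  (fun (kl : mi * mi) (fg : (M -> C) * (M -> C)) w => jet kl.1 fg.1 w * jet kl.2 fg.2 w)
  (fun kl : mi * mi => (size kl.1 <= N)%N && (size kl.2 <= N)%N)
  (fun fg : (M -> C) * (M -> C) => smoothM fg.1 /\ smoothM fg.2).

Lemma smooth_jet k f : smoothM f -> smooth_on D (jet k f).
Proof. by move=> sf; elim: k => [|a k IH]; [exact: sf|exact: (smooth_pd a oD IH)]. Qed.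

Lemma dop_le N N' T : (N <= N')%N -> dop N T -> dop N' T.
Proof.
move=> NN [I [c [k [sc Pk E]]]]; exists I, c, k; split=> // i.
exact: leq_trans (Pk i) NN.
Qed.

Lemma dop_pd N a T : dop N T -> dop N.+1 (fun f => pd a (T f)).
Proof.
move=> [I [c [k [sc Pk E]]]].
exists (I * bool)%type, (fun i => if i.2 then c i.1 else pd a (c i.1)),
  (fun i => if i.2 then a :: k i.1 else k i.1).
split=> [[i []]|[i []]|f sf w Dw] /=; [exact: sc|exact: (smooth_pd a oD (sc i))|exact: Pk|exact: leqW (Pk i)|].
have H i := smoothMul oD (sc i) (smooth_jet (k i) sf).
rewrite (eq_on_pd a oD (E f sf) Dw) (pd_sum oD Dw _ _ (fun i _ => H i)).
rewrite -(pair_bigA _ (fun i b => (if b then c i else pd a (c i)) w * jet (if b then a :: k i else k i) f w)).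
apply: eq_bigr => i _; rewrite big_bool (pdM Dw _ (sc i) (smooth_jet (k i) sf)) addrC.
by [].
Qed.

(** [pd_tau] read backwards: [tau] on a list is a chart derivative of [tau] on a list shorter by
    one, plus terms with smooth coefficients on lists of that shorter length. *)
Lemma dop_tau t N (bs : seq 'I_n) : (size bs <= N)%N ->
  dop N (fun f => @tau R n s j t (hatS f) bs).
Proof.
move=> sN; apply: dop_le sN _; move: {2}(size bs) (erefl (size bs)) => r.
elim: r bs => [|r IH] [|a bs] // => [_|[sz]].
  have H := @lincomb1 R n mi (M -> C) D jet (fun k => (size k <= 0)%N) (@smoothM R n s) [::] isT.
  by refine (lincomb_eq _ H) => f sf w Dw; rewrite /jet /= (loc_hatS j w sf).
have H1 : dop r.+1 (fun f => @tau R n s j t (hatS f) bs).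
  by apply: (@dop_le r) => //; have := IH bs sz; rewrite sz.
have H2 i : (i < size bs)%N -> dop r.+1 (fun f => @tau R n s j t (hatS f) (set_nth a bs i a)).
  move=> isz; have e : size (set_nth a bs i a) = r.
    by rewrite size_set_nth sz; apply/maxn_idPr; rewrite -sz.
  by apply: (@dop_le r) => //; have := IH _ e; rewrite e.
have H3 : dop r.+1 (fun f => pd (ix t a) (@tau R n s j t (hatS f) bs)).
  by apply: dop_pd; have := IH bs sz; rewrite sz.
have su b := @smooth_uu R n s j t b.
have H4 : dop r.+1 (fun f w => \sum_(i < size bs) @uu R n s j t (nth a bs i) w * tau j t (hatS f) (set_nth a bs i a) w).
  apply: lincomb_sum => i; apply: (lincombZ oD (su _)); exact: H2.
have H5 := lincombD (lincombD H3 (lincombZ oD (smoothMul oD (@smooth_cst R n D (size bs)%:R) (su a)) H1)) H4.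
rewrite [size (a :: bs)]/= sz; apply: lincomb_eq H5 => f sf w Dw; cbv beta.
have [e1 e2] := hatS_proj sf.
have eF0 : \sum_A zz t A * dz t A (hatS f) = - (0%:R * hatS f).
  by rewrite mul0r oppr0; case: (t); [exact: e2|exact: e1].
rewrite (pd_tau a bs Dw eF0) add0n.
by move: (tau j t _ (a :: bs) w) (tau j t _ bs w) (\sum_(i < _) _) (uu s j t a w) => x y z v; ring.
Qed.

Lemma bdop_mul N T T' : dop N T -> dop N T' -> bdop N (fun fg w => T fg.1 w * T' fg.2 w).
Proof.
move=> [I [c [k [sc Pk E]]]] [I' [c' [k' [sc' Pk' E']]]].
exists (I * I')%type, (fun i w => c i.1 w * c' i.2 w), (fun i => (k i.1, k' i.2)).
split=> [i|i|[f g] [sf sg] w Dw] /=; [exact: (smoothMul oD)|by rewrite Pk Pk'|].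
rewrite (E f sf w Dw) (E' g sg w Dw) -(pair_bigA _ (fun i i' => c i w * c' i' w * (jet (k i) f w * jet (k' i') g w))).
rewrite mulr_suml; apply: eq_bigr => i _; rewrite mulr_sumr; apply: eq_bigr => i' _ /=.
by move: (jet _ _ w) (jet _ _ w) => x y; ring.
Qed.

Lemma smooth_hh a b : smooth_on D (fun w => hh s j w a b).
Proof.
have sx k : smooth_on D (fun w : 'rV[C]_n => w 0 k) := @smooth_coord R n D k.
have s1 := smoothMul oD (smooth_conj oD (sx a)) (sx b).
have s2 := smoothMul oD (@smooth_cst R n D (nu R s j)) s1.
have s3 := smoothD oD s2 (@smooth_cst R n D (nu R s (lift j a) * (a == b)%:R)).
have s4 := smoothMul oD (@smooth_K R n s j) s3.
by apply: (eq_on_smooth oD _ s4) => w Dw; rewrite hhE.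
Qed.

Lemma bdop_cwick r N : (r <= N)%N ->
  bdop N (fun fg w => cwick r (hatS fg.1) (hatS fg.2) (sec j w)).
Proof.
move=> rN.
pose P (A B : {ffun 'I_r -> 'I_n}) (w : 'rV[C]_n) : C := \prod_(i < r) hh s j w (A i) (B i).
have H : bdop N (fun fg w => \sum_(A : {ffun 'I_r -> 'I_n}) \sum_(B : {ffun 'I_r -> 'I_n})
    P A B w * (@tau R n s j true (hatS fg.1) (lst A) w * @tau R n s j false (hatS fg.2) (lst B) w)).
  refine (lincomb_sum _ (fun A => lincomb_sum _ (fun B => _))).
  have sz (A' : {ffun 'I_r -> 'I_n}) : (size (lst A') <= N)%N by rewrite size_lst.
  have sp : smooth_on D (P A B) by apply: (smooth_prod oD) => i _; exact: smooth_hh.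
  exact (lincombZ oD sp (bdop_mul (dop_tau true (sz A)) (dop_tau false (sz B)))).
refine (lincomb_eq _ H) => fg _ w Dw; rewrite -(pairT_cwick r _ _ Dw).
by apply: eq_bigr => A _; apply: eq_bigr => B _; rewrite mulrA.
Qed.

Lemma bdop_cstar m : bdop m (fun fg w => cstar m (hatS fg.1) (hatS fg.2) (sec j w)).
Proof.
have H : bdop m (fun fg w => \sum_(r < m.+1) cred R r m * cwick r (hatS fg.1) (hatS fg.2) (sec j w)).
  apply: lincomb_sum => r; apply: (lincombZ oD); first exact: smooth_cst.
  by apply: bdop_cwick; rewrite -ltnS.
apply: lincomb_eq H => fg _ w Dw; rewrite cstarE conefun_sum //.
by apply: eq_bigr => r _; rewrite conefunM // scstE.
Qed.

(** Puts a term labelled by an index sequence of length at most N into the sums over tuples used in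
    [bidifferential]. *)
Lemma sum_tuples N (F : mi -> C) (k : mi) : (size k <= N)%N ->
  \sum_(p < N.+1) \sum_(I : p.-tuple (idx n)) (if k == I then F I else 0) = F k.
Proof.
move=> kN; rewrite (bigD1 (Ordinal (kN : (size k < N.+1)%N))) //= (bigD1 (in_tuple k)) //= eqxx.
rewrite [X in _ + X + _]big1 => [|I hI]; last first.
  by case: eqP => // kI; case/eqP: hI; apply: val_inj.
rewrite big1 ?addr0 // => p hp; rewrite big1 // => I _; case: eqP => // kI.
by case/eqP: hp; apply: val_inj; rewrite /= kI size_tuple.
Qed.

Lemma bdop_expand N T : bdop N T -> exists c : mi -> mi -> 'rV[C]_n -> C,
  (forall I K, smooth_on D (c I K)) /\
  forall f g, smoothM f -> smoothM g -> forall w, D w -> T (f, g) w =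
    \sum_(p < N.+1) \sum_(q < N.+1) \sum_(I : p.-tuple (idx n)) \sum_(K : q.-tuple (idx n))
      c I K w * foldr (@pd R n) (loc j f) I w * foldr (@pd R n) (loc j g) K w.
Proof.
move=> [I0 [c [k [sc Pk E]]]].
exists (fun I K w => \sum_(i | ((k i).1 == I) && ((k i).2 == K)) c i w); split.
  by move=> I K; apply: (smooth_sum oD) => i _; exact: sc.
move=> f g sf sg w Dw; rewrite (E (f, g) (conj sf sg) w Dw).
pose G i (I K : mi) := c i w * (jet I f w * jet K g w).
transitivity (\sum_(p < N.+1) \sum_(q < N.+1) \sum_(I : p.-tuple (idx n)) \sum_(K : q.-tuple (idx n))
   \sum_i (if (k i).1 == I then if (k i).2 == K then G i I K else 0 else 0)).
  transitivity (\sum_i \sum_(p < N.+1) \sum_(q < N.+1) \sum_(I : p.-tuple (idx n)) \sum_(K : q.-tuple (idx n))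
     (if (k i).1 == I then if (k i).2 == K then G i I K else 0 else 0)).
    apply: eq_bigr => i _; have /andP[k1 k2] := Pk i.
    rewrite -[LHS]/(G i (k i).1 (k i).2) -(sum_tuples (fun I => G i I (k i).2) k1).
    apply: eq_bigr => p _; rewrite exchange_big /=; apply: eq_bigr => I _.
    case: eqP => [_|_]; last by rewrite big1 // => q _; rewrite big1.
    by rewrite (sum_tuples (G i I) k2).
  rewrite exchange_big; apply: eq_bigr => p _; rewrite exchange_big; apply: eq_bigr => q _.
  by rewrite exchange_big; apply: eq_bigr => I _; rewrite exchange_big.
apply: eq_bigr => p _; apply: eq_bigr => q _; apply: eq_bigr => I _; apply: eq_bigr => K _.
rewrite -mulrA mulr_suml [RHS]big_mkcond; apply: eq_bigr => i _.
by case: eqP => //= _; case: eqP.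
Qed.
End Bidifferential.

(** * Bilinear extension to formal series *)

Section Extension.
Variables (R : realType) (n s : nat).
Local Notation C := (Cplx R).
Local Notation S := (conefun R n s).
Implicit Types (a b c : nat -> S).

Definition cext a b m : S :=
  \sum_(i < m.+1) \sum_(j < m.+1 | (i + j <= m)%N) cstar (m - (i + j)) (a i) (b j).

Lemma sum_pick (V : nmodType) N k m (F : nat -> V) : (m < N)%N ->
  \sum_(e < N | (k + e)%N == m) F e = if (k <= m)%N then F (m - k)%N else 0.
Proof.
move=> mN; case: leqP => km.
  rewrite (big_pred1 (Ordinal (leq_ltn_trans (leq_subr k m) mN))) // => e /=.
  by rewrite -val_eqE /= -{1}(subnKC km) eqn_add2l.
by rewrite big_pred0 // => e; rewrite gtn_eqF // (leq_trans km) // leq_addr.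
Qed.

(** With one common range N and the orders tied by a single equation, the sums can be exchanged
    freely. *)
Lemma cextE N a b m : (m < N)%N ->
  cext a b m = \sum_(i < N) \sum_(j < N) \sum_(e < N | (i + j + e)%N == m) cstar e (a i) (b j).
Proof.
move=> mN.
rewrite /cext (big_ord_widen _ (fun i => \sum_(j < m.+1 | (i + j <= m)%N) cstar (m - (i + j)) (a i) (b j)) mN).
rewrite big_mkcond; apply: eq_bigr => i _.
rewrite (eq_bigr (fun j : 'I_N => if (i + j <= m)%N then cstar (m - (i + j)) (a i) (b j) else 0)); last first.
  by move=> j _; exact: (sum_pick _ (fun e => cstar e (a i) (b j)) mN).
rewrite -big_mkcond; case: ltnP => im; last first.
  by rewrite big_pred0 // => j; rewrite leqNgt (leq_trans im) // leq_addr.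
rewrite (big_ord_widen_cond _ (fun j => (i + j <= m)%N) (fun j => cstar (m - (i + j)) (a i) (b j)) mN).
by apply: eq_bigl => j; rewrite ltnS; case: leqP => //= /(leq_trans (leq_addl i j)).
Qed.

Lemma cstar_suml m (I : finType) (P : pred I) (F : I -> S) g :
  cstar m (\sum_(i | P i) F i) g = \sum_(i | P i) cstar m (F i) g.
Proof.
apply: (big_morph (fun f => cstar m f g)) => [x y|]; first exact: cstarDl.
by have := cstarZl m 0 0 g; rewrite rmorph0 !mul0r.
Qed.
Lemma cstar_sumr m (I : finType) (P : pred I) (F : I -> S) g :
  cstar m g (\sum_(i | P i) F i) = \sum_(i | P i) cstar m g (F i).
Proof.
apply: (big_morph (fun f => cstar m g f)) => [x y|]; first exact: cstarDr.
by have := cstarZr m 0 g 0; rewrite rmorph0 !mul0r.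
Qed.

Lemma sum_diag (V : nmodType) N k m (X : nat -> nat -> V) : (m < N)%N ->
  \sum_(d < N) \sum_(e < N | (k + d + e)%N == m) X e d =
  if (k <= m)%N then \sum_(e < (m - k).+1) X e (m - k - e)%N else 0.
Proof.
move=> mN; rewrite (exchange_big_dep xpredT) //=.
under eq_bigr => e _.
  rewrite (eq_bigl (fun d : 'I_N => (k + e + d)%N == m)) => [|d]; last by rewrite addnAC.
  rewrite (sum_pick _ (X e) mN); over.
case: leqP => km; last first.
  by rewrite big1 // => e _; rewrite leqNgt (leq_trans km) // leq_addr.
rewrite (@big_ord_widen _ _ _ _ N (fun e => X e (m - k - e)%N)); last first.
  by rewrite (leq_ltn_trans _ mN) // leq_subr.
rewrite [RHS]big_mkcond; apply: eq_bigr => e _.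
by rewrite ltnS leq_subRL // subnDA.
Qed.

Lemma exchange33 (V : nmodType) (I J K I' J' K' : finType) (F : I -> J -> K -> I' -> J' -> K' -> V) :
  \sum_i \sum_j \sum_k \sum_i' \sum_j' \sum_k' F i j k i' j' k' =
  \sum_i' \sum_j' \sum_k' \sum_i \sum_j \sum_k F i j k i' j' k'.
Proof.
have E (A B D : finType) (X : A -> B -> D -> V) :
    \sum_x \sum_y \sum_z X x y z = \sum_(p : A * (B * D)) X p.1 p.2.1 p.2.2.
  rewrite -(pair_bigA _ (fun x q => X x q.1 q.2)); apply: eq_bigr => x _.
  exact: (pair_bigA _ (fun y z => X x y z)).
rewrite [LHS]E [RHS]E; under eq_bigr do rewrite E; under [RHS]eq_bigr do rewrite E.
exact: exchange_big.
Qed.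

(** The order i of the inner product is determined by k, l and d, so its sum disappears and only the
    total order remains constrained. *)
Lemma sum_assoc (V : nmodType) N m (G : 'I_N -> 'I_N -> nat -> 'I_N -> nat -> V) : (m < N)%N ->
  \sum_(i < N) \sum_(j < N) \sum_(e < N | (i + j + e)%N == m)
    \sum_(k < N) \sum_(l < N) \sum_(d < N | (k + l + d)%N == i) G k l d j e =
  \sum_(k < N) \sum_(l < N) \sum_(j < N)
    \sum_(d < N) \sum_(e < N | (k + l + j + d + e)%N == m) G k l d j e.
Proof.
move=> mN.
transitivity (\sum_(k < N) \sum_(l < N) \sum_(j < N) \sum_(d < N) \sum_(e < N) \sum_(i < N)
   (if ((i + j + e)%N == m) && ((k + l + d)%N == i) then G k l d j e else 0)).
  pose F (i j e k l d : 'I_N) :=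
    if ((i + j + e)%N == m) && ((k + l + d)%N == i) then G k l d j e else 0.
  transitivity (\sum_i \sum_j \sum_e \sum_k \sum_l \sum_d F i j e k l d).
    apply: eq_bigr => i _; apply: eq_bigr => j _; rewrite big_mkcond; apply: eq_bigr => e _.
    rewrite /F; case: eqP => _ /=; last by rewrite big1 // => k _; rewrite big1 // => l _; rewrite big1.
    by apply: eq_bigr => k _; apply: eq_bigr => l _; rewrite big_mkcond.
  rewrite exchange33; apply: eq_bigr => k _; apply: eq_bigr => l _.
  rewrite [RHS]exchange_big; apply: eq_bigr => d _ /=.
  rewrite exchange_big; apply: eq_bigr => j _; exact: exchange_big.
apply: eq_bigr => k _; apply: eq_bigr => l _; apply: eq_bigr => j _; apply: eq_bigr => d _.
rewrite [RHS]big_mkcond; apply: eq_bigr => e _; rewrite -big_mkcond.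
have -> : (k + l + j + d + e = k + l + d + j + e)%N by rewrite [(k + l + j + d)%N]addnAC.
case: eqP => [km|km]; last first.
  by rewrite big_pred0 // => i; apply/negbTE/negP => /andP[/eqP e1 /eqP e2]; apply: km; rewrite e2.
have iN : (k + l + d < N)%N by rewrite (leq_ltn_trans _ mN) // -km -[(_ + j + e)%N]addnA leq_addr.
rewrite (big_pred1 (Ordinal iN)) // => i /=; rewrite -[RHS]val_eqE /= [RHS]eq_sym.
by case: (eqVneq _ (i : nat)) => [<-|_]; rewrite ?km ?eqxx ?andbF.
Qed.

(** For fixed orders of the three entries, the sum over the orders d and e of the two products is
    [cstar_assoc] at the remaining order. *)
Lemma cext_assoc a b c : (forall m, proj_inv (a m)) -> (forall m, proj_inv (b m)) ->
  (forall m, proj_inv (c m)) -> cext (cext a b) c = cext a (cext b c).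
Proof.
move=> pa pb pc; apply/funext => m; rewrite !(@cextE m.+1) //.
pose GL (k l : 'I_m.+1) (d : nat) (j : 'I_m.+1) (e : nat) := cstar e (cstar d (a k) (b l)) (c j).
pose GR (k l : 'I_m.+1) (d : nat) (j : 'I_m.+1) (e : nat) := cstar e (a j) (cstar d (b k) (c l)).
transitivity (\sum_(i < m.+1) \sum_(j < m.+1) \sum_(e < m.+1 | (i + j + e)%N == m)
    \sum_(k < m.+1) \sum_(l < m.+1) \sum_(d < m.+1 | (k + l + d)%N == i) GL k l d j e).
  apply: eq_bigr => i _; apply: eq_bigr => j _; apply: eq_bigr => e _.
  rewrite (@cextE m.+1) // cstar_suml; apply: eq_bigr => k _.
  rewrite cstar_suml; apply: eq_bigr => l _; exact: cstar_suml.
transitivity (\sum_(i < m.+1) \sum_(j < m.+1) \sum_(e < m.+1 | (i + j + e)%N == m)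
    \sum_(k < m.+1) \sum_(l < m.+1) \sum_(d < m.+1 | (k + l + d)%N == i) GR k l d j e); last first.
  rewrite exchange_big; apply: eq_bigr => i _; apply: eq_bigr => j _ /=.
  apply: eq_big => [e|e _]; first by rewrite [(i + j)%N]addnC.
  rewrite (@cextE m.+1) // cstar_sumr; apply: eq_bigr => k _.
  rewrite cstar_sumr; apply: eq_bigr => l _; apply/esym; exact: cstar_sumr.
rewrite !sum_assoc //.
transitivity (\sum_(k < m.+1) \sum_(l < m.+1) \sum_(j < m.+1)
   \sum_(d < m.+1) \sum_(e < m.+1 | (l + j + k + d + e)%N == m) GR l j d k e); last first.
  rewrite exchange_big; apply: eq_bigr => l _; rewrite exchange_big; exact: erefl.
apply: eq_bigr => k _; apply: eq_bigr => l _; apply: eq_bigr => j _.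
have -> : (l + j + k = k + l + j)%N by rewrite addnC addnA.
rewrite (sum_diag _ (fun e d => GL k l d j e)) // (sum_diag _ (fun e d => GR l j d k e)) //.
by case: leqP => // kl; rewrite /GL /GR cstar_assoc.
Qed.

Lemma cextDl a b c m : cext (fun i => a i + b i) c m = cext a c m + cext b c m.
Proof.
rewrite -big_split; apply: eq_bigr => i _; rewrite -big_split; apply: eq_bigr => j _.
exact: cstarDl.
Qed.
Lemma cextDr a b c m : cext c (fun i => a i + b i) m = cext c a m + cext c b m.
Proof.
rewrite -big_split; apply: eq_bigr => i _; rewrite -big_split; apply: eq_bigr => j _.
exact: cstarDr.
Qed.

(** Against a constant only order 0 of the product survives, which forces j = m - i. *)
Lemma cext_cst_aux (k : nat -> C) (f : nat -> S) m (B : nat -> C -> S -> S) :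
  (forall e x g, B e x g = if e is 0%N then scst x * g else 0) ->
  \sum_(i < m.+1) \sum_(j < m.+1 | (i + j <= m)%N) B (m - (i + j))%N (k i) (f j) =
  \sum_(i < m.+1) scst (k i) * f (m - i)%N.
Proof.
move=> HB; apply: eq_bigr => i _.
have im : (m - i < m.+1)%N by rewrite ltnS leq_subr.
rewrite (bigD1 (Ordinal im)) /=; last by rewrite subnKC // -ltnS.
rewrite subnKC ?subnn; last by rewrite -ltnS.
rewrite HB big1 ?addr0 // => j /andP[ij jm]; rewrite HB.
case E: (m - (i + j))%N => [|//]; case/eqP: jm; apply: val_inj => /=.
by move/eqP: E; rewrite subn_eq0 => E; rewrite -(addKn i j); congr (_ - _)%N; apply/eqP; rewrite eqn_leq ij.
Qed.

Lemma cext_cstl (k : nat -> C) f m :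
  cext (fun i => scst (k i)) f m = \sum_(i < m.+1) scst (k i) * f (m - i)%N.
Proof.
apply: (@cext_cst_aux k f m (fun e x g => cstar e (scst x) g)) => e x g.
by rewrite -[scst x]mulr1 cstarZl cstar1l mulr1; case: e => // e; rewrite mulr0.
Qed.
Lemma cext_cstr (k : nat -> C) f m :
  cext f (fun i => scst (k i)) m = \sum_(i < m.+1) scst (k i) * f (m - i)%N.
Proof.
rewrite -(@cext_cst_aux k f m (fun e x g => cstar e g (scst x))) => [|e x g]; last first.
  by rewrite -[scst x]mulr1 cstarZr cstar1r mulr1; case: e => // e; rewrite mulr0.
rewrite /cext (exchange_big_dep xpredT) //=; apply: eq_bigr => i _; apply: eq_big => [j|j _];
  by rewrite [(j + i)%N]addnC.
Qed.
End Extension.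

(** * The formal star product on M_red *)

Section Star.
Variables (R : realType) (n s : nat).
Local Notation C := (Cplx R).
Local Notation M := (Mred R n s).
Local Notation S := (conefun R n s).
Implicit Types (F G K : fps (M -> C)).
Variable Gam : 'I_n.+1 -> christoffel R n.
Hypothesis hGam : levi_civita s (gred R n s) Gam.
Local Notation star := (star_red R n s Gam).

Definition hatF F : nat -> S := fun m => hatS (F m).

Lemma hatF_proj F : smooth_fps F -> forall m, proj_inv (hatF F m).
Proof. by move=> sF m; exact: hatS_proj (sF m). Qed.

Lemma hatF_inj F G : smooth_fps F -> smooth_fps G -> hatF F = hatF G -> F = G.
Proof.
move=> sF sG e; apply/funext => m.
by rewrite -(descend_hatS (sF m)) -(descend_hatS (sG m)) -[hatS (F m)]/(hatF F m) e.
Qed.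

Lemma cext_inv (a b : nat -> S) m : (forall i, cone_inv (a i)) -> (forall i, cone_inv (b i)) ->
  cone_inv (cext a b m).
Proof.
move=> ia ib; apply: inv_sum => i _; apply: inv_sum => j _; exact: (inv_cstar _ (ia i) (ib j)).
Qed.

Lemma starE F G m : smooth_fps F -> smooth_fps G -> star F G m = descend (cext (hatF F) (hatF G) m).
Proof.
move=> sF sG; rewrite /cext descend_sum; apply/funext => p; apply: eq_bigr => i _.
rewrite descend_sum; apply: eq_bigr => j _.
by rewrite -(starCE hGam (m - (i + j)) (sF i) (sG j)).
Qed.

Lemma star_smooth F G : smooth_fps F -> smooth_fps G -> smooth_fps (star F G).
Proof.
move=> sF sG m; rewrite (starE m sF sG); apply: descend_smooth.
by apply: cext_inv => i; apply: hatS_inv.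
Qed.

Lemma hatF_star F G : smooth_fps F -> smooth_fps G -> hatF (star F G) = cext (hatF F) (hatF G).
Proof.
move=> sF sG; apply/funext => m; rewrite /hatF (starE m sF sG); apply: hatS_descend.
by apply: cext_inv => i; apply: hatS_inv.
Qed.

Lemma star_assoc F G K : smooth_fps F -> smooth_fps G -> smooth_fps K ->
  star (star F G) K = star F (star G K).
Proof.
move=> sF sG sK; have sFG := star_smooth sF sG; have sGK := star_smooth sG sK.
apply: (hatF_inj (star_smooth sFG sK) (star_smooth sF sGK)).
rewrite (hatF_star sFG sK) (hatF_star sF sGK) (hatF_star sF sG) (hatF_star sG sK).
exact: (cext_assoc (hatF_proj sF) (hatF_proj sG) (hatF_proj sK)).
Qed.

Lemma smooth_addM F G : smooth_fps F -> smooth_fps G -> smooth_fps (fps_addM F G).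
Proof. by move=> sF sG m; exact: (hatSD (sF m) (sG m)).1. Qed.
Lemma hatF_addM F G : smooth_fps F -> smooth_fps G ->
  hatF (fps_addM F G) = fun m => hatF F m + hatF G m.
Proof. by move=> sF sG; apply/funext => m; exact: (hatSD (sF m) (sG m)).2. Qed.

Lemma starDl F G K : smooth_fps F -> smooth_fps G -> smooth_fps K ->
  star (fps_addM F G) K = fps_addM (star F K) (star G K).
Proof.
move=> sF sG sK; have sFG := smooth_addM sF sG; apply/funext => m.
rewrite (starE m sFG sK) (hatF_addM sF sG) cextDl descendD /fps_addM.
by rewrite (starE m sF sK) (starE m sG sK).
Qed.
Lemma starDr F G K : smooth_fps F -> smooth_fps G -> smooth_fps K ->
  star K (fps_addM F G) = fps_addM (star K F) (star K G).
Proof.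
move=> sF sG sK; have sFG := smooth_addM sF sG; apply/funext => m.
rewrite (starE m sK sFG) (hatF_addM sF sG) cextDr descendD /fps_addM.
by rewrite (starE m sK sF) (starE m sK sG).
Qed.

(** Scalars of C[[lambda]] as series of constant functions: by [star_cstl] and [star_cstr] scaling
    becomes a star product, so linearity over C[[lambda]] follows from associativity. *)
Definition fps_cst (a : fps C) : fps (M -> C) := fun m _ => a m.

Lemma smooth_fps_cst a : smooth_fps (fps_cst a).
Proof. by move=> m; exact: smoothM_cst. Qed.
Lemma hatF_cst a : hatF (fps_cst a) = fun m => scst (a m).
Proof. by apply/funext => m; exact: hatS_cst. Qed.

Lemma star_cstl a F : smooth_fps F -> star (fps_cst a) F = fps_scaleM a F.
Proof.
move=> sF; apply/funext => m; rewrite (starE m (smooth_fps_cst a) sF) hatF_cst cext_cstl.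
rewrite descend_sum; apply/funext => p; apply: eq_bigr => i _.
by rewrite descendM descend_cst (descend_hatS (sF _)).
Qed.
Lemma star_cstr a F : smooth_fps F -> star F (fps_cst a) = fps_scaleM a F.
Proof.
move=> sF; apply/funext => m; rewrite (starE m sF (smooth_fps_cst a)) hatF_cst cext_cstr.
rewrite descend_sum; apply/funext => p; apply: eq_bigr => i _.
by rewrite descendM descend_cst (descend_hatS (sF _)).
Qed.

Lemma smooth_scaleM a F : smooth_fps F -> smooth_fps (fps_scaleM a F).
Proof.
by move=> sF; rewrite -(star_cstl a sF); exact: (star_smooth (smooth_fps_cst a) sF).
Qed.

Lemma star_scalel a F K : smooth_fps F -> smooth_fps K ->
  star (fps_scaleM a F) K = fps_scaleM a (star F K).
Proof.
move=> sF sK; have sa := smooth_fps_cst a.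
by rewrite -(star_cstl a sF) (star_assoc sa sF sK) (star_cstl a (star_smooth sF sK)).
Qed.
Lemma star_scaler a F K : smooth_fps F -> smooth_fps K ->
  star K (fps_scaleM a F) = fps_scaleM a (star K F).
Proof.
move=> sF sK; have sa := smooth_fps_cst a.
by rewrite -(star_cstr a sF) -(star_assoc sK sF sa) (star_cstr a (star_smooth sK sF)).
Qed.

Lemma fps_scaleM1 F : fps_scaleM (fps_one R) F = F.
Proof.
apply/funext => m; apply/funext => p; rewrite /fps_scaleM big_ord_recl subn0 mul1r.
by rewrite big1 ?addr0 // => i _; rewrite mul0r.
Qed.
Lemma fps_const1 : fps_const (fun _ : M => 1) = fps_cst (fps_one R).
Proof. by apply/funext => -[|m]. Qed.

Lemma starC_bidifferential m : @bidifferential R n s (starC Gam m).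
Proof.
split=> [f g sf sg|j]; first exact: (starC_smooth hGam m sf sg).
have [c [sc E]] := bdop_expand (@bdop_cstar R n s j m).
exists m, c; split=> // f g sf sg w Dw; rewrite -(E f g sf sg w Dw) (starCE hGam m sf sg).
exact: (loc_descend (inv_cstar m (hatS_inv sf) (hatS_inv sg)) Dw).
Qed.

Lemma star_red_formal : is_formal_star_product (poisson_red R n s) star.
Proof.
split.
- exact: poisson_red_bracket.
- exact: star_assoc.
- move=> a F G K sF sG sK; have saF := smooth_scaleM a sF.
  by rewrite (starDl saF sG sK) (starDr saF sG sK) (star_scalel a sF sK) (star_scaler a sF sK).
- by move=> F sF; rewrite fps_const1 (star_cstl _ sF) (star_cstr _ sF) fps_scaleM1.
- exists (starC Gam); split.
  + exact: starC_bidifferential.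
  + by [].
  + move=> f g sf sg; rewrite (starCE hGam 0 sf sg) cstar0E descendM.
    by rewrite (descend_hatS sf) (descend_hatS sg).
  + move=> f g sf sg p; rewrite (starCE hGam 1 sf sg) (starCE hGam 1 sg sf) !cstar1E.
    rewrite (poissonE sf sg) /brS descendM descend_cst descendD descendN.
    by rewrite mulVKf // neq0Ci.
Qed.
End Star.

Theorem theoremI (R : realType) (n s : nat)
    (hn : (1 <= n)%N) (hs1 : (1 <= s)%N) (hs2 : (s <= n.+1)%N)
    (Gam : 'I_n.+1 -> christoffel R n)
    (hGam : levi_civita s (gred R n s) Gam) :
  (forall (r : nat) (f g : Mred R n s -> Cplx R), smoothM f -> smoothM g ->
     chart_independent s (Dpairing Gam r f g)) /\
  is_formal_star_product (poisson_red R n s) (star_red R n s Gam).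
Proof.
split; last exact: star_red_formal.
by move=> r f g sf sg; exact: Dpairing_independent.
Qed.
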